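(* In the multidimensional Black–Scholes setting of the context, fix $t>0$, suppose all weights $\xi_1,\dots,\xi_n$ are positive and that Assumption $(\mathcal A)$ holds for $\mathfrak B$. Put $\bar S=\bar A_1+\dots+\bar A_{\bar n}$. Then, as $x\to0$: (1) if $1\le i\le\bar n$, $e_i(t,x)=\frac{x}{\xi_i}\frac{\bar A_i}{\bar S}\left(1+O\left((\log\frac1x)^{-1}\right)\right)=x\frac{\bar w_i}{\xi_i}\left(1+O\left((\log\frac1x)^{-1}\right)\right)$; (2) if $\bar n<i\le n$, $$e_i(t,x)=x^{\sum_{j=1}^{\bar n}\bar A_jb_{ij}}S^i_0\exp\left\{\theta_it-\sum_{p,q=1}^{\bar n}b_{pi}\bar a_{pq}\left(\log\tfrac{\bar S}{\bar A_q}+\mu_{q,t}\right)\right\}\exp\left\{-\tfrac t2\sum_{p,q=1}^{\bar n}\bar a_{pq}b_{pi}b_{qi}\right\}\left(1+O\left(\left(\log\tfrac1x\right)^{-1}\right)\right).$$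
   Context: Let $\mathfrak B=(b_{ij})$ be an $n\times n$ positive definite covariance matrix, $\theta\in\mathbb R^n$, $W$ an $n$-dimensional standard Brownian motion, and asset prices $S_t=(S^1_t,\dots,S^n_t)$ with $\log S_t=\log S_0+\theta t-\frac t2\operatorname{diag}(\mathfrak B)+\mathfrak B^{1/2}W_t$ (componentwise, $\operatorname{diag}(\mathfrak B)=(b_{11},\dots,b_{nn})$), $S_0\in(0,\infty)^n$. Given weights $\xi_i$, set $\mu_{i,t}=\log S^i_0+\log|\xi_i|+\theta_it-\frac{b_{ii}t}{2}$ and $e_i(t,x)=\mathbb E[S^i_t\mid\sum_{k=1}^n\xi_kS^k_t=x]$. Let $\Delta_n=\{w\in\mathbb R^n:w_i\ge0,\sum_iw_i=1\}$, $\bar w$ the unique minimizer of $w^\top\mathfrak Bw$ over $\Delta_n$, $\bar I=\{i:\bar w_i\ne0\}$, $\bar n=|\bar I|$, with assets labeled so that $\bar I=\{1,\dots,\bar n\}$. Let $\bar{\mathfrak B}=(b_{ij})_{i,j=1}^{\bar n}$, $\bar a_{ij}$ the entries of $\bar{\mathfrak B}^{-1}$, $\bar A_k=\sum_{j=1}^{\bar n}\bar a_{kj}$. Assumption $(\mathcal A)$: for every $i\notin\bar I$, $(e^i-\bar w)^\top\mathfrak B\bar w\ne0$, with $e^i$ the $i$-th standard basis vector. *)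

(* Defs.v *)
From HB Require Import structures.
From mathcomp Require Import all_boot all_order all_algebra.
From mathcomp Require Import all_classical all_reals all_analysis.
Set Implicit Arguments. Unset Strict Implicit. Unset Printing Implicit Defensive.
Import Order.TTheory GRing.Theory Num.Theory.
Import numFieldNormedType.Exports.
Local Open Scope classical_set_scope.
Local Open Scope ring_scope.

Section BSDefs.
Context {R : realType}.

Definition pos_def n (B : 'M[R]_n) : Prop :=
  B^T = B /\ forall v : 'rV[R]_n, v != 0 -> 0 < (v *m B *m v^T) 0 0.

Definition is_psd_sqrt n (B C : 'M[R]_n) : Prop :=
  [/\ C^T = C, C *m C = B & forall v : 'rV[R]_n, 0 <= (v *m C *m v^T) 0 0].

Definition simplex n : set 'rV[R]_n :=
  [set w | (forall j, 0 <= w 0 j) /\ \sum_j w 0 j = 1].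

Definition qform n (B : 'M[R]_n) (w : 'rV[R]_n) : R := (w *m B *m w^T) 0 0.

Definition simplex_minimizer n (B : 'M[R]_n) (wbar : 'rV[R]_n) : Prop :=
  simplex wbar /\ forall w, simplex w -> qform B wbar <= qform B w.

(* Assumption (A), with assets labelled so that Ibar = {0,..,nb-1} and the
   assets outside Ibar are the  rshift nb j,  j : 'I_m *)
Definition assumptionA nb m (B : 'M[R]_(nb + m)) (wbar : 'rV[R]_(nb + m)) : Prop :=
  forall j : 'I_m, ((delta_mx 0 (rshift nb j) - wbar) *m B *m wbar^T) 0 0 != 0.

Definition mutually_independent d (T : measurableType d) (P : probability T R)
    n (W : 'I_n -> T -> R) : Prop :=
  forall A : 'I_n -> set R, (forall j, measurable (A j)) ->
    P (\bigcap_(j in [set: 'I_n]) (W j @^-1` A j)) =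
    (\prod_(j < n) P (W j @^-1` A j))%E.

(* S^i_t = S^i_0 exp(theta_i t - t b_ii / 2 + (B^{1/2} W_t)_i) *)
Definition priceS d (T : measurableType d) n (S0 theta : 'I_n -> R)
    (B C : 'M[R]_n) (t : R) (W : 'I_n -> T -> R) (i : 'I_n) (w : T) : R :=
  S0 i * expR (theta i * t - t / 2 * B i i + \sum_j C i j * W j w).

Definition cond_exp_version d (T : measurableType d) (P : probability T R)
    (Y X : T -> R) (g : R -> R) : Prop :=
  [/\ measurable_fun setT g,
      P.-integrable setT (EFin \o (g \o X)) &
      forall A : set R, measurable A ->
        (\int[P]_(w in X @^-1` A) (Y w)%:E =
         \int[P]_(w in X @^-1` A) (g (X w))%:E)%E].

Definition bigO_loginv_at0 (f F : R -> R) : Prop :=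
  exists (c delta : R), 0 < delta /\
    forall x, 0 < x < delta -> `|f x - F x| <= c * `|F x| / ln x^-1.

Definition mu_t n (S0 theta xi : 'I_n -> R) (B : 'M[R]_n) (t : R) (i : 'I_n) : R :=
  ln (S0 i) + ln `|xi i| + theta i * t - B i i * t / 2.

Definition Bbar nb m (B : 'M[R]_(nb + m)) : 'M[R]_nb := ulsubmx B.
Definition abar nb m (B : 'M[R]_(nb + m)) : 'M[R]_nb := invmx (Bbar B).
Definition Abar nb m (B : 'M[R]_(nb + m)) (k : 'I_nb) : R := \sum_j abar B k j.
Definition Sbar nb m (B : 'M[R]_(nb + m)) : R := \sum_k Abar B k.

End BSDefs.

(* Main.v *)
(** Write [X] for the sum of the assets and [m + N] for the Gaussian vector of the
    logarithms of its summands.  The Cameron-Martin formula in the direction [(1,...,1)]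
    disintegrates the law of [m + N] along [log X]: up to a constant, the density of
    [log X] at [- L] integrated against [H] is the expectation of [H y * weight y], where
    [y] is the translate of [m + N] along [(1,...,1)] with [sum_i exp (y_i) = exp (- L)].
    Hence at [x = exp (- L)] the continuous version of [e_i] is [1 / xi_i] times the
    normalized average of [exp (y_i)].

    Gaussian integration by parts on the level set shows that the residual
    [r = A (y - m) - Sig u], where [A = B^-1], [Sig = 1.A (y - m)], [u_i = exp (y_i + L)],
    has mean [0] and second moment [O(L)].  Since [B r = y - m - Sig B u], the
    Karush-Kuhn-Tucker conditions for [wbar], strict by assumption (A), force [u] to
    concentrate at [wbar], and [<u> = wbar + O(1/L)]: this is (1).  With Jensen's inequality
    also [<log u_i> = log wbar_i + O(1/L)] on the support of [wbar].

    For (2), split [e^i = c + alpha] with [c] supported on [Ibar] and [B alpha = 0] there.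
    Tilting by [exp (alpha.y)] produces an explicit factor and translates [m] off [Ibar]
    only, which changes the mass by a factor [1 + O(1/L)]; Jensen's inequality, applied
    before and after a tilt by [c], squeezes the average of [exp (c.y)]. *)
Require Import Defs.
From HB Require Import structures.
From mathcomp Require Import all_boot all_order all_algebra.
From mathcomp Require Import all_classical all_reals all_analysis.
From mathcomp Require Import measurable_realfun ring lra.
Set Implicit Arguments. Unset Strict Implicit. Unset Printing Implicit Defensive.
Import Order.TTheory GRing.Theory Num.Theory.
Import numFieldNormedType.Exports.
Local Open Scope classical_set_scope.
Local Open Scope ring_scope.

(** * The Cameron-Martin formula *)

(** When some asset is off [Ibar], [wbar] lies on the boundary of the simplex, so there is no
    Laplace expansion at an interior critical point; moments of [r] replace it. The unit of error is
    [1 + P^2 / L], with [P] the l1 norm of [B r]: the bounds on a level set hold pointwise as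
    multiples of it, and its average is bounded because the second moment of [r] is [O(L)]. The
    squeeze by Jensen's inequality works for functions of the [y_i] with [i] in [Ibar], where
    [log u_i] stays bounded on average; off [Ibar] that average tends to minus infinity at least
    linearly in [L]. This is the reason for [alpha], whose tilt moves only those coordinates of [m].
    That the mass then changes little does not follow from [<u_i> = O(1/L)]: the change involves
    [Sig * u_i] with [Sig] of order [L], so a faster decay of [<u_i>] off [Ibar] has to be shown
    first. *)

Section IntegralDensity.
Import HBNNSimple.

(** Change of variables for the image under [phi] of the measure of density [f], by increasing
    simple functions. It serves with [phi] the identity for the normal density, with [f] an
    indicator for the law of one coordinate on an event, and with [f] an exponential tilt. *)
Lemma ge0_integral_density d1 d2 (X : measurableType d1) (Y : measurableType d2)
    (R : realType) (mu : {measure set X -> \bar R}) (nu : {measure set Y -> \bar R})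
    (phi : X -> Y) (f : X -> R) (F : Y -> \bar R) :
  measurable_fun [set: X] phi -> measurable_fun [set: X] f -> (forall x, 0 <= f x) ->
  (forall B, measurable B -> nu B = \int[mu]_(x in phi @^-1` B) (f x)%:E)%E ->
  measurable_fun [set: _] F -> (forall y, 0 <= F y)%E ->
  (\int[nu]_y F y = \int[mu]_x (F (phi x) * (f x)%:E))%E.
Proof.
move=> mphi mf f0 nuE mF F0.
pose h := nnsfun_approx measurableT mF.
have hF y : F y = limn (fun n => (h n y)%:E).
  by apply/esym/cvg_lim => //; exact: cvg_nnsfun_approx.
have mhphi n : measurable_fun setT (fun x => (h n (phi x))).
  by apply: measurableT_comp.
have ndh y : {homo (fun n => h n y) : a b / (a <= b)%N >-> a <= b}.
  by move=> a b ab; exact/lefP/nd_nnsfun_approx.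
have -> : (\int[nu]_y F y = limn (fun n => \int[nu]_y (h n y)%:E))%E.
  under eq_integral do rewrite hF.
  apply: monotone_convergence => //.
  - by move=> n; apply/measurable_EFinP.
  - by move=> n y _; rewrite lee_fin.
  - by move=> y _ a b ab; rewrite lee_fin ndh.
have -> : (\int[mu]_x (F (phi x) * (f x)%:E) =
    limn (fun n => \int[mu]_x ((h n (phi x))%:E * (f x)%:E)))%E.
  have Ff x : (F (phi x) * (f x)%:E = limn (fun n => (h n (phi x))%:E * (f x)%:E))%E.
    by apply/esym/cvg_lim => //; apply: cvgeZr => //; exact: cvg_nnsfun_approx.
  under eq_integral do rewrite Ff.
  apply: monotone_convergence => //.
  - by move=> n; apply/measurable_EFinP/measurable_funM.
  - by move=> n y _; rewrite lee_fin mulr_ge0.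
  - by move=> y _ a b ab; rewrite lee_fin ler_wpM2r// ndh.
congr (limn _); apply/funext => n.
transitivity (\int[nu]_y (\sum_(r \in range (h n)) (r * \1_(h n @^-1` [set r]) y)%:E))%E.
  by apply: eq_integral => t tE; rewrite /= fimfunE -fsumEFin.
rewrite ge0_integral_fsum//=; last 2 first.
- by move=> r; apply/measurable_EFinP/measurable_funM => //.
- by move=> r y _; exact: nnfun_muleindic_ge0.
have mh r : measurable (h n @^-1` [set r]).
  by rewrite -[X in measurable X]setTI; exact: measurable_funP.
have mind r : measurable_fun setT (fun x => \1_(h n @^-1` [set r]) (phi x) : R).
  exact: measurableT_comp.
transitivity (\int[mu]_x (\sum_(r \in range (h n)) ((r * \1_(h n @^-1` [set r]) (phi x)) * f x)%:E))%E; last first.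
  apply: eq_integral => x _.
  rewrite [in RHS]fimfunE -fsumEFin// ge0_mule_fsuml//.
  by move=> r; exact: nnfun_muleindic_ge0.
rewrite ge0_integral_fsum//=; last 2 first.
- by move=> r; apply/measurable_EFinP; do 2 apply: measurable_funM => //.
- by move=> r x _; rewrite EFinM mule_ge0 ?lee_fin//; exact: nnfun_muleindic_ge0.
apply: eq_fsbigr => r rhn.
have r0 : 0 <= r by move: rhn; rewrite inE => -[t _ <-].
under [RHS]eq_integral do rewrite -mulrA EFinM.
rewrite integralZl_indic_nnsfun// integral_indic// setIT nuE//.
rewrite ge0_integralZl//=.
- congr (_ * _)%E; rewrite integral_mkcond/=.
  apply: eq_integral => x _; rewrite patchE indicE.
  rewrite (_ : (x \in _) = (phi x \in h n @^-1` [set r])); last first.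
    by apply/idP/idP; rewrite !inE.
  by case: ifP => _; rewrite ?mul1r ?mul0r.
- by apply/measurable_EFinP; apply: measurable_funM => //.
- by move=> x _; rewrite lee_fin mulr_ge0.
Qed.

End IntegralDensity.

(** By uniqueness of Lebesgue measure: translation preserves the length of half-open intervals. *)
Lemma ge0_integral_lebesgue_shift (R : realType) (c : R) (F : R -> \bar R) :
  measurable_fun [set: _] F -> (forall y, 0 <= F y)%E ->
  (\int[lebesgue_measure]_x F (x + c)%R = \int[lebesgue_measure]_x F x)%E.
Proof.
move=> mF F0.
have mphi : measurable_fun [set: measurableTypeR R]
    ((fun x : R => x + c) : _ -> measurableTypeR R).
  exact: measurable_funD.
pose phi : measurableTypeR R -> measurableTypeR R := fun x : R => x + c.
have mS (A : set (measurableTypeR R)) : measurable A ->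
    lebesgue_measure A = pushforward (@lebesgue_measure R) phi A.
  apply: lebesgue_measure_unique => // _ [[a b]] _ <-.
  transitivity (lebesgue_measure (phi @^-1` `]a, b])); last by [].
  rewrite (_ : phi @^-1` _ = `]a - c, b - c]%classic); last first.
    by apply/seteqP; split => x /=; rewrite !in_itv/= ltrBlDr lerBrDr.
  rewrite !lebesgue_measure_itv/= !lte_fin ltrD2r; case: ifP => // _.
  by rewrite -!EFinB; congr (EFin _); lra.
transitivity (\int[pushforward (@lebesgue_measure R) phi]_x F x)%E; last first.
  by apply: eq_measure_integral => // A mA _; exact/esym/mS.
by rewrite ge0_integral_pushforward.
Qed.

Section WithDensity.
Context d (X : measurableType d) (R : realType) (mu : {measure set X -> \bar R}).

(** Packaged as a measure, so that a tilted law can be compared with a translated law by uniqueness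
    of measures. *)
Definition with_density (f : X -> R) : set X -> \bar R :=
  fun A => (\int[mu]_(x in A) (f x)%:E)%E.

Variable f : X -> R.
Hypothesis mf : measurable_fun [set: X] f.
Hypothesis f0 : forall x, 0 <= f x.

Let with_density0 : with_density f set0 = 0%E.
Proof. exact: integral_set0. Qed.

Let with_density_ge0 A : (0 <= with_density f A)%E.
Proof. by apply: integral_ge0 => x _; rewrite lee_fin. Qed.

Let with_density_sigma_additive : semi_sigma_additive (with_density f).
Proof.
move=> A mA tA mUA; rewrite /with_density ge0_integral_bigcup//.
- by apply: is_cvg_ereal_nneg_natsum_cond => k _ _; exact: with_density_ge0.
- by apply/measurable_EFinP; exact: measurable_funTS.
- by move=> x _; rewrite lee_fin.
Qed.

HB.instance Definition _ := isMeasure.Build _ _ _ (with_density f)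
  with_density0 with_density_ge0 with_density_sigma_additive.
End WithDensity.

Definition box n (R : realType) (A : 'I_n -> set R) : set (n.-tuple R) :=
  [set v | forall k, A k (tnth v k)].

(** Boxes are stable under intersection and are the events whose probability independence gives;
    that they generate is what uniqueness of measures asks for. *)
Lemma measurable_tuple_boxes n (R : realType) :
  @measurable _ (n.-tuple R) = <<s [set B | exists2 A : 'I_n -> set R,
    (forall k, measurable (A k)) & B = box A] >>.
Proof.
apply/seteqP; split => B.
- apply: smallest_sub; first exact: smallest_sigma_algebra.
  rewrite -bigcup_seq => _ [k _] [A mA <-]; rewrite setTI.
  apply: sub_sigma_algebra; exists (fun i => if i == k then A else setT).
    by move=> i; case: ifP.
  apply/seteqP; split => v /=; rewrite /box/=.
    by move=> Av i; case: eqP => // ->.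
  by move=> /(_ k); rewrite eqxx.
- apply: smallest_sub; first exact: sigma_algebra_measurable.
  move=> _ [A mA ->].
  rewrite (_ : box A = \big[setI/setT]_(k < n) ((fun v : n.-tuple R => tnth v k) @^-1` A k)).
    apply: bigsetI_measurable => k _.
    by rewrite -[X in measurable X]setTI; exact: measurable_tnth.
  apply/seteqP; split => v; rewrite -bigcap_seq/=.
    by move=> Av k _; exact: Av.
  by move=> Av k; apply: Av; rewrite /= mem_index_enum.
Qed.

(** Vectors are functions on ['I_n], while the product sigma-algebra lives on tuples; measurability
    is read through [tnth]. *)
Definition vmeasurable n (R : realType) (F : ('I_n -> R) -> R) : Prop :=
  measurable_fun [set: n.-tuple R] (fun v => F (tnth v)).

Lemma vmeasurable_comp n (R : realType) d (T : measurableType d)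
    (F : ('I_n -> R) -> R) (N : 'I_n -> T -> R) :
  vmeasurable F -> (forall i, measurable_fun [set: T] (N i)) ->
  measurable_fun [set: T] (fun w => F (N ^~ w)).
Proof.
move=> mF mN.
rewrite (_ : (fun w => _) = (fun v : n.-tuple R => F (tnth v)) \o
    (fun w => [tuple N i w | i < n])); last first.
  apply/funext => w /=; congr F; apply/funext => i; by rewrite tnth_mktuple.
apply: measurableT_comp => //; apply/measurable_fun_tnthP => i.
by rewrite (_ : _ \o _ = N i)//; apply/funext => w /=; rewrite tnth_mktuple.
Qed.

Lemma vmeasurable_subst n (R : realType) (F : ('I_n -> R) -> R)
    (G : 'I_n -> ('I_n -> R) -> R) :
  vmeasurable F -> (forall i, vmeasurable (G i)) ->
  vmeasurable (fun v => F (fun i => G i v)).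
Proof.
by move=> mF mG; exact: (vmeasurable_comp (N := fun i v => G i (tnth v)) mF).
Qed.

Lemma vmeasurable_coord n (R : realType) (i : 'I_n) :
  vmeasurable (fun v : 'I_n -> R => v i).
Proof. exact: measurable_tnth. Qed.

Section CameronMartin.
Context {R : realType} d (T : measurableType d) (P : probability T R)
  (n : nat) (W : 'I_n -> T -> R) (t : R).
Hypothesis t_gt0 : 0 < t.
Hypothesis mW : forall j, measurable_fun setT (W j).
Hypothesis normalW : forall j (A : set R), measurable A ->
  P (W j @^-1` A) = normal_prob 0 (Num.sqrt t) A.
Hypothesis indepW : mutually_independent P W.

(** Completing the square: the tilt turns the centred density of variance [t] into its translate by
    [t * a]. *)
Lemma normal_shift (a : R) (A : set R) : measurable A ->
  (\int[normal_prob 0 (Num.sqrt t)]_x (\1_A x * expR (a * x - t / 2 * a ^+ 2))%:E =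
   normal_prob 0 (Num.sqrt t) ((fun x => x + t * a)%R @^-1` A))%E.
Proof.
move=> mA.
have s0 : Num.sqrt t != 0 by rewrite gt_eqF// sqrtr_gt0.
have mE : measurable_fun setT (fun x : R => expR (a * x - t / 2 * a ^+ 2)).
  by apply: measurableT_comp => //; apply: measurable_funB => //; exact: measurable_funM.
rewrite (@ge0_integral_density _ _ _ _ _ lebesgue_measure _ id (normal_pdf 0 (Num.sqrt t)))//; first last.
- by apply/measurable_EFinP; apply: measurable_funM => //; exact: measurable_indic.
- by move=> x; exact: normal_pdf_ge0.
- exact: measurable_normal_pdf.
pose G (x : R) := (\1_A x * normal_pdf 0 (Num.sqrt t) (x - t * a))%:E.
have mpdf := measurable_normal_pdf 0 (Num.sqrt t).
transitivity (\int[lebesgue_measure]_x G x)%E.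
  apply: eq_integral => x _; rewrite /G/= -EFinM; congr EFin.
  rewrite /normal_pdf (negbTE s0) /normal_fun.
  have -> : - (x - t * a - 0) ^+ 2 / (Num.sqrt t ^+ 2 *+ 2) =
      (a * x - t / 2 * a ^+ 2) + - (x - 0) ^+ 2 / (Num.sqrt t ^+ 2 *+ 2).
    by rewrite sqr_sqrtr ?ltW//; field; exact: lt0r_neq0.
  by rewrite [in RHS]expRD; ring.
rewrite -(ge0_integral_lebesgue_shift (t * a)).
- rewrite /G /normal_prob [RHS]integral_mkcond; apply: eq_integral => x _.
  rewrite patchE /= indicE addrK.
  rewrite (_ : (x + t * a \in A) = (x \in (fun x => x + t * a) @^-1` A)); last first.
    by apply/idP/idP; rewrite !inE.
  by case: ifP => _; rewrite ?mul1r ?mul0r.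
- apply/measurable_EFinP; apply: measurable_funM => //.
  apply: measurableT_comp => //; exact: measurable_funB.
- by move=> x; rewrite lee_fin mulr_ge0// normal_pdf_ge0.
Qed.

Let coord_law (j : 'I_n) (A : 'I_n -> set R) (B : set R) :
  (forall k, measurable (A k)) -> measurable B ->
  P (\bigcap_(k in [set: 'I_n]) (W k @^-1` (if k == j then B else A k))) =
  (normal_prob 0 (Num.sqrt t) B * \prod_(k < n | k != j) P (W k @^-1` A k))%E.
Proof.
move=> mA mB; rewrite (@indepW (fun k => if k == j then B else A k)).
  rewrite (bigD1 j)//= eqxx normalW//; congr (_ * _)%E.
  by apply: eq_bigr => k /negbTE ->.
by move=> k; case: ifP.
Qed.

Let mpre k B : measurable B -> measurable (W k @^-1` B).
Proof. by move=> mB; rewrite -[X in measurable X]setTI; exact: mW. Qed.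

Let mcap (A : 'I_n -> set R) : (forall k, measurable (A k)) ->
  measurable (\bigcap_(k in [set: 'I_n]) (W k @^-1` A k)).
Proof.
move=> mA; rewrite (_ : \bigcap_(k in _) _ = \big[setI/setT]_(k < n) (W k @^-1` A k)).
  by apply: bigsetI_measurable => k _; exact: mpre.
apply/seteqP; split => w; rewrite -bigcap_seq/=.
  by move=> Aw k _; exact: Aw.
by move=> Aw k _; apply: Aw; rewrite /= mem_index_enum.
Qed.

Let cameron_martin_box (j : 'I_n) (a : R) (A : 'I_n -> set R) :
  (forall k, measurable (A k)) ->
  (P (\bigcap_(k in [set: 'I_n]) ((fun w => W k w + (if k == j then t * a else 0))%R @^-1` A k)) =
   \int[P]_(w in \bigcap_(k in [set: 'I_n]) (W k @^-1` A k))
     (expR (a * W j w - t / 2 * a ^+ 2))%:E)%E.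
Proof.
move=> mA.
pose B := (fun x => x + t * a) @^-1` A j.
have mB : measurable B.
  by rewrite -[X in measurable X]setTI; apply: measurable_funD.
rewrite (_ : \bigcap_(k in _) _ =
    \bigcap_(k in [set: 'I_n]) (W k @^-1` (if k == j then B else A k))); last first.
  apply: eq_bigcapr => k _; case: eqP => [->//|_].
  by rewrite (_ : (fun w => _) = W k)//; apply/funext => w; rewrite addr0.
rewrite coord_law//.
set c := (\prod_(k < n | _) _)%E.
have c0 : (0 <= c)%E by apply: prode_ge0 => k _; apply: measure_ge0; exact: mpre.
have cfin : c \is a fin_num.
  by apply: prode_fin_num => k _; apply: fin_num_measure; exact: mpre.
pose k0 : {nonneg R} := NngNum (fine_ge0 c0).
(* On the event [E], which concerns the other coordinates only, the law of [W j] is [c] times the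
   normal law; this puts the one-dimensional formula back under [P]. *)
pose E := \bigcap_(k in [set: 'I_n]) (W k @^-1` (if k == j then setT else A k)).
have mE : measurable E.
  by apply: (mcap (A := fun k => if k == j then setT else A k)) => k; case: ifP.
pose F x := (\1_(A j) x * expR (a * x - t / 2 * a ^+ 2))%:E.
have mF : measurable_fun [set: R] F.
  apply/measurable_EFinP; apply: measurable_funM; first exact: measurable_indic.
  by apply: measurableT_comp => //; apply: measurable_funB => //; exact: measurable_funM.
have F0 x : (0 <= F x)%E by rewrite lee_fin mulr_ge0// expR_ge0.
have := @ge0_integral_density _ _ _ _ _ P (mscale k0 (normal_prob 0 (Num.sqrt t)))
  (W j) (\1_E) F.
rewrite ge0_integral_mscale// /F normal_shift// => D.
rewrite muleC -[c]fineK// [LHS]D//; first last.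
- move=> C mC; transitivity ((fine c)%:E * normal_prob 0 (Num.sqrt t) C)%E => //.
  rewrite fineK//.
  rewrite integral_indic//; last exact: mpre.
  rewrite muleC -coord_law//; congr (P _).
  apply/seteqP; split => w.
    move=> H; split=> [k _|]; first by have := H k I; case: ifP.
    by have := H j I; rewrite /= eqxx.
  move=> [H Cw] k _; have := H k I; rewrite /=; case: eqP => // -> _; exact: Cw.
- exact: mW.
rewrite [RHS]integral_mkcond; apply: eq_integral => w _.
rewrite patchE -EFinM !indicE.
have -> : (w \in \bigcap_(k in [set: 'I_n]) (W k @^-1` A k)) =
    (W j w \in A j) && (w \in E).
  apply/idP/andP; rewrite !inE.
    move=> H; split; first exact: (H j I).
    by move=> k _; case: eqP => // _; exact: H.
  move=> [Aw H] k _; have := H k I; case: eqP => // -> _; exact: Aw.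
by case: (_ \in A j); case: (_ \in E); rewrite /= ?mul1r ?mul0r ?mulr1 ?mulr0.
Qed.

Let tilt (j : 'I_n) (a : R) (w : T) : R := expR (a * W j w - t / 2 * a ^+ 2).

Let measurable_tilt j a : measurable_fun [set: T] (tilt j a).
Proof.
by apply: measurableT_comp => //; apply: measurable_funB => //; exact: measurable_funM.
Qed.

(** Both sides are integrals against finite measures on tuples, which agree on boxes by
    [cameron_martin_box]. *)
Let cameron_martin_coord (j : 'I_n) (a : R) (F : ('I_n -> R) -> R) :
  vmeasurable F -> (forall v, 0 <= F v) ->
  (\int[P]_w (F (fun k => W k w + (if k == j then t * a else 0))%R)%:E =
   \int[P]_w (F (W ^~ w) * expR (a * W j w - t / 2 * a ^+ 2))%:E)%E.
Proof.
move=> mF F0.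
have mf : measurable_fun [set: T] (tilt j a) := @measurable_tilt j a.
have f0 w : 0 <= tilt j a w by exact: expR_ge0.
pose tupW (w : T) : n.-tuple R := [tuple W k w | k < n].
pose tupV (w : T) : n.-tuple R := [tuple W k w + (if k == j then t * a else 0) | k < n].
have mtupW : measurable_fun [set: T] tupW.
  apply/measurable_fun_tnthP => k; rewrite (_ : _ \o _ = W k)//.
  by apply/funext => w; rewrite /= tnth_mktuple.
have mtupV : measurable_fun [set: T] tupV.
  apply/measurable_fun_tnthP => k.
  rewrite (_ : _ \o _ = (fun w => W k w + (if k == j then t * a else 0))).
    exact: measurable_funD.
  by apply/funext => w; rewrite /= tnth_mktuple.
have lawE B : measurable B -> (pushforward P tupV B =
    \int[P]_(w in tupW @^-1` B) (tilt j a w)%:E)%E.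
  move=> mB; transitivity (pushforward (with_density P (tilt j a)) tupW B) => //.
  apply: (@measure_unique _ R _ [set B | exists2 A : 'I_n -> set R,
    (forall k, measurable (A k)) & B = box A] (fun=> setT)
    _ _ _ _ (pushforward P tupV) (pushforward (with_density P (tilt j a)) tupW)) => //.
  - exact: measurable_tuple_boxes.
  - move=> _ _ [A1 mA1 ->] [A2 mA2 ->]; exists (fun k => A1 k `&` A2 k).
      by move=> k; exact: measurableI.
    by apply/seteqP; split => v; rewrite /box/=; [move=> [H1 H2] k|
      move=> H; split => k; have [] := H k].
  - by move=> _; exists (fun=> setT) => //; apply/seteqP; split.
  - by apply/seteqP; split => // v _; exists 0%N.
  - move=> _ [A mA ->]; transitivity (P (tupV @^-1` box A)) => //.
    transitivity (\int[P]_(w in tupW @^-1` box A) (tilt j a w)%:E)%E => //.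
    rewrite (_ : tupV @^-1` _ = \bigcap_(k in [set: 'I_n])
        ((fun w => W k w + (if k == j then t * a else 0)) @^-1` A k)); last first.
      apply/seteqP; split => w H k => [_|]; have := H k; rewrite /= tnth_mktuple//.
      by apply.
    rewrite cameron_martin_box//; congr integral.
    apply/seteqP; split => w H k => [|_]; have := H k; rewrite /= tnth_mktuple//.
    by apply.
  - move=> _; apply: (@le_lt_trans _ _ 1%E); last by rewrite ltry.
    exact: (probability_le1 P (measurableT : measurable (tupV @^-1` setT))).
pose F' := fun v : n.-tuple R => (F (tnth v))%:E.
have mF' : measurable_fun [set: n.-tuple R] F' by apply/measurable_EFinP.
have F'0 v : (0 <= F' v)%E by rewrite lee_fin.
transitivity (\int[pushforward P tupV]_v F' v)%E.
  rewrite ge0_integral_pushforward// preimage_setT; apply: eq_integral => w _ /=.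
  by congr (F _)%:E; apply/funext => k; rewrite tnth_mktuple.
rewrite (@ge0_integral_density _ _ _ _ _ P _ tupW (tilt j a))//.
apply: eq_integral => w _; rewrite /F' -EFinM; congr ((F _ * _)%:E).
by apply/funext => k; rewrite tnth_mktuple.
Qed.

(** One coordinate at a time; [uniq] ensures that the shifts still to come leave the [W j] of the
    exponent untouched. *)
Let cameron_martin_seq (a : 'I_n -> R) (s : seq 'I_n) (F : ('I_n -> R) -> R) :
  uniq s -> vmeasurable F -> (forall v, 0 <= F v) ->
  (\int[P]_w (F (fun k => W k w + (if k \in s then t * a k else 0))%R)%:E =
   \int[P]_w (F (W ^~ w) *
     expR (\sum_(k <- s) (a k * W k w - t / 2 * a k ^+ 2)))%:E)%E.
Proof.
elim: s F => [F _ _ _|j s IH F /= /andP[js us] mF F0].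
  apply: eq_integral => w _; rewrite big_nil expR0 mulr1; congr (F _)%:E.
  by apply/funext => k; rewrite in_nil addr0.
pose sh (v : 'I_n -> R) k := v k + (if k \in s then t * a k else 0).
have msh k : vmeasurable (fun v => sh v k).
  by apply: measurable_funD => //; exact: measurable_tnth.
transitivity (\int[P]_w (F (sh (fun k => W k w + (if k == j then t * a j else 0))))%:E)%E.
  apply: eq_integral => w _; congr (F _)%:E; apply/funext => k.
  rewrite /sh in_cons; case: eqP => [->|_] /=; last by rewrite addr0.
  by rewrite (negbTE js) addr0.
rewrite (cameron_martin_coord j (a j) (F := fun v => F (sh v)))//; last first.
  exact: vmeasurable_subst.
pose G (v : 'I_n -> R) := F v * expR (a j * v j - t / 2 * a j ^+ 2).
transitivity (\int[P]_w (G (sh (W ^~ w)))%:E)%E.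
  by apply: eq_integral => w _; rewrite /G [in sh _ j]/sh (negbTE js) addr0.
rewrite IH//.
- apply: eq_integral => w _; rewrite /G big_cons -mulrA -expRD//.
- apply: measurable_funM => //; apply: measurableT_comp => //.
  apply: measurable_funB => //; apply: measurable_funM => //.
  exact: measurable_tnth.
- by move=> v; rewrite mulr_ge0// expR_ge0.
Qed.

Lemma cameron_martin (a : 'I_n -> R) (F : ('I_n -> R) -> R) :
  vmeasurable F -> (forall v, 0 <= F v) ->
  (\int[P]_w (F (fun k => W k w + t * a k)%R)%:E =
   \int[P]_w (F (W ^~ w) *
     expR (\sum_k (a k * W k w - t / 2 * a k ^+ 2)))%:E)%E.
Proof.
move=> mF F0; rewrite -(cameron_martin_seq _ (index_enum_uniq _))//.
apply: eq_integral => w _; congr (F _)%:E; apply/funext => k.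
by rewrite mem_index_enum.
Qed.
End CameronMartin.

(** * Gaussian expectations *)

Section Vectors.
Context {R : realType} {n : nat}.
Implicit Types (u v : 'I_n -> R) (M : 'M[R]_n).

Definition dotv u v : R := \sum_i u i * v i.
Definition mulv M v : 'I_n -> R := fun i => \sum_j M i j * v j.
Definition norm1 v : R := \sum_i `|v i|.

Lemma dotvC u v : dotv u v = dotv v u.
Proof. by apply: eq_bigr => i _; rewrite mulrC. Qed.

Lemma dotvD u v1 v2 : dotv u (fun i => v1 i + v2 i) = dotv u v1 + dotv u v2.
Proof. by rewrite -big_split; apply: eq_bigr => i _; rewrite mulrDr. Qed.

Lemma dotvB u v1 v2 : dotv u (fun i => v1 i - v2 i) = dotv u v1 - dotv u v2.
Proof. by rewrite -sumrB; apply: eq_bigr => i _; rewrite mulrBr. Qed.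

Lemma dotvZ u k v : dotv u (fun i => k * v i) = k * dotv u v.
Proof. by rewrite big_distrr; apply: eq_bigr => i _; rewrite /= mulrCA. Qed.

Lemma mulvD M v1 v2 i : mulv M (fun i => v1 i + v2 i) i = mulv M v1 i + mulv M v2 i.
Proof. exact: (dotvD (M i)). Qed.

Lemma mulvB M v1 v2 i : mulv M (fun i => v1 i - v2 i) i = mulv M v1 i - mulv M v2 i.
Proof. exact: (dotvB (M i)). Qed.

Lemma mulvZ M k v i : mulv M (fun i => k * v i) i = k * mulv M v i.
Proof. exact: (dotvZ (M i)). Qed.

Lemma mulv1 v : mulv 1%:M v = v.
Proof.
apply/funext => i; rewrite /mulv (bigD1 i)//= big1 => [|j ji].
  by rewrite mxE eqxx mul1r addr0.
by rewrite mxE eq_sym (negbTE ji) mul0r.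
Qed.

Lemma mulvM M1 M2 v : mulv M1 (mulv M2 v) = mulv (M1 *m M2) v.
Proof.
apply/funext => i; rewrite /mulv.
under eq_bigr do rewrite big_distrr.
rewrite exchange_big; apply: eq_bigr => k _; rewrite mxE big_distrl.
by apply: eq_bigr => j _; rewrite /= mulrA.
Qed.

Lemma dotv_mulv M u v : M^T = M -> dotv u (mulv M v) = dotv (mulv M u) v.
Proof.
move=> MT; rewrite /dotv /mulv.
under eq_bigr do rewrite big_distrr.
rewrite exchange_big; apply: eq_bigr => k _; rewrite big_distrl.
by apply: eq_bigr => j _; rewrite /= -{1}MT mxE mulrCA mulrA.
Qed.

Lemma norm1_ge0 v : 0 <= norm1 v.
Proof. exact: sumr_ge0. Qed.

Lemma coord_le_norm1 v i : `|v i| <= norm1 v.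
Proof. by rewrite /norm1 (bigD1 i)//= lerDl sumr_ge0. Qed.

Lemma norm1D u v : norm1 (fun i => u i + v i) <= norm1 u + norm1 v.
Proof. by rewrite /norm1 -big_split; apply: ler_sum => i _; exact: ler_normD. Qed.

Lemma norm1Z k v : norm1 (fun i => k * v i) = `|k| * norm1 v.
Proof. by rewrite /norm1 big_distrr; apply: eq_bigr => i _; rewrite normrM. Qed.

Lemma norm_dotv_le u v : `|dotv u v| <= norm1 u * norm1 v.
Proof.
apply: (le_trans (ler_norm_sum _ _ _)).
rewrite /norm1 big_distrl; apply: ler_sum => i _ /=.
by rewrite normrM ler_wpM2l// coord_le_norm1.
Qed.

End Vectors.

(** * Observables of exponential and of linear growth *)

Section Tame.
Context {R : realType} {n : nat}.
Implicit Types (F G : ('I_n -> R) -> R).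

(* Exponential growth makes these observables integrable against every Gaussian law. *)
Definition tame F : Prop :=
  vmeasurable F /\ exists2 k, 0 <= k & forall v, `|F v| <= k * expR (k * norm1 v).

(** Exponentials of these functions are tame, and tame functions stay tame when such functions are
    substituted for the coordinates. *)
Definition lingrowth F : Prop :=
  vmeasurable F /\ exists2 k, 0 <= k & forall v, `|F v| <= k * (1 + norm1 v).

Lemma tame_intro F a b : vmeasurable F -> 0 <= a -> 0 <= b ->
  (forall v, `|F v| <= a * expR (b * norm1 v)) -> tame F.
Proof.
move=> mF a0 b0 H; split=> //; exists (a + b); first exact: addr_ge0.
move=> v; apply: (le_trans (H v)); apply: ler_pM => //.
  by rewrite lerDl.
by rewrite ler_expR ler_wpM2r ?norm1_ge0// lerDr.
Qed.

Lemma tame_le F G : vmeasurable F -> tame G -> (forall v, `|F v| <= `|G v|) -> tame F.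
Proof.
move=> mF [mG [k k0 H]] FG; split=> //; exists k => // v.
exact: le_trans (FG v) (H v).
Qed.

Lemma tame_bounded F c : vmeasurable F -> (forall v, `|F v| <= c) -> tame F.
Proof.
move=> mF H; apply: (@tame_intro F `|c| 0) => // v.
by rewrite mul0r expR0 mulr1; exact: le_trans (H v) (ler_norm _).
Qed.

Lemma tame_cst c : tame (fun=> c).
Proof. by apply: (@tame_bounded _ `|c|) => //; exact: measurable_cst. Qed.

Lemma tameN F : tame F -> tame (fun v => - F v).
Proof.
move=> tF; apply: (tame_le _ tF) => [|v]; last by rewrite normrN.
by apply: measurableT_comp => //; case: tF.
Qed.

Lemma tame_norm F : tame F -> tame (fun v => `|F v|).
Proof.
move=> tF; apply: (tame_le _ tF) => [|v]; last by rewrite normr_id.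
by apply: measurableT_comp => //; case: tF.
Qed.

Lemma tameD F G : tame F -> tame G -> tame (fun v => F v + G v).
Proof.
move=> [mF [k k0 H]] [mG [l l0 K]].
apply: (@tame_intro _ (k + l) (k + l)); rewrite ?addr_ge0//.
  exact: measurable_funD.
move=> v; apply: (le_trans (ler_normD _ _)); rewrite mulrDl lerD//.
  by apply: (le_trans (H v)); rewrite ler_wpM2l// ler_expR ler_wpM2r ?norm1_ge0// lerDl.
by apply: (le_trans (K v)); rewrite ler_wpM2l// ler_expR ler_wpM2r ?norm1_ge0// lerDr.
Qed.

Lemma tameB F G : tame F -> tame G -> tame (fun v => F v - G v).
Proof. by move=> tF tG; apply: tameD => //; exact: tameN. Qed.

Lemma tameM F G : tame F -> tame G -> tame (fun v => F v * G v).
Proof.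
move=> [mF [k k0 H]] [mG [l l0 K]].
apply: (@tame_intro _ (k * l) (k + l)); rewrite ?addr_ge0 ?mulr_ge0//.
  exact: measurable_funM.
move=> v; rewrite normrM mulrDl expRD mulrACA.
by apply: ler_pM.
Qed.

Lemma tameZ c F : tame F -> tame (fun v => c * F v).
Proof. by move=> tF; apply: tameM => //; exact: tame_cst. Qed.

Lemma tameX F k : tame F -> tame (fun v => F v ^+ k).
Proof.
move=> tF; elim: k => [|k IH]; first exact: (tame_cst 1).
by under eq_fun do rewrite exprS; exact: tameM.
Qed.

Lemma tame_sum I (s : seq I) (P : pred I) (F : I -> ('I_n -> R) -> R) :
  (forall i, P i -> tame (F i)) -> tame (fun v => \sum_(i <- s | P i) F i v).
Proof.
move=> tF; elim: s => [|i s IH].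
  by under eq_fun do rewrite big_nil; exact: tame_cst.
case Pi : (P i); under eq_fun do rewrite big_cons Pi; last exact: IH.
by apply: tameD => //; exact: tF.
Qed.

Lemma lingrowthD F G : lingrowth F -> lingrowth G -> lingrowth (fun v => F v + G v).
Proof.
move=> [mF [k k0 H]] [mG [l l0 K]]; split; first exact: measurable_funD.
exists (k + l) => [|v]; first exact: addr_ge0.
by apply: (le_trans (ler_normD _ _)); rewrite mulrDl lerD.
Qed.

Lemma lingrowthZ c F : lingrowth F -> lingrowth (fun v => c * F v).
Proof.
move=> [mF [k k0 H]]; split; first exact: measurable_funM.
exists (`|c| * k) => [|v]; first exact: mulr_ge0.
by rewrite normrM -mulrA ler_wpM2l.
Qed.

Lemma lingrowthN F : lingrowth F -> lingrowth (fun v => - F v).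
Proof.
move=> /(lingrowthZ (-1)); rewrite (_ : (fun v => _) = fun v => - F v)//.
by apply/funext => v; rewrite mulN1r.
Qed.

Lemma lingrowthB F G : lingrowth F -> lingrowth G -> lingrowth (fun v => F v - G v).
Proof. by move=> lF lG; apply: lingrowthD => //; exact: lingrowthN. Qed.

Lemma lingrowth_cst c : lingrowth (fun=> c).
Proof.
split; first exact: measurable_cst.
exists `|c| => // v; rewrite ler_peMr// lerDl; exact: norm1_ge0.
Qed.

Lemma lingrowth_coord i : lingrowth (fun v => v i).
Proof.
split; first exact: vmeasurable_coord.
exists 1 => // v; rewrite mul1r; apply: (le_trans (coord_le_norm1 v i)).
by rewrite lerDr.
Qed.

Lemma lingrowth_norm1 : lingrowth (@norm1 R n).
Proof.
split; first by apply: measurable_sum => i; apply: measurableT_comp => //; exact: measurable_tnth.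
by exists 1 => // v; rewrite mul1r ger0_norm ?norm1_ge0// lerDr.
Qed.

Lemma lingrowth_sum I (s : seq I) (P : pred I) (F : I -> ('I_n -> R) -> R) :
  (forall i, P i -> lingrowth (F i)) -> lingrowth (fun v => \sum_(i <- s | P i) F i v).
Proof.
move=> tF; elim: s => [|i s IH].
  by under eq_fun do rewrite big_nil; exact: lingrowth_cst.
case Pi : (P i); under eq_fun do rewrite big_cons Pi; last exact: IH.
by apply: lingrowthD => //; exact: tF.
Qed.

Lemma lingrowth_dotv u (F : 'I_n -> ('I_n -> R) -> R) :
  (forall i, lingrowth (F i)) -> lingrowth (fun v => dotv u (fun i => F i v)).
Proof. by move=> lF; apply: lingrowth_sum => i _; exact: lingrowthZ. Qed.

Lemma tame_comp F (G : 'I_n -> ('I_n -> R) -> R) :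
  tame F -> (forall i, lingrowth (G i)) -> tame (fun v => F (fun i => G i v)).
Proof.
move=> [mF [k k0 H]] lG.
have [l l0 Hl] : exists2 l, 0 <= l & forall v, norm1 (fun i => G i v) <= l * (1 + norm1 v).
  have : forall i, exists l, 0 <= l /\ forall v, `|G i v| <= l * (1 + norm1 v).
    by move=> i; have [_ [l l0 Hl]] := lG i; exists l.
  move=> /choice[l Hl]; exists (\sum_i l i) => [|v].
    by apply: sumr_ge0 => i _; case: (Hl i).
  by rewrite /norm1 big_distrl; apply: ler_sum => i _; case: (Hl i).
apply: (@tame_intro _ (k * expR (k * l)) (k * l)); rewrite ?mulr_ge0 ?expR_ge0//.
  by apply: vmeasurable_subst => // i; case: (lG i).
move=> v; apply: (le_trans (H _)); rewrite -mulrA ler_wpM2l// -expRD ler_expR.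
by apply: (le_trans (ler_wpM2l k0 (Hl v))); rewrite mulrDr mulr1 mulrDr mulrA.
Qed.

Lemma tame_expR F : lingrowth F -> tame (fun v => expR (F v)).
Proof.
move=> [mF [k k0 H]].
apply: (@tame_intro _ (expR k) k); rewrite ?expR_ge0//.
  exact: measurableT_comp.
move=> v; rewrite ger0_norm ?expR_ge0// -expRD ler_expR.
by apply: (le_trans (ler_norm _)); apply: (le_trans (H v)); rewrite mulrDr mulr1.
Qed.

Lemma tame_lingrowth F : lingrowth F -> tame F.
Proof.
move=> lF; case: (lF) => mF [k k0 H].
apply: (@tame_intro _ k 1) => // v; apply: (le_trans (H v)).
by rewrite ler_wpM2l// mul1r expR_ge1Dx.
Qed.

Lemma tame_shift F u : tame F -> tame (fun v => F (fun i => v i + u i)).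
Proof.
move=> tF; apply: tame_comp => // i; apply: lingrowthD.
  exact: lingrowth_coord.
exact: lingrowth_cst.
Qed.

End Tame.

(** The centred Gaussian law of covariance [t] times the inverse of [A] enters through this formula
    alone; the exponential is the density of its translate by [h]. *)
Definition gaussian_shift {R : realType} d (T : measurableType d)
    (P : probability T R) n (N : 'I_n -> T -> R) (A : 'M[R]_n) (t : R) : Prop :=
  (forall i, measurable_fun [set: T] (N i)) /\
  forall (h : 'I_n -> R) (F : ('I_n -> R) -> R),
    vmeasurable F -> (forall v, 0 <= F v) ->
    (\int[P]_w (F (fun i => N i w + h i)%R)%:E =
     \int[P]_w (F (N ^~ w) *
       expR ((dotv h (mulv A (N ^~ w)) - dotv h (mulv A h) / 2) / t))%:E)%E.

Lemma gaussian_shift_linear {R : realType} d (T : measurableType d)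
    (P : probability T R) n (W : 'I_n -> T -> R) (A B C : 'M[R]_n) (t : R) :
  0 < t -> (forall j, measurable_fun [set: T] (W j)) ->
  (forall j (A : set R), measurable A ->
     P (W j @^-1` A) = normal_prob 0 (Num.sqrt t) A) ->
  mutually_independent P W ->
  C^T = C -> A^T = A -> C *m C = B -> B *m A = 1%:M ->
  gaussian_shift P (fun i w => mulv C (W ^~ w) i) A t.
Proof.
move=> t0 mW nW iW CT AT CC BA; split=> [i|h F mF F0].
  by apply: measurable_sum => j; apply: measurable_funM.
(* Translating [W] by [t * a] translates [C W] by [C C A h = B A h = h]. *)
pose a := fun k => t^-1 * mulv C (mulv A h) k.
pose F' := fun v => F (mulv C v).
have mF' : vmeasurable F'.
  apply: vmeasurable_subst => // i; apply: measurable_sum => j.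
  by apply: measurable_funM => //; exact: measurable_tnth.
have := cameron_martin t0 mW nW iW a mF' (fun v => F0 _).
have t0' : t != 0 by rewrite gt_eqF.
have Eh : mulv C (mulv C (mulv A h)) = h by rewrite !mulvM CC BA mulv1.
rewrite /F' => E; transitivity (\int[P]_w (F (mulv C (fun k => W k w + t * a k)%R))%:E)%E.
  apply: eq_integral => w _; congr (F _)%:E; apply/funext => i.
  rewrite mulvD; congr (_ + _); rewrite -{1}Eh; congr mulv.
  by apply/funext => k; rewrite /a mulVKf.
rewrite E; apply: eq_integral => w _; congr (_ * expR _)%:E.
rewrite sumrB -[X in _ - X]big_distrr /=.
rewrite -[X in X - _]/(dotv a (W ^~ w)) dotvC dotvZ.
have -> : \sum_i a i ^+ 2 = t^-1 ^+ 2 * dotv h (mulv A h).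
  have -> : \sum_i a i ^+ 2 = dotv a a by apply: eq_bigr => i _; rewrite expr2.
  rewrite {2}/a dotvZ dotvC dotvZ mulrA -expr2; congr (_ * _).
  by rewrite dotv_mulv// Eh.
rewrite dotvC -dotv_mulv// -dotv_mulv//.
by field.
Qed.

(** The interface between probability and the estimates, which use nothing else about the law. The
    functional is total, but its rules concern tame arguments, where integrals converge.
    [gexp_derive] is differentiation under the integral at [0], with a domination on a fixed
    neighbourhood. *)
Record gaussian_expectation {R : realType} n (A : 'M[R]_n) (t : R) := GaussianExpectation {
  gexp :> (('I_n -> R) -> R) -> R;
  gexp_cst : forall c, gexp (fun=> c) = c;
  gexpD : forall F G, tame F -> tame G -> gexp (fun v => F v + G v) = gexp F + gexp G;
  gexpZ : forall c F, tame F -> gexp (fun v => c * F v) = c * gexp F;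
  ler_gexp : forall F G, tame F -> tame G -> (forall v, F v <= G v) -> gexp F <= gexp G;
  gexp_shift : forall h F, tame F ->
    gexp (fun v => F (fun i => v i + h i)) =
    gexp (fun v => F v * expR ((dotv h (mulv A v) - dotv h (mulv A h) / 2) / t));
  gexp_derive : forall (F F' : R -> ('I_n -> R) -> R) (G : ('I_n -> R) -> R),
    (forall e : R, -1 < e < 1 -> tame (F e)) -> tame G ->
    (forall (e : R) v, -1 < e < 1 -> is_derive e (1 : R) (F ^~ v) (F' e v)) ->
    (forall (e : R) v, -1 < e < 1 -> `|F' e v| <= G v) ->
    is_derive (0 : R) (1 : R) (fun e => gexp (F e)) (gexp (F' 0)) }.

Section GaussianExpectation.
Context {R : realType} d (T : measurableType d) (P : probability T R) n
  (N : 'I_n -> T -> R) (A B : 'M[R]_n) (t : R).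
Hypothesis t_gt0 : 0 < t.
Hypothesis BT : B^T = B.
Hypothesis BA : B *m A = 1%:M.
Hypothesis NG : gaussian_shift P N A t.

Let mN : forall i, measurable_fun [set: T] (N i) := proj1 NG.

Lemma tame_shift_weight h : tame (fun v : 'I_n -> R =>
  expR ((dotv h (mulv A v) - dotv h (mulv A h) / 2) / t)).
Proof.
apply: tame_expR; rewrite (_ : (fun v => _) = fun v =>
  t^-1 * (dotv h (mulv A v) - dotv h (mulv A h) / 2)); last first.
  by apply/funext => v; rewrite mulrC.
apply: lingrowthZ; apply: lingrowthB; last exact: lingrowth_cst.
by apply: lingrowth_dotv => i; apply: lingrowth_dotv => j; exact: lingrowth_coord.
Qed.

(** The translation formula for the constant [1] says that a translation density has integral [1];
    for [h = t B c] this density is [expR (dotv c v)] up to a constant factor. *)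
Lemma integrable_expR_dotv c :
  P.-integrable setT (EFin \o (fun w => expR (dotv c (N ^~ w)))).
Proof.
have mE : measurable_fun [set: T] (fun w => expR (dotv c (N ^~ w))).
  by apply: measurableT_comp => //; apply: measurable_sum => j; apply: measurable_funM.
have [_ /(_ _ (fun=> 1) (measurable_cst _) (fun=> ler01))] := NG.
pose h i := t * mulv B c i.
move=> /(_ h); rewrite integral_cst// [X in (1 * X)%E]probability_setT mul1e => E.
have Eh v : dotv h (mulv A v) = t * dotv c v.
  by rewrite dotvC dotvZ dotvC -dotv_mulv// mulvM BA mulv1.
pose K := expR (dotv c h / 2).
apply/integrableP; split; first exact/measurable_EFinP.
under eq_integral do rewrite /= ger0_norm ?expR_ge0//.
rewrite (eq_integral (fun w => K%:E * (1 * expR ((dotv h (mulv A (N^~ w)) -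
    dotv h (mulv A h) / 2) / t))%:E)%E).
  rewrite ge0_integralZl ?lee_fin ?expR_ge0//; last first.
    apply/measurable_EFinP; apply: measurable_funM => //.
    by have [mw _] := tame_shift_weight h; exact: (vmeasurable_comp mw mN).
  by rewrite -E mule1 ltry.
move=> w _; rewrite -EFinM mul1r -expRD !Eh.
congr (expR _)%:E; field; exact: lt0r_neq0.
Qed.

Lemma integrable_tame F : tame F ->
  P.-integrable setT (EFin \o (fun w => F (N ^~ w))).
Proof.
move=> [mF [k k0 H]].
(* [expR (k * norm1 v)] is at most the sum, over all sign vectors, of the exponentials of the linear
   forms [sgn s]: it is the term of the signs of [v]. *)
pose sgn (s : {ffun 'I_n -> bool}) i := k * (-1) ^+ s i.
have iS : P.-integrable setT (fun w => \sum_(s : {ffun 'I_n -> bool})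
     (expR (dotv (sgn s) (N ^~ w)))%:E)%E.
  by apply: integrable_sum => // s _; exact: integrable_expR_dotv.
apply: (le_integrable _ _ _ (integrableZl _ k iS)) => //.
  by apply/measurable_EFinP; exact: vmeasurable_comp.
move=> w _; rewrite /= sumEFin -EFinM lee_fin.
apply: (le_trans (H _)); rewrite ger0_norm; last first.
  by rewrite mulr_ge0// sumr_ge0// => s _; exact: expR_ge0.
rewrite ler_wpM2l//.
pose s := [ffun i => N i w < 0].
rewrite (bigD1 s)//=; apply: (@le_trans _ _ (expR (dotv (sgn s) (N ^~ w)))).
  rewrite ler_expR /norm1 big_distrr /dotv; apply: ler_sum => i _.
  rewrite /sgn ffunE -mulrA ler_wpM2l//.
  by case: ltrP => [/ltW/ler0_norm ->|/ger0_norm ->]; rewrite ?mulN1r ?mul1r.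
by rewrite lerDl sumr_ge0// => u _; exact: expR_ge0.
Qed.

Definition gaussE (F : ('I_n -> R) -> R) : R := \int[P]_w F (N ^~ w).

Let gaussE_cst c : gaussE (fun=> c) = c.
Proof. by rewrite /gaussE Rintegral_cst// [X in fine X]probability_setT mulr1. Qed.

Let gaussED F G : tame F -> tame G ->
  gaussE (fun v => F v + G v) = gaussE F + gaussE G.
Proof. by move=> tF tG; rewrite /gaussE RintegralD//; exact: integrable_tame. Qed.

Let gaussEZ c F : tame F -> gaussE (fun v => c * F v) = c * gaussE F.
Proof. by move=> tF; rewrite /gaussE RintegralZl//; exact: integrable_tame. Qed.

Let ler_gaussE F G : tame F -> tame G -> (forall v, F v <= G v) ->
  gaussE F <= gaussE G.
Proof. by move=> tF tG FG; apply: le_Rintegral => //; exact: integrable_tame. Qed.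

Let gaussE_shift h F : tame F ->
  gaussE (fun v => F (fun i => v i + h i)) =
  gaussE (fun v => F v * expR ((dotv h (mulv A v) - dotv h (mulv A h) / 2) / t)).
Proof.
have shift0 G : tame G -> (forall v, 0 <= G v) ->
    gaussE (fun v => G (fun i => v i + h i)) =
    gaussE (fun v => G v * expR ((dotv h (mulv A v) - dotv h (mulv A h) / 2) / t)).
  by move=> [mG _] G0; rewrite /gaussE /Rintegral (proj2 NG).
move=> tF; have [_ [k k0 H]] := tF.
(* The formula is known for non-negative functions. Both [F + G] and [G] are non-negative, and the
   contribution of [G] is subtracted. *)
pose G (v : 'I_n -> R) : R := k * expR (k * norm1 v).
have tG : tame G by apply/tameZ/tame_expR/lingrowthZ/lingrowth_norm1.
have G0 v : 0 <= G v by rewrite mulr_ge0 ?expR_ge0.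
have FG0 v : 0 <= F v + G v.
  by have := H v; rewrite ler_norml => /andP[+ _]; rewrite -subr_ge0 opprK.
have tw := tame_shift_weight h.
have /shift0/(_ FG0) := tameD tF tG.
rewrite gaussED; [|exact: tame_shift..].
under [in X in _ = X -> _]eq_fun do rewrite mulrDl.
rewrite gaussED; [|exact: tameM..].
by rewrite (shift0 _ tG)// => /addIr.
Qed.

Let gaussE_derive (F F' : R -> ('I_n -> R) -> R) (G : ('I_n -> R) -> R) :
    (forall e : R, -1 < e < 1 -> tame (F e)) -> tame G ->
    (forall (e : R) v, -1 < e < 1 -> is_derive e (1 : R) (F ^~ v) (F' e v)) ->
    (forall (e : R) v, -1 < e < 1 -> `|F' e v| <= G v) ->
    is_derive (0 : R) (1 : R) (fun e => gaussE (F e)) (gaussE (F' 0)).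
Proof.
move=> tF tG dF HG.
have I0 : `](-1 : R), 1[%classic (0 : R) by rewrite /= in_itv/= ltrN10 ltr01.
have HI (e : R) : `](-1 : R), 1[%classic e -> -1 < e < 1 by rewrite /= in_itv.
pose f (e : R) (w : T) := F e (N ^~ w).
have intf (e : R) : `](-1 : R), 1[%classic e -> P.-integrable setT (EFin \o f e).
  by move=> /HI/tF; exact: integrable_tame.
have derf (e : R) w : `](-1 : R), 1[%classic e -> [set: T] w -> derivable (f ^~ w) e 1.
  by move=> /HI/dF H _; have [] := H (N ^~ w).
have intG := integrable_tame tG.
have f'E (e : R) w : `](-1 : R), 1[%classic e -> partial1of2 f e w = F' e (N ^~ w).
  by move=> /HI/dF H; rewrite partial1of2E; have [_ <-] := H (N ^~ w).
have ub (e : R) w : `](-1 : R), 1[%classic e -> [set: T] w ->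
    `|partial1of2 f e w| <= G (N ^~ w).
  by move=> Ie _; rewrite f'E//; apply: HG; exact: HI.
have G0 w : 0 <= G (N ^~ w).
  by apply: le_trans (HG 0 _ _); rewrite ?normr_ge0// ltrN10 ltr01.
apply: DeriveDef.
  exact: (derivable_under_integral measurableT I0 intf derf G0 intG ub).
rewrite -derive1E (differentiation_under_integral measurableT I0 intf derf G0 intG ub).
by apply: eq_Rintegral => w _; rewrite f'E.
Qed.

Definition gaussian_expectation_of : gaussian_expectation A t :=
  GaussianExpectation gaussE_cst gaussED gaussEZ ler_gaussE gaussE_shift gaussE_derive.

End GaussianExpectation.

(** * Derivatives of real functions of one variable *)

Section RealDerivative.
Context {R : realType}.
Implicit Types (f g : R -> R) (x a b c : R).

Lemma is_derive_funD f g x a b : is_derive x 1 f a -> is_derive x 1 g b ->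
  is_derive x 1 (fun e => f e + g e) (a + b).
Proof. by move=> df dg; exact: is_deriveD. Qed.

Lemma is_derive_funZ c f x a : is_derive x 1 f a ->
  is_derive x 1 (fun e => c * f e) (c * a).
Proof. by move=> df; exact: is_deriveZ. Qed.

Lemma is_derive_funN f x a : is_derive x 1 f a ->
  is_derive x 1 (fun e => - f e) (- a).
Proof. by move=> df; exact: is_deriveN. Qed.

Lemma is_derive_funM f g x a b : is_derive x 1 f a -> is_derive x 1 g b ->
  is_derive x 1 (fun e => f e * g e) (f x * b + g x * a).
Proof. by move=> df dg; exact: is_deriveM. Qed.

Lemma is_derive_fun_expR f x a : is_derive x 1 f a ->
  is_derive x 1 (fun e => expR (f e)) (expR (f x) * a).
Proof. by move=> df; exact: (is_derive1_comp (is_derive_expR _) df). Qed.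

Lemma is_derive_fun_ln f x a : 0 < f x -> is_derive x 1 f a ->
  is_derive x 1 (fun e => ln (f e)) ((f x)^-1 * a).
Proof. by move=> f0 df; exact: (is_derive1_comp (is_derive1_ln f0) df). Qed.

Lemma is_derive_fun_sum n (h : 'I_n -> R -> R) (dh : 'I_n -> R) x :
  (forall i, is_derive x 1 (h i) (dh i)) ->
  is_derive x 1 (fun e => \sum_i h i e) (\sum_i dh i).
Proof.
move=> H; rewrite (_ : (fun e => _) = \sum_i h i); last first.
  by apply/funext => e; rewrite fct_sumE.
exact: is_derive_sum.
Qed.

Lemma is_derive_ext f g x a b : is_derive x 1 f a -> (forall e, f e = g e) ->
  a = b -> is_derive x 1 g b.
Proof. by move=> df /funext <- <-. Qed.

Lemma is_derive_affine c b x : is_derive x 1 (fun e => c * e + b) c.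
Proof.
have := is_derive_funD (is_derive_funZ c (is_derive_id x 1)) (is_derive_cst b x 1).
by rewrite mulr1 addr0.
Qed.

Lemma is_derive_translate f x a c : is_derive (0 : R) 1 (fun e => f (x + e)) a ->
  is_derive x 1 f a.
Proof.
move=> df.
have := @is_derive1_comp R (fun e => f (x + e)) (fun e => e - x) x a 1.
rewrite subrr => /(_ df) H.
have : is_derive x 1 (fun e : R => e - x) 1.
  have := is_derive_affine 1 (- x) x.
  by rewrite (_ : (fun e => _) = fun e : R => e - x)//; apply/funext => e; rewrite mul1r.
move=> /H; rewrite mulr1 (_ : _ \o _ = f)//.
by apply/funext => e /=; rewrite addrC subrK.
Qed.

Lemma is_derive_unique f x a b : is_derive x 1 f a -> is_derive x 1 f b -> a = b.
Proof. by move=> [_ <-] [_ <-]. Qed.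

End RealDerivative.

(** * Gaussian integration by parts *)

Section Stein.
Context {R : realType} {n : nat} {A : 'M[R]_n} {t : R} (E : gaussian_expectation A t).
Hypothesis t_gt0 : 0 < t.

(** The translation formula for [e * h] is differentiated at [e = 0]: the left side gives [F'], the
    density on the right gives the linear form [dotv h (mulv A v)] divided by [t]. *)
Lemma gexp_stein (F F' : ('I_n -> R) -> R) (h : 'I_n -> R) :
  tame F -> tame F' ->
  (forall v, is_derive (0 : R) (1 : R) (fun e => F (fun i => v i + e * h i)) (F' v)) ->
  t * E F' = E (fun v => F v * dotv h (mulv A v)).
Proof.
move=> tF tF' dF.
have [mF' [k k0 HF']] := tF'.
pose a (v : 'I_n -> R) := dotv h (mulv A v); pose b := dotv h (mulv A h).
have la : lingrowth a.
  by apply: lingrowth_dotv => i; apply: lingrowth_dotv => j; exact: lingrowth_coord.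
pose F1 (e : R) (v : 'I_n -> R) := F (fun i => v i + e * h i).
pose F1' (e : R) (v : 'I_n -> R) := F' (fun i => v i + e * h i).
have D1 : is_derive (0 : R) (1 : R) (fun e => E (F1 e)) (E (F1' 0)).
  apply: (gexp_derive E (G := fun v => (k * expR (k * norm1 h)) * expR (k * norm1 v))).
  - by move=> e _; exact: tame_shift.
  - by apply/tameZ/tame_expR/lingrowthZ/lingrowth_norm1.
  - move=> e v _; apply: (is_derive_translate 0).
    have := dF (fun i => v i + e * h i); rewrite /F1.
    congr (is_derive _ _ _ _); apply/funext => z; congr F; apply/funext => i.
    by rewrite mulrDl addrA.
  - move=> e v /andP[e1 e2]; apply: (le_trans (HF' _)).
    rewrite -mulrA ler_wpM2l// -expRD ler_expR -mulrDr ler_wpM2l//.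
    apply: (le_trans (norm1D _ _)); rewrite addrC lerD2r norm1Z.
    by rewrite ler_piMl ?norm1_ge0// ler_norml; lra.
pose F2 (e : R) (v : 'I_n -> R) := F v * expR (t^-1 * (e * a v - e ^+ 2 * b / 2)).
pose F2' (e : R) (v : 'I_n -> R) :=
  F v * (expR (t^-1 * (e * a v - e ^+ 2 * b / 2)) * (t^-1 * (a v - e * b))).
have EF e : E (F1 e) = E (F2 e).
  rewrite /F1 (gexp_shift E (fun i => e * h i) tF); congr (E _); apply/funext => v.
  rewrite /F2; congr (_ * expR _).
  have HZ w : dotv (fun i => e * h i) w = e * dotv h w by rewrite dotvC dotvZ dotvC.
  rewrite !HZ (_ : mulv A (fun i => e * h i) = fun i => e * mulv A h i).
    by rewrite dotvZ -/b -/(a v) mulrC; congr (_ * _); ring.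
  by apply/funext => i; rewrite mulvZ.
have D2 : is_derive (0 : R) (1 : R) (fun e => E (F2 e)) (E (F2' 0)).
  (* For [|e| < 1], [M] dominates both the exponent and its derivative in [e]. *)
  pose M (v : 'I_n -> R) := t^-1 * (`|a v| + `|b|).
  have lM : lingrowth M.
    apply/lingrowthZ/lingrowthD; last exact: lingrowth_cst.
    have [ma [l l0 Hl]] := la; split; first exact: measurableT_comp.
    by exists l => // v; rewrite normr_id.
  have ti0 : 0 <= t^-1 by rewrite invr_ge0 ltW.
  apply: (gexp_derive E (G := fun v => `|F v| * (expR (M v) * M v))).
  - move=> e _; apply: tameM => //; apply/tame_expR/lingrowthZ/lingrowthB.
      exact: lingrowthZ.
    exact: lingrowth_cst.
  - apply: tameM; first exact: tame_norm.
    by apply: tameM; [exact: tame_expR|exact: tame_lingrowth].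
  - move=> e v _; apply/is_derive_funZ/is_derive_fun_expR/is_derive_funZ.
    have H := is_derive_funD (is_derive_affine (a v) 0 e) (is_derive_funZ (- b / 2)
      (is_derive_funM (is_derive_id e 1) (is_derive_id e 1))).
    by apply: (is_derive_ext H) => [z|] /=; field.
  - move=> e v /andP[e1 e2].
    have ne : `|e| <= 1 by rewrite ler_norml; lra.
    have ne2 : `|e ^+ 2 / 2| <= 1.
      rewrite ger0_norm ?divr_ge0 ?sqr_ge0//; nra.
    rewrite /F2' !normrM ler_wpM2l// (ger0_norm (expR_ge0 _)).
    apply: ler_pM; rewrite ?expR_ge0 ?mulr_ge0//.
      rewrite ler_expR /M ler_wpM2l//.
      apply: (le_trans (ler_norm _)); apply: (le_trans (ler_normB _ _)); apply: lerD.
        by rewrite normrM ler_piMl.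
      by rewrite mulrAC normrM ler_piMl.
    rewrite (ger0_norm ti0) /M ler_wpM2l//.
    by apply: (le_trans (ler_normB _ _)); rewrite lerD2l normrM ler_piMl.
have EE : (fun e => E (F1 e)) = (fun e => E (F2 e)) by apply/funext.
rewrite EE in D1; have := is_derive_unique D1 D2.
have -> : F1' 0 = F'.
  by apply/funext => v; rewrite /F1'; congr F'; apply/funext => i; rewrite mul0r addr0.
have -> : F2' 0 = fun v => t^-1 * (F v * a v).
  apply/funext => v; rewrite /F2' !mul0r expr0n /= !mul0r subr0 mulr0 expR0; ring.
rewrite gexpZ; last by apply: tameM => //; exact: tame_lingrowth.
by move=> ->; rewrite mulVKf// gt_eqF.
Qed.

End Stein.

(** * The law on the level sets of the sum *)

Section LogSumExp.
Context {R : realType} {n : nat} (i0 : 'I_n).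
Implicit Types (x : 'I_n -> R).

Definition sumexp x : R := \sum_i expR (x i).
Definition lse x : R := ln (sumexp x).

Lemma sumexp_gt0 x : 0 < sumexp x.
Proof.
rewrite /sumexp (bigD1 i0)//= ltr_pwDl ?expR_gt0//.
by rewrite sumr_ge0// => i _; exact: expR_ge0.
Qed.

Lemma expR_lse x : expR (lse x) = sumexp x.
Proof. by rewrite lnK// posrE sumexp_gt0. Qed.

Lemma lseD x c : lse (fun i => x i + c) = lse x + c.
Proof.
apply: expR_inj; rewrite expRD !expR_lse /sumexp big_distrl.
by apply: eq_bigr => i _; rewrite /= expRD.
Qed.

Lemma coord_le_lse x i : x i <= lse x.
Proof.
rewrite -ler_expR expR_lse /sumexp (bigD1 i)//= lerDl.
by rewrite sumr_ge0// => j _; exact: expR_ge0.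
Qed.

(** [lse x] lies between the coordinate [x i0] and [n + norm1 x], the latter because [n] is at most
    [expR n]. *)
Lemma lingrowth_lse : lingrowth lse.
Proof.
split.
  apply: measurableT_comp; first exact: measurable_ln.
  by apply: measurable_sum => i; apply: measurableT_comp => //; exact: measurable_tnth.
exists (n%:R + 1) => [|x]; first by rewrite addr_ge0.
apply: (@le_trans _ _ (n%:R + norm1 x)); last first.
  have := mulr_ge0 (ler0n R n) (norm1_ge0 x).
  move: (n%:R : R) (norm1 x) => a b; lra.
rewrite ler_norml; apply/andP; split.
  apply: le_trans (coord_le_lse x i0); rewrite lerNl.
  apply: (le_trans (ler_norm _)); rewrite normrN.
  by apply: (le_trans (coord_le_norm1 x i0)); rewrite lerDr.
rewrite -ler_expR expR_lse expRD.
apply: (@le_trans _ _ (n%:R * expR (norm1 x))); last first.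
  rewrite ler_wpM2r ?expR_ge0//; apply: le_trans (expR_ge1Dx _); by rewrite lerDr.
rewrite /sumexp mulr_natl -[X in _ *+ X]card_ord -sumr_const; apply: ler_sum => i _.
by rewrite ler_expR (le_trans (ler_norm _))// coord_le_norm1.
Qed.

Lemma lingrowth_lse_shift (m : 'I_n -> R) : lingrowth (fun v => lse (fun i => m i + v i)).
Proof.
have [ml [k k0 H]] := lingrowth_lse; split.
  apply: (vmeasurable_subst ml) => i; apply: measurable_funD => //; exact: measurable_tnth.
exists (k * (1 + norm1 m)) => [|v]; first by rewrite mulr_ge0// addr_ge0// norm1_ge0.
apply: (le_trans (H _)); rewrite -mulrA ler_wpM2l// mulrDr mulr1 mulrDl mul1r.
have := norm1D m v; have := norm1_ge0 m; have := norm1_ge0 v; nra.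
Qed.

End LogSumExp.

(** * Integrals over a level set and exponential tilts *)

Section ConditionalExpectation.
Context {R : realType} {n : nat} (i0 : 'I_n) {A B : 'M[R]_n} {t : R}
  (E : gaussian_expectation A t).
Hypothesis t_gt0 : 0 < t.
Hypothesis AT : A^T = A.
Hypothesis BT : B^T = B.
Hypothesis AB : A *m B = 1%:M.
Hypothesis BA : B *m A = 1%:M.

Let one : 'I_n -> R := fun=> 1.
Definition rowsum (M : 'M[R]_n) : 'I_n -> R := mulv M one.
Definition totsum (M : 'M[R]_n) : R := dotv one (rowsum M).
Local Notation beta := (rowsum A).
Local Notation S := (totsum A).
Hypothesis S_gt0 : 0 < S.

(* The point of the line [m + v + R.1] on which the exponentials sum up to [expR (- L)]. *)
Definition level (m : 'I_n -> R) (L : R) (v : 'I_n -> R) : 'I_n -> R :=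
  fun i => m i + v i - lse (fun j => m j + v j) - L.

Definition Sig (m y : 'I_n -> R) : R := dotv (rowsum A) (fun i => y i - m i).

(** [dotv (rowsum A) N] is Gaussian of variance [t * totsum A] and independent of the class of [N]
    modulo [(1,...,1)], on which alone [level] depends. This is its unnormalized density, at the
    value taken on the level set. *)
Definition weight (m y : 'I_n -> R) : R := expR (- (2 * t * totsum A)^-1 * Sig m y ^+ 2).

(* Up to a constant, the density of [lse (m + N)] at [- L] integrated against [H]
   applied to the value of [m + N]. *)
Definition cexp (m : 'I_n -> R) (L : R) (H : ('I_n -> R) -> R) : R :=
  E (fun v => H (level m L v) * weight m (level m L v)).

Definition mass m L := cexp m L (fun=> 1).

Lemma sum_expR_level m L v : \sum_i expR (level m L v i) = expR (- L).
Proof.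
rewrite /level; under eq_bigr do rewrite -addrA expRD.
rewrite -big_distrl /= -/(sumexp (fun i => m i + v i)) -(expR_lse i0) -expRD.
by congr expR; ring.
Qed.

(** This freedom lets a translation be corrected along [(1,...,1)], in [cexp_tilt] and in
    [cexp_stein]. *)
Lemma level_shift m L v c : level m L (fun i => v i + c) = level m L v.
Proof.
apply/funext => i; rewrite /level.
have -> : (fun j => m j + (v j + c)) = (fun j => (m j + v j) + c).
  by apply/funext => j; rewrite addrA.
rewrite (lseD i0); ring.
Qed.

Lemma level_translate m h L v : level m L (fun i => v i + h i) = level (fun i => m i + h i) L v.
Proof.
apply/funext => i; rewrite /level.
have -> : (fun j => m j + (v j + h j)) = (fun j => (m j + h j) + v j).
  by apply/funext => j; ring.
ring.
Qed.

Lemma lingrowth_level m L i : lingrowth (fun v => level m L v i).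
Proof.
apply: lingrowthB; last exact: lingrowth_cst.
apply: lingrowthB; last exact: (lingrowth_lse_shift i0).
by apply: lingrowthD; [exact: lingrowth_cst|exact: lingrowth_coord].
Qed.

Lemma lingrowth_Sig m : lingrowth (Sig m).
Proof.
apply: lingrowth_dotv => i.
by apply: lingrowthB; [exact: lingrowth_coord|exact: lingrowth_cst].
Qed.

Lemma Sig_level m L v :
  Sig m (level m L v) = dotv beta v - (lse (fun j => m j + v j) + L) * S.
Proof.
rewrite /Sig (_ : (fun i => _) = fun i => v i - (lse (fun j => m j + v j) + L) * 1).
  by rewrite (dotvB _ _ (fun=> _ * 1)) (dotvZ _ _ (fun=> 1)) (dotvC _ (fun=> 1)).
by apply/funext => i; rewrite /level; ring.
Qed.

Lemma tame_weight m : tame (weight m).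
Proof.
have lS := lingrowth_Sig m.
apply: (@tame_bounded _ _ _ 1).
  apply: measurableT_comp => //; apply: measurable_funM => //.
  by apply: measurable_funX; case: lS.
move=> v; rewrite ger0_norm ?expR_ge0// -expR0 ler_expR.
by rewrite mulNr oppr_le0 mulr_ge0 ?sqr_ge0// invr_ge0 !mulr_ge0// ltW.
Qed.

Lemma tame_level m L H : tame H -> tame (fun v => H (level m L v)).
Proof. by move=> tH; apply: tame_comp => // i; exact: lingrowth_level. Qed.

Lemma tame_cexp m L H : tame H -> tame (fun v => H (level m L v) * weight m (level m L v)).
Proof. by move=> tH; apply: tameM; apply: tame_level => //; exact: tame_weight. Qed.

Lemma cexpD m L H K : tame H -> tame K ->
  cexp m L (fun y => H y + K y) = cexp m L H + cexp m L K.
Proof.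
move=> tH tK; rewrite /cexp -gexpD; [|exact: tame_cexp..].
by congr (E _); apply/funext => v; rewrite mulrDl.
Qed.

Lemma cexpZ m L c H : tame H -> cexp m L (fun y => c * H y) = c * cexp m L H.
Proof.
move=> tH; rewrite /cexp -gexpZ; last exact: tame_cexp.
by congr (E _); apply/funext => v; rewrite mulrA.
Qed.

Lemma ler_cexp m L H K : tame H -> tame K ->
  (forall y, \sum_i expR (y i) = expR (- L) -> H y <= K y) ->
  cexp m L H <= cexp m L K.
Proof.
move=> tH tK HK; apply: ler_gexp => [||v]; [exact: tame_cexp..|].
by rewrite ler_wpM2r ?expR_ge0// HK// sum_expR_level.
Qed.

Lemma eq_cexp m L H K :
  (forall y, \sum_i expR (y i) = expR (- L) -> H y = K y) ->
  cexp m L H = cexp m L K.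
Proof.
by move=> HK; congr (E _); apply/funext => v; rewrite HK// sum_expR_level.
Qed.

(** Strictness comes from the tangent line of [expR] at [E F], that is, from Jensen's inequality. *)
Lemma gexp_expR_gt0 F : tame F -> tame (fun v => expR (F v)) -> 0 < E (fun v => expR (F v)).
Proof.
move=> tF tE; have : E (fun v => expR (E F) * (1 + (F v - E F))) <= E (fun v => expR (F v)).
  apply: ler_gexp => // [|v].
    apply: tameZ; apply: tameD; first exact: tame_cst.
    by apply: tameB => //; exact: tame_cst.
  have -> : expR (F v) = expR (E F) * expR (F v - E F) by rewrite -expRD addrC subrK.
  by rewrite ler_wpM2l ?expR_ge0// expR_ge1Dx.
rewrite gexpZ; last first.
  apply: tameD; first exact: tame_cst.
  by apply: tameB => //; exact: tame_cst.
rewrite gexpD; [|exact: tame_cst|by apply: tameB => //; exact: tame_cst].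
rewrite gexp_cst [E (fun v => _ - _)](_ : _ = 0) ?addr0 ?mulr1.
  by apply: lt_le_trans; exact: expR_gt0.
rewrite (gexpD E (G := fun=> - E F)) ?gexp_cst ?subrr//; exact: tame_cst.
Qed.

Lemma mass_gt0 m L : 0 < mass m L.
Proof.
rewrite /mass /cexp (_ : (fun v => _) = fun v => weight m (level m L v)); last first.
  by apply/funext => v; rewrite mul1r.
apply: gexp_expR_gt0; last exact: (tame_level m L (tame_weight m)).
apply/tameZ/tameX/tame_lingrowth/lingrowth_dotv => i.
by apply: lingrowthB; [exact: lingrowth_level|exact: lingrowth_cst].
Qed.

Lemma dotv_one_mulv v : dotv one (mulv A v) = dotv beta v.
Proof. by rewrite dotv_mulv. Qed.

Lemma cexp_tilt (a m : 'I_n -> R) L H : tame H ->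
  cexp m L (fun y => H y * expR (dotv a y)) =
  expR (dotv a m + t / 2 * dotv a (mulv B a)) *
    cexp (fun i => m i + t * mulv B a i) L H.
Proof.
move=> tH.
(* The translation by [t B a] is corrected along [(1,...,1)] so that [dotv beta h = 0]; [level] does
   not see the correction. *)
pose s := dotv one a; pose h i := t * mulv B a i - t * s / S.
pose m' i := m i + t * mulv B a i.
pose phi v := (dotv h (mulv A v) - dotv h (mulv A h) / 2) / t.
(* [G] is the tilted integrand divided by the translation density [expR (phi v)], so that the
   translation formula for [h] turns the left side into the expectation of [G (v + h)]. *)
pose G v := H (level m L v) *
  expR (- (2 * t * S)^-1 * Sig m (level m L v) ^+ 2 + dotv a (level m L v) - phi v).
have tG : tame G.
  rewrite (_ : G = fun v => (H (level m L v) * weight m (level m L v)) *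
      expR (dotv a (level m L v) - phi v)); last first.
    by apply/funext => v; rewrite /G /weight -[RHS]mulrA -expRD addrA.
  apply: tameM; first exact: tame_cexp.
  apply/tame_expR/lingrowthB; first by apply: lingrowth_dotv => i; exact: lingrowth_level.
  rewrite (_ : phi = fun v => t^-1 * (dotv h (mulv A v) - dotv h (mulv A h) / 2)).
    apply/lingrowthZ/lingrowthB; last exact: lingrowth_cst.
    by apply: lingrowth_dotv => i; apply: lingrowth_dotv => j; exact: lingrowth_coord.
  by apply/funext => v; rewrite mulrC.
have tn0 : t != 0 by rewrite gt_eqF.
have Sn0 : S != 0 by rewrite gt_eqF.
have := gexp_shift E h tG.
have -> : (fun v => G v * expR ((dotv h (mulv A v) - dotv h (mulv A h) / 2) / t)) =
    fun v => (H (level m L v) * expR (dotv a (level m L v))) * weight m (level m L v).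
  apply/funext => v; rewrite /G -/(phi v) /weight -[LHS]mulrA -[RHS]mulrA -!expRD.
  by congr (_ * expR _); ring.
rewrite -/(cexp m L (fun y => H y * expR (dotv a y))) => <-.
rewrite /cexp -gexpZ; last exact: tame_cexp.
congr (E _); apply/funext => v; rewrite /G.
have -> : level m L (fun i => v i + h i) = level m' L v.
  rewrite -(level_shift m' L v (- (t * s / S))) !level_translate.
  congr (level _ L v); apply/funext => i.
  by rewrite /m' /h; ring.
rewrite [RHS]mulrCA; congr (_ * _); rewrite /weight -expRD; congr expR.
pose c := lse (fun j => m' j + v j) + L.
have yE i : level m' L v i = m' i + v i - c * 1 by rewrite /level /c; ring.
set D := dotv beta v.
set al := dotv a (mulv B a).
have bBa : dotv beta (mulv B a) = s.
  by rewrite /rowsum -dotv_mulv// mulvM AB mulv1.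
have dots u : dotv u one = dotv one u by rewrite dotvC.
have SS : dotv beta one = S by rewrite dots.
have X' : Sig m' (level m' L v) = D - c * S.
  rewrite /Sig (_ : (fun i => _) = fun i => v i - c * 1).
    by rewrite (dotvB _ _ (fun=> c * 1)) (dotvZ _ c one) SS.
  by apply/funext => i; rewrite yE; ring.
have X : Sig m (level m' L v) = D - c * S + t * s.
  rewrite -X' /Sig -bBa -dotvZ -dotvD; congr dotv; apply/funext => i.
  by rewrite /m'; ring.
have Ya : dotv a (level m' L v) = dotv a m + t * al + dotv a v - c * s.
  rewrite (_ : level m' L v = fun i => m' i + v i - c * 1); last by apply/funext => i; rewrite yE.
  rewrite (dotvB _ _ (fun=> c * 1)) (dotvZ _ c one) dots -/s dotvD.
  by rewrite /m' dotvD dotvZ.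
have hA w : dotv h (mulv A w) = t * dotv a w - t * s / S * dotv beta w.
  rewrite dotvC /h (dotvB _ _ (fun=> t * s / S)) dotvZ; congr (_ * _ - _).
    by rewrite dotvC -dotv_mulv// mulvM BA mulv1.
  rewrite (_ : (fun=> t * s / S) = fun i => t * s / S * one i).
    by rewrite dotvZ dots dotv_one_mulv.
  by apply/funext => i; rewrite mulr1.
have ah : dotv a h = t * al - t * s / S * s.
  rewrite /h (dotvB _ _ (fun=> t * s / S)) dotvZ; congr (_ - _).
  rewrite (_ : (fun=> t * s / S) = fun i => t * s / S * one i).
    by rewrite dotvZ dots.
  by apply/funext => i; rewrite mulr1.
have bh : dotv beta h = 0.
  rewrite /h (dotvB _ _ (fun=> t * s / S)) dotvZ bBa.
  rewrite (_ : (fun=> t * s / S) = fun i => t * s / S * one i).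
    by rewrite dotvZ SS divfK// subrr.
  by apply/funext => i; rewrite mulr1.
rewrite /phi !hA dotvD dotvD ah bh X Ya -/(m') -/m' X' -/D -/al.
field; exact/andP.
Qed.

End ConditionalExpectation.
Arguments Sig {R n} A m y.
Arguments weight {R n} A t m y.

(** * Integration by parts on a level set *)

Section ConditionalStein.
Context {R : realType} {n : nat} (i0 : 'I_n) {A : 'M[R]_n} {t : R}
  (E : gaussian_expectation A t).
Hypothesis t_gt0 : 0 < t.
Hypothesis AT : A^T = A.
Hypothesis S_gt0 : 0 < totsum A.
Variables (m : 'I_n -> R) (L : R).
Local Notation beta := (rowsum A).
Local Notation S := (totsum A).

(* On the level set, [mulv A (y - m)] is the gradient of the Gaussian potential, the
   [expR (y i + L)] are the coordinates of a point of the simplex, and [residual] vanishes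
   exactly at the critical points of the constrained potential. *)
Definition residual (y : 'I_n -> R) (i : 'I_n) : R :=
  mulv A (fun j => y j - m j) i - expR (y i + L) * Sig A m y.

Let bump (i : 'I_n) (v : 'I_n -> R) (e : R) : 'I_n -> R :=
  fun k => v k + e * (k == i)%:R.

(** [expR (level m L v i + L)] is the softmax weight of coordinate [i] at [m + v], which is the
    partial derivative of [lse]. *)
Lemma is_derive_level i v j :
  is_derive (0 : R) (1 : R) (fun e => level m L (bump i v e) j)
    ((j == i)%:R - expR (level m L v i + L)).
Proof.
pose x k := m k + v k.
have Dx k : is_derive (0 : R) 1 (fun e : R => m k + bump i v e k) (k == i)%:R.
  apply: (is_derive_ext (is_derive_affine (k == i)%:R (x k) 0)) => // e.
  by rewrite /bump /x; ring.
have bump0 : (fun k => m k + bump i v 0 k) = x.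
  by apply/funext => k; rewrite /bump mul0r addr0.
have Dlse : is_derive (0 : R) 1 (fun e : R => lse (fun k => m k + bump i v e k))
    (expR (level m L v i + L)).
  have := is_derive_fun_ln _ (is_derive_fun_sum (fun k => is_derive_fun_expR (Dx k))).
  move=> /(_ (sumexp_gt0 i0 _)) D; apply: (is_derive_ext D) => //.
  rewrite -/(sumexp _) bump0 (bigD1 i)//= big1 ?addr0 => [|k /negbTE ->]; last by rewrite mulr0.
  rewrite eqxx mulr1 -(expR_lse i0) -expRN -expRD /level -/x (_ : bump i v 0 i = v i).
    by congr expR; rewrite /x; ring.
  by rewrite /bump mul0r addr0.
have := is_derive_funD (Dx j) (is_derive_funN Dlse) => D.
apply: (is_derive_ext (is_derive_funD D (is_derive_cst (- L) (0 : R) (1 : R)))) => //.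
by rewrite addr0.
Qed.

Lemma is_derive_dotv_level i v c :
  is_derive (0 : R) (1 : R) (fun e => dotv c (level m L (bump i v e)))
    (c i - expR (level m L v i + L) * dotv (fun=> 1) c).
Proof.
have := is_derive_fun_sum (fun j => is_derive_funZ (c j) (is_derive_level i v j)).
move=> D; apply: (is_derive_ext D) => //.
under eq_bigr do rewrite mulrBr.
rewrite sumrB; congr (_ - _).
  rewrite (bigD1 i)//= eqxx mulr1 big1 ?addr0// => k /negbTE ->.
  by rewrite mulr0.
rewrite /dotv big_distrr; apply: eq_bigr => k _ /=; ring.
Qed.

Lemma tame_residual i : tame (fun y => residual y i).
Proof.
have lA : lingrowth (fun y => mulv A (fun j => y j - m j) i).
  by apply: lingrowth_dotv => j; apply: lingrowthB;
    [exact: lingrowth_coord|exact: lingrowth_cst].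
apply: tameB; first exact: tame_lingrowth.
apply: tameM; last exact/tame_lingrowth/lingrowth_Sig.
by apply: tame_expR; apply: lingrowthD; [exact: lingrowth_coord|exact: lingrowth_cst].
Qed.

(** Integration by parts in the direction [e_i - (beta_i / S) (1,...,1)], for which the linear form
    depends on the level point only: it is [(A (y - m))_i - (beta_i / S) Sig]. Differentiating
    [weight] then replaces [beta_i / S] by [u_i], which produces [residual]. *)
Lemma cexp_stein i (H H' : ('I_n -> R) -> R) : tame H -> tame H' ->
  (forall v, is_derive (0 : R) (1 : R) (fun e => H (level m L (bump i v e)))
    (H' (level m L v))) ->
  cexp E m L (fun y => H y * residual y i) = t * cexp E m L H'.
Proof.
move=> tH tH' dH.
have tn0 : t != 0 by rewrite gt_eqF.
have Sn0 : S != 0 by rewrite gt_eqF.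
pose h k := (k == i)%:R - beta i / S : R.
pose W v := weight A t m (level m L v).
pose F v := H (level m L v) * W v.
pose dS v := beta i - expR (level m L v i + L) * S.
pose F' v := H (level m L v) * (W v * (- (2 * t * S)^-1 *
  (Sig A m (level m L v) * dS v + Sig A m (level m L v) * dS v))) +
  W v * H' (level m L v).
have tF : tame F by exact: (tame_cexp i0 t_gt0 S_gt0).
have tW : tame W by exact: (tame_level i0 _ _ (tame_weight t_gt0 S_gt0 _)).
have tSig : tame (fun v => Sig A m (level m L v)).
  exact: (tame_level i0 _ _ (tame_lingrowth (lingrowth_Sig _))).
have tlev j : lingrowth (fun v => level m L v j) by exact: lingrowth_level.
have tdS : tame dS.
  apply: tameB; first exact: tame_cst.
  apply: tameM; last exact: tame_cst.
  by apply: tame_expR; apply: lingrowthD => //; exact: lingrowth_cst.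
have tHl : tame (fun v => H (level m L v)) by exact: tame_level.
have tHl' : tame (fun v => H' (level m L v)) by exact: tame_level.
have tF' : tame F'.
  apply: tameD; last exact: tameM.
  apply: tameM => //; apply: tameM => //; apply: tameZ.
  by apply: tameD; apply: tameM.
have dF v : is_derive (0 : R) (1 : R) (fun e => F (fun k => v k + e * h k)) (F' v).
  have levE e : level m L (fun k => v k + e * h k) = level m L (bump i v e).
    rewrite -(level_shift i0 m L (bump i v e) (- e * (beta i / S))).
    by congr level; apply/funext => k; rewrite /bump /h; ring.
  have b0 : bump i v 0 = v by apply/funext => k; rewrite /bump mul0r addr0.
  have DS : is_derive (0 : R) 1 (fun e => Sig A m (level m L (bump i v e))) (dS v).
    apply: (is_derive_ext (is_derive_funD (is_derive_dotv_level i v beta)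
      (is_derive_cst (- dotv beta m) (0 : R) (1 : R)))) => [e|].
      by rewrite /Sig dotvB.
    by rewrite addr0.
  have DW := is_derive_fun_expR (is_derive_funZ (- (2 * t * S)^-1) (is_derive_funM DS DS)).
  apply: (is_derive_ext (is_derive_funM (dH v) DW)) => [e|].
    by rewrite /F /W levE /weight expr2.
  by rewrite /F' /= b0 /W /weight expr2.
have := gexp_stein E t_gt0 tF tF' dF.
have hA v : dotv h (mulv A v) = mulv A (fun j => level m L v j - m j) i -
    beta i / S * Sig A m (level m L v).
  pose c := lse (fun j => m j + v j) + L.
  have yE : (fun j => level m L v j - m j) = fun j => v j - c * 1.
    by apply/funext => j; rewrite /level /c; ring.
  rewrite /Sig yE mulvB (mulvZ A c (fun=> 1)) (dotvB _ _ (fun=> c * 1)) (dotvZ _ c (fun=> 1)).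
  rewrite (_ : dotv beta (fun=> 1) = S); last by rewrite dotvC.
  rewrite -/beta -(dotv_one_mulv AT) /h dotvC (dotvB _ _ (fun=> beta i / S)).
  rewrite (_ : dotv (mulv A v) (fun k => (k == i)%:R) = mulv A v i).
    rewrite (_ : dotv _ (fun=> beta i / S) = beta i / S * dotv (fun=> 1) (mulv A v)).
      by field.
    rewrite dotvC /dotv big_distrr; apply: eq_bigr => k _ /=; ring.
  rewrite /dotv (bigD1 i)//= eqxx mulr1 big1 ?addr0// => k /negbTE ->.
  by rewrite mulr0.
move=> ST.
have -> : cexp E m L (fun y => H y * residual y i) =
    E (fun v => F v * dotv h (mulv A v) + (- t) * F' v + t * (H' (level m L v) * W v)).
  congr (E _); apply/funext => v; rewrite hA /F /F' /residual -/(W v) /dS.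
  field; exact/andP.
have tFh : tame (fun v => F v * dotv h (mulv A v)).
  apply: tameM => //; apply: tame_lingrowth; apply: lingrowth_dotv => j.
  by apply: lingrowth_dotv => k; exact: lingrowth_coord.
have tH'W : tame (fun v => H' (level m L v) * W v) by exact: tameM.
rewrite gexpD; [|by apply: tameD => //; exact: tameZ|exact: tameZ].
rewrite gexpD//; last exact: tameZ.
by rewrite !gexpZ// -ST mulNr subrr add0r.
Qed.

Lemma cexp_residual i : cexp E m L (fun y => residual y i) = 0.
Proof.
have := @cexp_stein i (fun=> 1) (fun=> 0) (tame_cst 1) (tame_cst 0).
move=> /(_ (fun v => is_derive_cst _ _ _)).
under [X in cexp _ _ _ X = _ -> _]eq_fun do rewrite mul1r.
move=> ->; rewrite /cexp; under eq_fun do rewrite mul0r.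
by rewrite gexp_cst mulr0.
Qed.

(** [cexp_stein] applied to [residual] itself. The right side is affine in [Sig] with bounded
    coefficients, hence of lower degree than the square on the left. *)
Lemma cexp_residual_sqr i : cexp E m L (fun y => residual y i ^+ 2) =
  t * cexp E m L (fun y => A i i - 2 * beta i * expR (y i + L) +
    S * expR (y i + L) ^+ 2 - expR (y i + L) * (1 - expR (y i + L)) * Sig A m y).
Proof.
under [in LHS]eq_fun do rewrite expr2.
have tu : tame (fun y => expR (y i + L)).
  by apply: tame_expR; apply: lingrowthD; [exact: lingrowth_coord|exact: lingrowth_cst].
apply: cexp_stein; first exact: tame_residual.
  apply: tameB; last first.
    apply: tameM; last exact/tame_lingrowth/lingrowth_Sig.
    by apply: tameM => //; apply: tameB => //; exact: tame_cst.
  apply: tameD; last exact/tameZ/tameX.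
  by apply: tameB; [exact: tame_cst|exact: tameZ].
move=> v.
have b0 : bump i v 0 = v by apply/funext => k; rewrite /bump mul0r addr0.
have DS : is_derive (0 : R) 1 (fun e => Sig A m (level m L (bump i v e)))
    (beta i - expR (level m L v i + L) * S).
  apply: (is_derive_ext (is_derive_funD (is_derive_dotv_level i v beta)
      (is_derive_cst (- dotv beta m) (0 : R) (1 : R)))) => [e|].
    by rewrite /Sig dotvB.
  by rewrite addr0.
have DA := is_derive_funD (is_derive_dotv_level i v (A i)) (is_derive_cst (- dotv (A i) m) (0 : R) (1 : R)).
have Du := is_derive_fun_expR (is_derive_funD (is_derive_level i v i) (is_derive_cst L (0 : R) (1 : R))).
have rs : dotv (fun=> 1) (A i) = beta i by rewrite dotvC.
apply: (is_derive_ext (is_derive_funD DA (is_derive_funN (is_derive_funM Du DS)))) => [e|].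
  by rewrite /residual mulvB.
rewrite /= b0 rs eqxx (_ : true%:R = 1 :> R)//; ring.
Qed.

End ConditionalStein.
Arguments residual {R n} A m L y i.

(** * Pointwise bounds on a level set *)

Section PointwiseBounds.
Context {R : realType} {n : nat} (A B : 'M[R]_n).
Hypothesis AT : A^T = A.
Hypothesis BT : B^T = B.
Hypothesis BA : B *m A = 1%:M.
Hypothesis B_pos : forall v : 'I_n -> R, (exists i, v i != 0) -> 0 < dotv v (mulv B v).

Lemma quad_ge0 v : 0 <= dotv v (mulv B v).
Proof.
have [[i vi]|nv] := pselect (exists i, v i != 0); first by apply/ltW/B_pos; exists i.
rewrite /dotv big1// => i _.
by have [->|vi] := eqVneq (v i) 0; [rewrite mul0r|case: nv; exists i].
Qed.

Lemma quad_comb a b v w :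
  dotv (fun k => a * v k - b * w k) (mulv B (fun k => a * v k - b * w k)) =
  a ^+ 2 * dotv v (mulv B v) - 2 * a * b * dotv v (mulv B w) +
  b ^+ 2 * dotv w (mulv B w).
Proof.
have -> : mulv B (fun k => a * v k - b * w k) =
    fun k => a * mulv B v k - b * mulv B w k.
  by apply/funext => k; rewrite mulvB !mulvZ.
rewrite dotvB !dotvZ !(dotvC (fun k => _ - _)) !dotvB !dotvZ.
rewrite -(dotv_mulv v w BT) (dotvC (mulv B v)) (dotvC (mulv B w) v) (dotvC (mulv B w)).
ring.
Qed.

(** Cauchy-Schwarz for the form of [B] between [v] and the column [w] of [A]: as [B w] is the basis
    vector of index [i], [v_i = v.B w] and [A_ii = w.B w]. *)
Lemma coord_sqr_le_quad v i : v i ^+ 2 <= A i i * dotv v (mulv B v).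
Proof.
pose w k := A k i.
have Bw k : mulv B w k = (k == i)%:R.
  by have := congr1 (fun M : 'M[R]_n => M k i) BA; rewrite !mxE => <-.
have dBw u : dotv u (mulv B w) = u i.
  rewrite /dotv (bigD1 i)//= Bw eqxx mulr1 big1 ?addr0// => k ki.
  by rewrite Bw (negbTE ki) mulr0.
have wi : w i = dotv w (mulv B w) by rewrite dBw.
have Aii : 0 < A i i.
  rewrite -[A i i]/(w i) wi; apply: B_pos.
  have [//|nw] := pselect (exists k, w k != 0).
  have := Bw i; rewrite eqxx /mulv big1 => [/eqP|k _]; first by rewrite eq_sym oner_eq0.
  by have [->|wk] := eqVneq (w k) 0; [rewrite mulr0|case: nw; exists k].
have := quad_ge0 (fun k => A i i * v k - v i * w k).
rewrite quad_comb !dBw -[w i]/(A i i).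
move: (dotv v (mulv B v)) (v i) (A i i) Aii => Q x a a0.
rewrite (_ : _ + _ = a * (a * Q - x ^+ 2)); last by ring.
by rewrite pmulr_rge0// subr_ge0.
Qed.

(** The square comes from summing the square roots of the bounds [coord_sqr_le_quad]; the [1] makes
    the constant positive. *)
Definition coerc : R := (\sum_i Num.sqrt (A i i)) ^+ 2 + 1.
Definition entries : R := \sum_i \sum_j `|B i j|.

Lemma coerc_gt0 : 0 < coerc.
Proof. by rewrite /coerc ltr_wpDl ?sqr_ge0. Qed.

Lemma entries_ge0 : 0 <= entries.
Proof. by apply: sumr_ge0 => i _; exact: sumr_ge0. Qed.

Lemma norm1_sqr_le_quad v : norm1 v ^+ 2 <= coerc * dotv v (mulv B v).
Proof.
set Q := dotv _ _; have Q0 : 0 <= Q by exact: quad_ge0.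
have H : norm1 v <= (\sum_i Num.sqrt (A i i)) * Num.sqrt Q.
  rewrite /norm1 big_distrl; apply: ler_sum => i _ /=.
  have Av := coord_sqr_le_quad v i.
  rewrite -sqrtr_sqr; have [A0|A0] := lerP 0 (A i i).
    by rewrite -sqrtrM// ler_sqrt// mulr_ge0.
  (* For a negative entry [Num.sqrt] is [0], but then [v i] vanishes as well. *)
  have : v i ^+ 2 <= 0 by apply: le_trans Av _; rewrite nmulr_rle0.
  by move=> v0; rewrite (ler0_sqrtr v0) mulr_ge0// sqrtr_ge0.
apply: (@le_trans _ _ (((\sum_i Num.sqrt (A i i)) * Num.sqrt Q) ^+ 2)).
  by rewrite ler_sqr ?nnegrE ?norm1_ge0//; apply: le_trans H; exact: norm1_ge0.
by rewrite exprMn sqr_sqrtr// /coerc mulrDl lerDl mul1r.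
Qed.

Lemma norm1_mulv_le (v : 'I_n -> R) : norm1 (mulv B v) <= entries * norm1 v.
Proof.
rewrite /norm1 /entries big_distrl; apply: ler_sum => i _ /=.
apply: (le_trans (ler_norm_sum _ _ _)); rewrite big_distrl; apply: ler_sum => j _ /=.
by rewrite normrM ler_wpM2l// -/(norm1 v) coord_le_norm1.
Qed.

Lemma norm1_sqr_le_sum (v : 'I_n -> R) : norm1 v ^+ 2 <= n%:R * \sum_i v i ^+ 2.
Proof.
rewrite expr2 {1}/norm1 big_distrl /=.
apply: (@le_trans _ _ (\sum_i \sum_j (v i ^+ 2 + v j ^+ 2) / 2)).
  apply: ler_sum => i _; rewrite /norm1 big_distrr; apply: ler_sum => j _ /=.
  rewrite -(real_normK (num_real (v i))) -(real_normK (num_real (v j))).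
  have := sqr_ge0 (`|v i| - `|v j|); lra.
set s := \sum_i v i ^+ 2.
have inner i : \sum_j (v i ^+ 2 + v j ^+ 2) / 2 = n%:R * v i ^+ 2 / 2 + s / 2.
  rewrite -big_distrl big_split /= sumr_const card_ord -mulr_natl -/s; ring.
under eq_bigr do rewrite inner.
rewrite big_split /= sumr_const card_ord -mulr_natl -big_distrl -big_distrr /= -/s.
by rewrite le_eqVlt; apply/orP; left; apply/eqP; field.
Qed.

Variables (wb : 'I_n -> R).
Let q := dotv wb (mulv B wb).
Hypothesis wb_ge0 : forall i, 0 <= wb i.
Hypothesis wb_sum : \sum_i wb i = 1.
Hypothesis wb_kkt : forall i, q <= mulv B wb i.
Hypothesis q_gt0 : 0 < q.

Section Bounds.
Variables (m : 'I_n -> R) (L : R) (g r : 'I_n -> R) (Sg : R).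
Hypothesis L1 : 1 <= L.
Let u i := expR (g i).
Hypothesis u_sum : \sum_i u i = 1.
(** The definition of [residual] multiplied by [B], with [g = y + L = log u] and [Sg = Sig]. The
    bounds of this section are deterministic consequences; they keep [P] explicit, since [r] is
    small only on average. *)
Hypothesis crit : forall i, mulv B r i + Sg * mulv B u i = g i - L - m i.

Let d i := u i - wb i.
Let rho := mulv B r.
Let P := norm1 rho.
Let X := dotv d (mulv B u).
Let qu := dotv u (mulv B u).
(** [h] is the entropy of [u], which is bounded; [k] is the cross-entropy of [wb] against [u], whose
    bound controls [log u_i] on the support. *)
Let h := - dotv u g.
Let k := - dotv wb g.
Let nm := norm1 m.

Let u_ge0 i : 0 <= u i. Proof. exact: expR_ge0. Qed.

Let u_le1 i : u i <= 1.
Proof. by rewrite -u_sum (bigD1 i)//= lerDl sumr_ge0. Qed.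

Let g_le0 i : g i <= 0.
Proof. by rewrite -ler_expR expR0; exact: u_le1. Qed.

Let h_ge0 : 0 <= h.
Proof. by rewrite /h -sumrN sumr_ge0// => i _; rewrite -mulrN mulr_ge0// oppr_ge0. Qed.

(** [1 - g <= expR (- g)] bounds each term [- u_i g_i] by [1]. *)
Let h_le : h <= n%:R.
Proof.
rewrite /h -sumrN -[n in n%:R]card_ord -sum1_card natr_sum; apply: ler_sum => i _.
have := expR_ge1Dx (- g i); have := expR_gt0 (g i); rewrite expRN /u => e0 e1.
rewrite -mulrN -ler_pdivlMl//; lra.
Qed.

Let k_ge0 : 0 <= k.
Proof. by rewrite /k -sumrN sumr_ge0// => i _; rewrite -mulrN mulr_ge0// oppr_ge0. Qed.

Let norm1_u : norm1 u = 1.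
Proof. by rewrite -u_sum; apply: eq_bigr => i _; rewrite ger0_norm. Qed.

Let norm1_wb : norm1 wb = 1.
Proof. by rewrite -wb_sum; apply: eq_bigr => i _; rewrite ger0_norm. Qed.

Let norm1_d : norm1 d <= 2.
Proof.
have := norm1D u (fun i => - wb i); rewrite norm1_u.
rewrite (_ : norm1 (fun i => - wb i) = 1); first by lra.
by rewrite -norm1_wb; apply: eq_bigr => i _; rewrite normrN.
Qed.

Let d_one c : dotv d (fun=> c) = 0.
Proof. by rewrite /dotv -big_distrl /= sumrB u_sum wb_sum subrr mul0r. Qed.

Let u_one c : dotv u (fun=> c) = c.
Proof. by rewrite /dotv -big_distrl /= u_sum mul1r. Qed.

Let dBwb_eq : dotv d (mulv B wb) = \sum_i u i * (mulv B wb i - q).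
Proof.
under [RHS]eq_bigr do rewrite mulrBr.
rewrite sumrB -big_distrl /= u_sum mul1r dotvC dotvB (dotvC _ wb) -/q.
by congr (_ - _); exact: dotvC.
Qed.

Let dBwb_ge0 : 0 <= dotv d (mulv B wb).
Proof. by rewrite dBwb_eq sumr_ge0// => i _; rewrite mulr_ge0// subr_ge0. Qed.

(** Both terms are non-negative, the first because [B] is positive, the second by the
    Karush-Kuhn-Tucker conditions. Thus [X] controls at once the distance from [u] to [wb] and the
    mass of [u] off the support. *)
Let dB_eq : X = dotv d (mulv B d) + dotv d (mulv B wb).
Proof.
rewrite /X -dotvD; congr dotv; apply/funext => i; rewrite -mulvD; congr mulv.
by apply/funext => j; rewrite /d subrK.
Qed.

Let X_ge : dotv d (mulv B d) <= X.
Proof. by rewrite dB_eq lerDl. Qed.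

Let X_ge' : dotv d (mulv B wb) <= X.
Proof. by rewrite dB_eq lerDr quad_ge0. Qed.

Let X_ge0 : 0 <= X.
Proof. by apply: le_trans X_ge; exact: quad_ge0. Qed.

Let d_sqr : norm1 d ^+ 2 <= coerc * X.
Proof. by apply: (le_trans (norm1_sqr_le_quad d)); rewrite ler_wpM2l// ltW// coerc_gt0. Qed.

Let X_le : X <= entries * norm1 d.
Proof.
apply: (le_trans (ler_norm _)); apply: (le_trans (norm_dotv_le _ _)).
rewrite mulrC ler_wpM2r ?norm1_ge0//; apply: (le_trans (norm1_mulv_le u)).
by rewrite norm1_u mulr1.
Qed.

Let qu_eq : qu = q + X + dotv d (mulv B wb).
Proof.
rewrite dB_eq /qu /q.
have uE : u = fun i => 1 * d i - (-1) * wb i by apply/funext => i; rewrite /d; ring.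
rewrite uE quad_comb; ring.
Qed.

Let qu_ge : q <= qu.
Proof. by rewrite qu_eq -addrA lerDl addr_ge0. Qed.

Let qu_le : qu <= entries.
Proof.
apply: (le_trans (ler_norm _)); apply: (le_trans (norm_dotv_le _ _)).
by rewrite norm1_u mul1r; apply: (le_trans (norm1_mulv_le u)); rewrite norm1_u mulr1.
Qed.

Let P_ge0 : 0 <= P. Proof. exact: norm1_ge0. Qed.

Let crit_dot v : dotv v rho + Sg * dotv v (mulv B u) =
  dotv v g - dotv v (fun=> L) - dotv v m.
Proof.
rewrite -dotvZ -dotvD -!dotvB; congr dotv.
by apply/funext => i; rewrite crit.
Qed.

(** Pairing [crit] with [u] determines [Sg]; pairing it with [d], whose coordinates sum to [0],
    makes [L] disappear. *)
Let crit_u : - Sg * qu = L + h + dotv u m + dotv u rho.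
Proof. by have := crit_dot u; rewrite u_one -/qu /h; lra. Qed.

Let crit_d : - Sg * X + k = dotv d rho + dotv d m + h.
Proof.
have := crit_dot d; rewrite d_one -/X /h /k.
have -> : dotv d g = dotv u g - dotv wb g by rewrite dotvC dotvB !(dotvC g).
lra.
Qed.

Let um_le : `|dotv u m| <= nm.
Proof. by apply: (le_trans (norm_dotv_le _ _)); rewrite norm1_u mul1r. Qed.

Let urho_le : `|dotv u rho| <= P.
Proof. by apply: (le_trans (norm_dotv_le _ _)); rewrite norm1_u mul1r. Qed.

Let drho_le : `|dotv d rho| <= norm1 d * P.
Proof. exact: norm_dotv_le. Qed.

Let dm_le : `|dotv d m| <= 2 * nm.
Proof. by apply: (le_trans (norm_dotv_le _ _)); rewrite ler_wpM2r ?norm1_ge0. Qed.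

(** The first summand collects the terms without [P] of [b1] and [b2] in [main_ineq]; the second is
    the price of absorbing their terms with [P]. *)
Definition bound1 : R := entries * (4 * norm1 m + n%:R) + 2 * coerc * entries ^+ 2.

Lemma bound1_ge0 : 0 <= bound1.
Proof.
rewrite addr_ge0// !mulr_ge0 ?entries_ge0 ?sqr_ge0 ?(ltW coerc_gt0)//.
by rewrite addr_ge0// mulr_ge0 ?norm1_ge0.
Qed.

(** Eliminating [Sg] between [crit_u] and [crit_d] gives an identity for [L X + qu k], whose
    unbounded terms are at most a multiple of [norm1 d * P]. By [d_sqr] and the inequality of
    arithmetic and geometric means they cost half of [L X] and a multiple of [P^2 / L]. *)
Let main_ineq : L * X / 2 + q * k <= bound1 * (1 + P ^+ 2 / L).
Proof.
have L0 : 0 < L by apply: lt_le_trans L1.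
have c0 := coerc_gt0; have b0 := entries_ge0.
have dl0 := norm1_ge0 d; have nm0 : 0 <= nm := norm1_ge0 m.
have key : L * X + qu * k =
    qu * (dotv d rho + dotv d m + h) - (h + dotv u m + dotv u rho) * X.
  have -> : L = - Sg * qu - h - dotv u m - dotv u rho by rewrite crit_u; ring.
  by rewrite -crit_d; ring.
have b1 : qu * (dotv d rho + dotv d m + h) <=
    entries * (norm1 d * P + 2 * nm + n%:R).
  have qu0 : 0 <= qu by apply: le_trans qu_ge; exact: ltW.
  apply: (@le_trans _ _ (qu * (norm1 d * P + 2 * nm + n%:R))).
    rewrite ler_wpM2l// !lerD//; exact: le_trans (ler_norm _) _.
  by rewrite ler_wpM2r ?qu_le// !addr_ge0// !mulr_ge0.
have b2 : - (h + dotv u m + dotv u rho) * X <= 2 * nm * entries + P * (entries * norm1 d).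
  apply: (@le_trans _ _ ((nm + P) * X)).
    rewrite ler_wpM2r//; move: h_ge0 um_le urho_le; rewrite !ler_norml; lra.
  rewrite mulrDl lerD//; last by rewrite ler_wpM2l.
  rewrite (mulrC 2) -mulrA ler_wpM2l// mulrC; apply: (le_trans X_le).
  by rewrite ler_wpM2l.
have AG : 2 * entries * norm1 d * P <= L * X / 2 + 2 * coerc * entries ^+ 2 * (P ^+ 2 / L).
  have -> : 2 * coerc * entries ^+ 2 * (P ^+ 2 / L) = (2 * coerc / L) * (entries * P) ^+ 2.
    by rewrite exprMn; ring.
  apply: (@le_trans _ _ (L / (2 * coerc) * norm1 d ^+ 2 + (2 * coerc / L) * (entries * P) ^+ 2)).
    have := mulr_ge0 (divr_ge0 (ltW L0) (mulr_ge0 (ler0n R 2) (ltW c0)))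
      (sqr_ge0 (norm1 d - 2 * coerc / L * (entries * P))).
    rewrite -subr_ge0 => H; rewrite -subr_ge0; apply: (le_trans H).
    rewrite le_eqVlt; apply/orP; left; apply/eqP.
    by field; rewrite !gt_eqF.
  rewrite lerD2r; have := ler_wpM2l (ltW (divr_gt0 L0 (mulr_gt0 (ltr0Sn R 1) c0))) d_sqr.
  move=> /le_trans; apply; rewrite le_eqVlt; apply/orP; left; apply/eqP.
  by field; rewrite gt_eqF.
have qk : q * k <= qu * k by rewrite ler_wpM2r.
have PL : 0 <= P ^+ 2 / L by rewrite divr_ge0 ?sqr_ge0 ?ltW.
have e0 : 0 <= entries * (4 * nm + n%:R) by rewrite mulr_ge0// addr_ge0// mulr_ge0.
have e1 : 0 <= 2 * coerc * entries ^+ 2 by rewrite !mulr_ge0 ?sqr_ge0 ?(ltW c0).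
apply: (@le_trans _ _ (entries * (4 * nm + n%:R) + 2 * coerc * entries ^+ 2 * (P ^+ 2 / L))).
  move: key qk b1 b2 AG; move: (L * X) (qu * k) (q * k) => a b c; lra.
have := mulr_ge0 e0 PL; rewrite /bound1 -/nm; move: e0 e1.
by move: (entries * _) (2 * _ * _) (P ^+ 2 / L) => a b c; lra.
Qed.

Let M := 1 + P ^+ 2 / L.
Let L_gt0 : 0 < L. Proof. exact: lt_le_trans L1. Qed.
Let M_ge1 : 1 <= M. Proof. by rewrite lerDl divr_ge0 ?sqr_ge0 ?ltW. Qed.

Lemma level_energy_le :
  L * dotv (fun i => u i - wb i) (mulv B u) <= 2 * bound1 * (1 + norm1 (mulv B r) ^+ 2 / L).
Proof.
have := main_ineq; have := mulr_ge0 (ltW q_gt0) k_ge0; rewrite -/d -/X -/rho -/P; lra.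
Qed.

Lemma level_off_le i :
  u i * (mulv B wb i - q) <= dotv (fun i => u i - wb i) (mulv B u).
Proof.
apply: le_trans X_ge'; rewrite dBwb_eq [leRHS](bigD1 i)//= lerDl sumr_ge0// => j _.
by rewrite mulr_ge0// subr_ge0.
Qed.

Lemma level_wb_le :
  `|dotv (fun i => u i - wb i) (mulv B wb)| <= dotv (fun i => u i - wb i) (mulv B u).
Proof. by rewrite ger0_norm. Qed.

Lemma level_log_le :
  - dotv wb g <= bound1 / q * (1 + norm1 (mulv B r) ^+ 2 / L).
Proof.
have := main_ineq; have := mulr_ge0 (ltW L_gt0) X_ge0; rewrite -/k -/rho -/P -/M => H1 H2.
by rewrite mulrAC ler_pdivlMr// mulrC; lra.
Qed.

Lemma level_slope_le : `|Sg| <= (L + n%:R + norm1 m + norm1 (mulv B r)) / q.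
Proof.
rewrite ler_pdivlMr// -/rho -/P -/nm.
apply: (@le_trans _ _ (`|Sg| * qu)); first by rewrite ler_wpM2l.
rewrite -(ger0_norm (le_trans (ltW q_gt0) qu_ge)) -normrM -normrN -mulNr crit_u.
apply: (le_trans (ler_normD _ _)); apply: lerD => //.
apply: (le_trans (ler_normD _ _)); apply: lerD => //.
by rewrite ger0_norm ?lerD// addr_ge0// ltW.
Qed.

(** [crit_u] gives [Sg] as minus the sum of [L] and lower terms, divided by [qu]; and
    [qu - q <= 2 X] by [qu_eq]. *)
Let slope_center : `|Sg + L / q| <= 2 / q ^+ 2 * (L * X) + (n%:R + nm + P) / q.
Proof.
have qu0 : 0 < qu by exact: lt_le_trans qu_ge.
have -> : Sg + L / q = L * (qu - q) / (q * qu) - (h + dotv u m + dotv u rho) / qu.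
  have -> : L = - Sg * qu - h - dotv u m - dotv u rho by rewrite crit_u; ring.
  by field; rewrite !gt_eqF.
apply: (le_trans (ler_normB _ _)); apply: lerD.
  have qq : 0 <= qu - q by rewrite subr_ge0.
  rewrite ger0_norm; last by rewrite divr_ge0 ?mulr_ge0// ltW.
  have -> : 2 / q ^+ 2 * (L * X) = L * (2 * X) / (q * q) by field; rewrite gt_eqF.
  apply: ler_pM.
  - by apply: mulr_ge0 => //; exact: ltW.
  - by rewrite invr_ge0 mulr_ge0// ltW.
  - by apply: ler_wpM2l; [exact: ltW|rewrite qu_eq; move: X_ge'; lra].
  - by rewrite lef_pV2 ?posrE ?mulr_gt0//; apply: ler_wpM2l => //; exact: ltW.
rewrite normrM; apply: ler_pM => //.
  apply: (le_trans (ler_normD _ _)); apply: lerD => //.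
  apply: (le_trans (ler_normD _ _)); apply: lerD => //.
  by rewrite ger0_norm.
by rewrite ger0_norm; [rewrite lef_pV2 ?posrE|rewrite invr_ge0 ltW].
Qed.

Let LX_le : L * X <= 2 * bound1 * M.
Proof. by move: level_energy_le. Qed.

Definition bound2 : R := 4 / q ^+ 2 * bound1 + (n%:R + norm1 m + 1) / q.

(** [P] is not bounded by a multiple of [1 + P^2 / L] uniformly in [L]; it is with the additional
    factor [sqrt L], since [2 sqrt L P <= L + P^2]. The loss is harmless against a term linear in
    [L]. *)
Lemma slope_center_le :
  `|Sg + L / q| <= bound2 * Num.sqrt L * (1 + norm1 (mulv B r) ^+ 2 / L).
Proof.
apply: (le_trans slope_center); rewrite -/rho -/P -/M /bound2 -/nm.
set sL := Num.sqrt L.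
have s1 : 1 <= sL by rewrite -sqrtr1 ler_wsqrtr.
have sM : 1 <= sL * M by rewrite -[1]mulr1; apply: ler_pM.
have PM : P <= sL * M.
  have s0 : 0 < sL by apply: lt_le_trans s1.
  have sLM : sL * (sL * M) = L + P ^+ 2.
    by rewrite mulrA -expr2 sqr_sqrtr ?ltW// /M mulrDr mulr1 mulrC divfK// gt_eqF.
  rewrite -(ler_pM2l s0) sLM.
  have := sqr_ge0 (sL - P); rewrite sqrrB (sqr_sqrtr (ltW L_gt0)) -mulr_natr; have := mulr_ge0 (ltW s0) P_ge0; lra.
rewrite -[leRHS]mulrA [leRHS]mulrDl; apply: lerD.
  have -> : 4 / q ^+ 2 * bound1 * (sL * M) = 2 / q ^+ 2 * (2 * bound1 * (sL * M)) by ring.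
  apply: ler_wpM2l; first by rewrite divr_ge0 ?sqr_ge0.
  apply: (le_trans LX_le); apply: ler_wpM2l.
    by rewrite mulr_ge0// bound1_ge0.
  by rewrite ler_peMl//; apply: le_trans M_ge1.
rewrite mulrAC; apply: ler_wpM2r; first by rewrite invr_ge0 ltW.
have : 0 <= (n%:R + nm) * (sL * M - 1) by rewrite mulr_ge0 ?subr_ge0// addr_ge0// norm1_ge0.
move: PM; move: (sL * M) (n%:R + nm) => a b; lra.
Qed.

Definition bound3 : R :=
  8 / q ^+ 2 * bound1 + 2 * (n%:R + norm1 m) / q + (1 + 2 * coerc * bound1) / q.

(** The factor [norm1 d] removes the loss: [P * norm1 d] is at most [P^2 / L + L * norm1 d ^ 2], and
    the last term is controlled by [L X]. *)
Lemma slope_center_dev_le :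
  `|Sg + L / q| * norm1 (fun i => u i - wb i) <=
    bound3 * (1 + norm1 (mulv B r) ^+ 2 / L).
Proof.
rewrite -/d -/rho -/P -/M /bound3 -/nm.
have dl0 := norm1_ge0 d; have nm0 : 0 <= nm := norm1_ge0 m; have b0 := bound1_ge0.
have qV : 0 <= q^-1 by rewrite invr_ge0 ltW.
have LX0 : 0 <= L * X by rewrite mulr_ge0// ltW.
apply: (le_trans (ler_wpM2r dl0 slope_center)).
have e1 : 2 / q ^+ 2 * (L * X) * norm1 d <= 8 / q ^+ 2 * bound1 * M.
  have -> : 8 / q ^+ 2 * bound1 * M = 2 / q ^+ 2 * (2 * bound1 * M) * 2 by ring.
  have q2 : 0 <= 2 / q ^+ 2 by rewrite divr_ge0 ?sqr_ge0.
  apply: ler_pM => //; first exact: mulr_ge0.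
  exact: ler_wpM2l.
have e2 : (n%:R + nm) * norm1 d <= 2 * (n%:R + nm) * M.
  have -> : 2 * (n%:R + nm) * M = (n%:R + nm) * (2 * M) by ring.
  apply: ler_wpM2l; first by rewrite addr_ge0.
  apply: (le_trans norm1_d); move: M_ge1; lra.
have e3 : P * norm1 d <= (1 + 2 * coerc * bound1) * M.
  apply: (@le_trans _ _ (P ^+ 2 / L + L * norm1 d ^+ 2)).
    have : 0 <= (P - L * norm1 d) ^+ 2 / L by rewrite divr_ge0 ?sqr_ge0 ?(ltW L_gt0).
    have -> : (P - L * norm1 d) ^+ 2 / L = P ^+ 2 / L + L * norm1 d ^+ 2 - 2 * (P * norm1 d).
      by field; rewrite gt_eqF.
    have := mulr_ge0 P_ge0 dl0; lra.
  rewrite mulrDl mul1r; apply: lerD; first by rewrite /M lerDr.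
  have := ler_wpM2l (ltW L_gt0) d_sqr; move=> /le_trans; apply.
  have -> : L * (coerc * X) = coerc * (L * X) by ring.
  have -> : 2 * coerc * bound1 * M = coerc * (2 * bound1 * M) by ring.
  by apply: ler_wpM2l => //; exact/ltW/coerc_gt0.
have -> : (2 / q ^+ 2 * (L * X) + (n%:R + nm + P) / q) * norm1 d =
    2 / q ^+ 2 * (L * X) * norm1 d + q^-1 * ((n%:R + nm) * norm1 d + P * norm1 d) by ring.
have -> : (8 / q ^+ 2 * bound1 + 2 * (n%:R + nm) / q + (1 + 2 * coerc * bound1) / q) * M =
    8 / q ^+ 2 * bound1 * M + q^-1 * (2 * (n%:R + nm) * M + (1 + 2 * coerc * bound1) * M) by ring.
by apply: lerD => //; apply: ler_wpM2l => //; exact: lerD.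
Qed.

End Bounds.
End PointwiseBounds.

(** * Concentration at the minimal variance portfolio *)

Section Averages.
Context {R : realType} {n : nat} (i0 : 'I_n) {A B : 'M[R]_n} {t : R}
  (E : gaussian_expectation A t).
Hypothesis t_gt0 : 0 < t.
Hypothesis AT : A^T = A.
Hypothesis BT : B^T = B.
Hypothesis AB : A *m B = 1%:M.
Hypothesis BA : B *m A = 1%:M.
Hypothesis S_gt0 : 0 < totsum A.
Implicit Types (m y : 'I_n -> R) (L : R) (F G H : ('I_n -> R) -> R).

Definition avg m L F : R := cexp E m L F / mass E m L.

Let massP m L : 0 < mass E m L := mass_gt0 i0 E t_gt0 S_gt0 m L.

Lemma avgD m L F G : tame F -> tame G ->
  avg m L (fun y => F y + G y) = avg m L F + avg m L G.
Proof. by move=> tF tG; rewrite /avg cexpD// mulrDl. Qed.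

Lemma avgZ m L c F : tame F -> avg m L (fun y => c * F y) = c * avg m L F.
Proof. by move=> tF; rewrite /avg cexpZ// mulrA. Qed.

Lemma avg_cst m L c : avg m L (fun=> c) = c.
Proof.
have a1 : avg m L (fun=> 1) = 1 by rewrite /avg -/(mass E m L) divff ?gt_eqF.
have := avgZ m L c (tame_cst 1); rewrite a1 mulr1 => H; rewrite -[RHS]H.
by congr avg; apply/funext => y; rewrite mulr1.
Qed.

Lemma avgN m L F : tame F -> avg m L (fun y => - F y) = - avg m L F.
Proof.
move=> tF; rewrite -mulN1r -avgZ//; congr avg; apply/funext => y.
by rewrite mulN1r.
Qed.

Lemma avgB m L F G : tame F -> tame G ->
  avg m L (fun y => F y - G y) = avg m L F - avg m L G.
Proof. by move=> tF tG; rewrite avgD ?avgN//; exact: tameN. Qed.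

Lemma avg_sum m L (F : 'I_n -> ('I_n -> R) -> R) : (forall i, tame (F i)) ->
  avg m L (fun y => \sum_i F i y) = \sum_i avg m L (F i).
Proof.
move=> tF; elim: (index_enum _) => [|i s IH].
  by rewrite big_nil -[RHS](avg_cst m L); congr avg; apply/funext => y; rewrite big_nil.
rewrite big_cons -IH -avgD//; last exact: tame_sum.
by congr avg; apply/funext => y; rewrite big_cons.
Qed.

Lemma ler_avg m L F G : tame F -> tame G ->
  (forall y, \sum_i expR (y i) = expR (- L) -> F y <= G y) ->
  avg m L F <= avg m L G.
Proof. by move=> tF tG FG; rewrite /avg ler_pM2r ?invr_gt0// ler_cexp. Qed.

Lemma eq_avg m L F G : (forall y, \sum_i expR (y i) = expR (- L) -> F y = G y) ->
  avg m L F = avg m L G.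
Proof. by move=> FG; rewrite /avg (eq_cexp i0 _ _ FG). Qed.

Lemma avg_norm_le m L F G : tame F -> tame G ->
  (forall y, \sum_i expR (y i) = expR (- L) -> `|F y| <= G y) ->
  `|avg m L F| <= avg m L G.
Proof.
move=> tF tG FG; rewrite ler_norml -avgN//; apply/andP; split.
  apply: ler_avg => //; [exact: tameN|move=> y Ly].
  by have := FG y Ly; rewrite ler_norml => /andP[].
by apply: ler_avg => // y Ly; exact: le_trans (ler_norm _) (FG y Ly).
Qed.

Lemma avg_jensen m L F : tame F -> tame (fun y => expR (F y)) ->
  expR (avg m L F) <= avg m L (fun y => expR (F y)).
Proof.
move=> tF tE; set c := avg m L F.
have tB : tame (fun y => F y - c) by apply: tameB => //; exact: tame_cst.
have t1 : tame (fun y => 1 + (F y - c)) by apply: tameD => //; exact: tame_cst.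
have : avg m L (fun y => expR c * (1 + (F y - c))) <= avg m L (fun y => expR (F y)).
  apply: ler_avg => // [|y _]; first exact: tameZ.
  have -> : expR (F y) = expR c * expR (F y - c) by rewrite -expRD addrC subrK.
  by rewrite ler_wpM2l ?expR_ge0// expR_ge1Dx.
rewrite avgZ// avgD//; last exact: tame_cst.
rewrite avgB//; last exact: tame_cst.
by rewrite !avg_cst -/c subrr addr0 mulr1.
Qed.

Lemma avg_tilt m L a H : tame H ->
  avg m L (fun y => H y * expR (dotv a y)) =
  avg m L (fun y => expR (dotv a y)) * avg (fun i => m i + t * mulv B a i) L H.
Proof.
move=> tH; rewrite /avg (cexp_tilt i0 E t_gt0 AT BT AB BA S_gt0 a m L tH).
have := cexp_tilt i0 E t_gt0 AT BT AB BA S_gt0 a m L (tame_cst 1).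
under [X in cexp _ _ _ X = _ -> _]eq_fun do rewrite mul1r.
move=> ->; rewrite -/(mass E _ L); field.
by rewrite !gt_eqF.
Qed.

Lemma avg_residual m L i : avg m L (fun y => residual A m L y i) = 0.
Proof. by rewrite /avg cexp_residual// mul0r. Qed.

Section Concentration.
Variable wb : 'I_n -> R.
Let q := dotv wb (mulv B wb).
Hypothesis B_pos : forall v : 'I_n -> R, (exists i, v i != 0) -> 0 < dotv v (mulv B v).
Hypothesis wb_ge0 : forall i, 0 <= wb i.
Hypothesis wb_sum : \sum_i wb i = 1.
(* The Karush-Kuhn-Tucker conditions for the minimizer of [dotv w (mulv B w)] on the simplex,
   strict off its support. *)
Hypothesis wb_eq : forall i, wb i != 0 -> mulv B wb i = q.
Hypothesis wb_gt : forall i, wb i = 0 -> q < mulv B wb i.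
Hypothesis q_gt0 : 0 < q.

Let wb_kkt i : q <= mulv B wb i.
Proof. by have [/wb_gt/ltW//|/wb_eq ->] := eqVneq (wb i) 0. Qed.

Let res m L y := residual A m L y.

Let crit m L y i : mulv B (res m L y) i + Sig A m y * mulv B (fun i => expR (y i + L)) i =
  (y i + L) - L - m i.
Proof.
rewrite /res /residual mulvB mulvM BA mulv1.
rewrite (_ : mulv B (fun i => expR (y i + L) * Sig A m y) =
   fun i => Sig A m y * mulv B (fun i => expR (y i + L)) i); last first.
  apply/funext => j; rewrite -mulvZ; congr mulv.
  by apply/funext => k; rewrite mulrC.
ring.
Qed.

Let usum L (y : 'I_n -> R) : \sum_i expR (y i) = expR (- L) -> \sum_i expR (y i + L) = 1.
Proof.
move=> Ly; under eq_bigr do rewrite expRD.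
by rewrite -big_distrl /= Ly -expRD addNr expR0.
Qed.

Let dev m L y := 1 + norm1 (mulv B (res m L y)) ^+ 2 / L.

Let tame_res m L i : tame (fun y => res m L y i).
Proof. exact: tame_residual. Qed.

Let tame_mulvres m L i : tame (fun y => mulv B (res m L y) i).
Proof. by apply: tame_sum => j _; exact: tameZ. Qed.

Let tame_norm1res m L : tame (fun y => norm1 (mulv B (res m L y))).
Proof. by apply: tame_sum => j _; exact: tame_norm. Qed.

Let tame_u L i : tame (fun y => expR (y i + L)).
Proof. by apply: tame_expR; apply: lingrowthD; [exact: lingrowth_coord|exact: lingrowth_cst]. Qed.

Let tame_g L i : tame (fun y => y i + L).
Proof. by apply: tame_lingrowth; apply: lingrowthD; [exact: lingrowth_coord|exact: lingrowth_cst]. Qed.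

Let tame_Sig m : tame (Sig A m).
Proof. exact/tame_lingrowth/lingrowth_Sig. Qed.

Let tame_dev m L : tame (dev m L).
Proof.
apply: tameD; first exact: tame_cst.
by apply: tameM; [exact: tameX|exact: tame_cst].
Qed.

Let u_le1 L (y : 'I_n -> R) i : \sum_i expR (y i) = expR (- L) -> expR (y i + L) <= 1.
Proof.
by move=> /usum <-; rewrite [leRHS](bigD1 i)//= lerDl sumr_ge0// => j _; exact: expR_ge0.
Qed.

Let sumsqr m L y := \sum_i res m L y i ^+ 2.

Let tame_sumsqr m L : tame (sumsqr m L).
Proof. by apply: tame_sum => i _; exact: tameX. Qed.

Let sumsqr_ge0 m L y : 0 <= sumsqr m L y.
Proof. by apply: sumr_ge0 => i _; exact: sqr_ge0. Qed.

Let norm1res_le m L y :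
  norm1 (mulv B (res m L y)) ^+ 2 <= entries B ^+ 2 * n%:R * sumsqr m L y.
Proof.
apply: (@le_trans _ _ ((entries B * norm1 (res m L y)) ^+ 2)).
  by rewrite ler_sqr ?nnegrE ?norm1_mulv_le// ?mulr_ge0 ?norm1_ge0 ?entries_ge0.
rewrite exprMn -mulrA; apply: ler_wpM2l; first exact: sqr_ge0.
exact: norm1_sqr_le_sum.
Qed.

(** A self-bounding estimate. Integration by parts bounds the average of [sumsqr] by that of
    [1 + |Sig|], [level_slope_le] bounds [|Sig|] by [L] and [P], and [P] is at most of the order of
    the square root of [sumsqr], which the left side absorbs. *)
Let avg_sumsqr m : exists2 C, 0 <= C & forall L, 1 <= L -> avg m L (sumsqr m L) <= C * L.
Proof.
pose K := (\sum_i `|A i i|) + 2 * norm1 (rowsum A) + n%:R * totsum A.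
pose T := t * n%:R / q.
(* As [P^2 <= a * sumsqr], the last term of [T P <= a T^2 + P^2 / (2 a)] is at most half of
   [sumsqr]; the [1] makes [a] positive. *)
pose a := entries B ^+ 2 * n%:R + 1.
have K0 : 0 <= K.
  by rewrite !addr_ge0// ?mulr_ge0 ?norm1_ge0// ?(ltW S_gt0)// sumr_ge0.
have T0 : 0 <= T by rewrite divr_ge0 ?mulr_ge0 ?(ltW t_gt0) ?(ltW q_gt0).
have a0 : 0 < a by rewrite ltr_wpDl// mulr_ge0 ?sqr_ge0.
pose K1 := t * K + T * (n%:R + norm1 m) + a * T ^+ 2.
have K10 : 0 <= K1.
  have nm0 : 0 <= n%:R + norm1 m by rewrite addr_ge0 ?norm1_ge0.
  exact: addr_ge0 (addr_ge0 (mulr_ge0 (ltW t_gt0) K0) (mulr_ge0 T0 nm0))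
    (mulr_ge0 (ltW a0) (sqr_ge0 _)).
exists (2 * (K1 + T)) => [|L L1]; first by rewrite mulr_ge0// addr_ge0.
pose D i y := A i i - 2 * rowsum A i * expR (y i + L) + totsum A * expR (y i + L) ^+ 2 -
    expR (y i + L) * (1 - expR (y i + L)) * Sig A m y.
have tD i : tame (D i).
  apply: tameB; last first.
    apply: tameM => //; apply: tameM => //; apply: tameB => //; exact: tame_cst.
  apply: tameD; last exact/tameZ/tameX.
  by apply: tameB; [exact: tame_cst|exact: tameZ].
have E1 : avg m L (sumsqr m L) = avg m L (fun y => t * \sum_i D i y).
  rewrite avgZ; last exact: tame_sum.
  rewrite !avg_sum//; last by move=> i; exact: tameX.
  rewrite big_distrr; apply: eq_bigr => i _ /=.
  by rewrite /avg cexp_residual_sqr// mulrA.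
(* Moving the last term to the left gives the factor [2] of the constant; [K1 <= K1 * L] does the
   rest. *)
suff H : avg m L (fun y => t * \sum_i D i y) <= K1 + T * L + 2^-1 * avg m L (sumsqr m L).
  move: H; rewrite E1; have := ler_wpM2l K10 L1; lra.
rewrite -[leRHS]addrA -(avg_cst m L K1) -(avg_cst m L (T * L)) -avgZ// -avgD//; [|exact: tame_cst|exact: tameZ].
rewrite -avgD//; [|exact: tame_cst|by apply: tameD; [exact: tame_cst|exact: tameZ]].
apply: ler_avg; first by apply: tameZ; exact: tame_sum.
  by do 2![apply: tameD; first exact: tame_cst]; exact: tameZ.
move=> y Ly.
have slope := level_slope_le BT B_pos wb_kkt q_gt0 L1 (usum Ly) (crit m L y).
have PR := norm1res_le m L y.
set P := norm1 (mulv B (res m L y)) in slope PR *.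
have P0 : 0 <= P by exact: norm1_ge0.
have sumD : \sum_i D i y <= K + n%:R * `|Sig A m y|.
  have -> : K + n%:R * `|Sig A m y| =
      \sum_i (`|A i i| + 2 * `|rowsum A i| + totsum A + `|Sig A m y|).
    by rewrite !big_split /= !sumr_const !card_ord -big_distrr /= /K /norm1 !mulr_natl.
  apply: ler_sum => i _; rewrite /D.
  have u0 := expR_ge0 (y i + L); have u1 := u_le1 i Ly.
  set u := expR _ in u0 u1 *.
  apply: lerD; first apply: lerD; first apply: lerD.
  - exact: ler_norm.
  - rewrite -mulrN -!mulrA; apply: ler_wpM2l => //.
    apply: (le_trans (ler_norm _)); rewrite normrM normrN (ger0_norm u0).
    by rewrite ler_piMr.
  - by rewrite ler_piMr ?(ltW S_gt0)// expr_le1.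
  - apply: (le_trans (ler_norm _)); rewrite normrN normrM ler_piMl//.
    by rewrite ger0_norm; nra.
apply: (le_trans (ler_wpM2l (ltW t_gt0) sumD)).
have -> : t * (K + n%:R * `|Sig A m y|) = t * K + (t * n%:R) * `|Sig A m y| by ring.
have tn : 0 <= t * n%:R by rewrite mulr_ge0// ltW.
have := ler_wpM2l tn slope.
have -> : t * n%:R * ((L + n%:R + norm1 m + P) / dotv wb (mulv B wb)) =
    T * L + T * (n%:R + norm1 m) + T * P by rewrite /T -/q; ring.
move=> H1.
have TP : T * P <= a * T ^+ 2 + 2^-1 * sumsqr m L y.
  apply: (@le_trans _ _ (a * T ^+ 2 + (2 * a)^-1 * P ^+ 2)).
    rewrite -subr_ge0.
    have -> : a * T ^+ 2 + (2 * a)^-1 * P ^+ 2 - T * P =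
        (2 * a)^-1 * (P - a * T) ^+ 2 + a * T ^+ 2 / 2 by field; rewrite gt_eqF.
    apply: addr_ge0.
      by apply: mulr_ge0; [rewrite invr_ge0 mulr_ge0// ltW|exact: sqr_ge0].
    by rewrite divr_ge0// mulr_ge0 ?sqr_ge0// ltW.
  rewrite lerD2l invfM -mulrA; apply: ler_wpM2l; first by rewrite invr_ge0.
  rewrite mulrC ler_pdivrMr// mulrC; apply: (le_trans PR).
  by apply: ler_wpM2r => //; rewrite /a lerDl.
rewrite /K1; lra.
Qed.

Let avg_dev m : exists2 C, 0 <= C & forall L, 1 <= L -> avg m L (dev m L) <= C.
Proof.
have [C C0 HC] := avg_sumsqr m.
pose K := entries B ^+ 2 * n%:R.
have K0 : 0 <= K by rewrite mulr_ge0 ?sqr_ge0.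
exists (1 + K * C) => [|L L1]; first by rewrite addr_ge0// mulr_ge0.
have L0 : 0 < L by apply: lt_le_trans L1.
apply: (@le_trans _ _ (avg m L (fun y => 1 + (K / L) * sumsqr m L y))).
  apply: ler_avg => //; first by apply: tameD; [exact: tame_cst|exact: tameZ].
  move=> y _; rewrite /dev lerD2l [leRHS]mulrAC; apply: ler_wpM2r; first by rewrite invr_ge0 ltW.
  exact: norm1res_le.
rewrite avgD; [|exact: tame_cst|exact: tameZ].
rewrite avg_cst avgZ// lerD2l -mulrA; apply: ler_wpM2l => //.
by rewrite mulrC ler_pdivrMr// HC.
Qed.

Lemma finite_choice (f : 'I_n -> R -> R) :
  (forall i, exists2 C, 0 <= C & forall L, 1 <= L -> f i L <= C / L) ->
  exists2 C, 0 <= C & forall L, 1 <= L -> forall i, f i L <= C / L.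
Proof.
move=> H; have /choice[C HC] : forall i, exists C, 0 <= C /\ forall L, 1 <= L -> f i L <= C / L.
  by move=> i; have [C C0 HC] := H i; exists C.
have C0 i : 0 <= C i by case: (HC i).
exists (\sum_i C i) => [|L L1 i]; first by rewrite sumr_ge0.
have [_ /(_ _ L1) H1] := HC i; apply: (le_trans H1).
apply: ler_wpM2r; first by rewrite invr_ge0 (le_trans _ L1).
by rewrite (bigD1 i)//= lerDl sumr_ge0.
Qed.

Let energy L (y : 'I_n -> R) := dotv (fun i => expR (y i + L) - wb i)
  (mulv B (fun i => expR (y i + L))).

Let tame_d L i : tame (fun y => expR (y i + L) - wb i).
Proof. by apply: tameB => //; exact: tame_cst. Qed.

Let tame_energy L : tame (energy L).
Proof.
by apply: tame_sum => i _; apply: tameM => //; apply: tame_sum => j _; exact: tameZ.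
Qed.

Let avg_energy m : exists2 C, 0 <= C & forall L, 1 <= L -> avg m L (energy L) <= C / L.
Proof.
have [C C0 HC] := avg_dev m.
have b0 : 0 <= 2 * bound1 A B m by rewrite mulr_ge0// bound1_ge0.
exists (2 * bound1 A B m * C) => [|L L1]; first exact: mulr_ge0.
have L0 : 0 < L by apply: lt_le_trans L1.
rewrite ler_pdivlMr// mulrC -avgZ//.
apply: (@le_trans _ _ (avg m L (fun y => 2 * bound1 A B m * dev m L y))).
  apply: ler_avg; [exact: tameZ|exact: tameZ|move=> y Ly].
  exact: (level_energy_le BT BA B_pos wb_ge0 wb_sum wb_kkt q_gt0 L1 (usum Ly) (crit m L y)).
by rewrite avgZ//; apply: ler_wpM2l => //; exact: HC.
Qed.

Let avg_off m i : wb i = 0 ->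
  exists2 C, 0 <= C & forall L, 1 <= L -> avg m L (fun y => expR (y i + L)) <= C / L.
Proof.
move=> /wb_gt wi; have [C C0 HC] := avg_energy m.
have g0 : 0 < mulv B wb i - q by rewrite subr_gt0.
exists (C / (mulv B wb i - q)) => [|L L1]; first by rewrite divr_ge0// ltW.
rewrite mulrAC ler_pdivlMr// mulrC -avgZ//; apply: le_trans (HC L L1).
apply: ler_avg => [||y Ly] //; first exact: tameZ.
rewrite mulrC.
exact: (level_off_le B_pos wb_kkt (usum Ly) i).
Qed.

(** Subtracting the [wb]-average removes the constant [L] from [crit]; on the support the two terms
    in [B wb] cancel, both being [q]. *)
Let tdev L i (y : 'I_n -> R) := mulv B (fun j => expR (y j + L) - wb j) i -
  dotv wb (mulv B (fun j => expR (y j + L) - wb j)).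

Let tame_mulvd L i : tame (fun y => mulv B (fun j => expR (y j + L) - wb j) i).
Proof. by apply: tame_sum => j _; exact: tameZ. Qed.

Let tame_tdev L i : tame (tdev L i).
Proof. by apply: tameB => //; apply: tame_sum => j _; exact: tameZ. Qed.

Let norm1_wb : norm1 wb = 1.
Proof. by rewrite -wb_sum; apply: eq_bigr => i _; rewrite ger0_norm. Qed.

Let tdev_le L i (y : 'I_n -> R) :
  `|tdev L i y| <= 2 * entries B * norm1 (fun j => expR (y j + L) - wb j).
Proof.
rewrite /tdev; set d := (fun j => _).
have H := norm1_mulv_le B d.
apply: (le_trans (ler_normB _ _)).
have H1 : `|mulv B d i| <= entries B * norm1 d by apply: le_trans H; exact: coord_le_norm1.
have H2 : `|dotv wb (mulv B d)| <= entries B * norm1 d.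
  by apply: le_trans H; apply: (le_trans (norm_dotv_le _ _)); rewrite norm1_wb mul1r.
by apply: (le_trans (lerD H1 H2)); rewrite -mulrA mulr_natl mulr2n.
Qed.

(** [Sig * tdev] is [gg - rr], where [rr] is linear in [residual] and averages to [0], and [gg]
    consists of logarithms that [level_log_le] controls because [wb i] is positive. Replacing [Sig]
    by [- L / q] costs a bounded average, by [slope_center_dev_le]. Hence [L] times the average of
    [tdev] is bounded. *)
Let avg_tdev m i : wb i != 0 ->
  exists2 C, 0 <= C & forall L, 1 <= L -> `|avg m L (tdev L i)| <= C / L.
Proof.
move=> wi; have [C C0 HC] := avg_dev m.
have wi0 : 0 < wb i by rewrite lt_neqAle eq_sym wi wb_ge0.
have b1 := bound1_ge0 A B m.
pose K1 := (1 / wb i + 1) * (bound1 A B m / q) + 2 * norm1 m.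
pose K2 := 2 * entries B * bound3 A B wb m.
have e0 : 0 <= 2 * entries B by rewrite mulr_ge0 ?entries_ge0.
have nm0 := norm1_ge0 m.
have qV : 0 <= q^-1 by rewrite invr_ge0 ltW.
have K10 : 0 <= K1.
  apply: addr_ge0; last exact: mulr_ge0.
  apply: mulr_ge0; last exact: mulr_ge0.
  by rewrite addr_ge0// divr_ge0.
have K20 : 0 <= K2.
  apply: mulr_ge0 => //; rewrite /bound3 -/q.
  apply: addr_ge0; first apply: addr_ge0.
  - by rewrite !mulr_ge0 ?invr_ge0 ?sqr_ge0.
  - by rewrite !mulr_ge0 ?addr_ge0.
  - by rewrite !mulr_ge0 ?addr_ge0 ?mulr_ge0 ?(ltW (coerc_gt0 A)).
exists (q * (K1 + K2) * C) => [|L L1].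
  exact: mulr_ge0 (mulr_ge0 (ltW q_gt0) (addr_ge0 K10 K20)) C0.
have L0 : 0 < L by apply: lt_le_trans L1.
have HCL := HC L L1.
pose rr y := mulv B (res m L y) i - dotv wb (mulv B (res m L y)).
have tmr j : tame (fun y => mulv B (res m L y) j) by exact: tame_mulvres.
have trr : tame rr.
  by apply: tameB => //; apply: tame_sum => j _; exact: tameZ.
have avr j : avg m L (fun y => mulv B (res m L y) j) = 0.
  rewrite avg_sum => [|k]; last exact: tameZ.
  by rewrite big1// => k _; rewrite avgZ// avg_residual mulr0.
have arr : avg m L rr = 0.
  rewrite avgB//; last by apply: tame_sum => j _; exact: tameZ.
  rewrite avr sub0r avg_sum => [|j]; last exact: tameZ.
  by rewrite big1 ?oppr0// => k _; rewrite avgZ// avr mulr0.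
pose gg y := ((y i + L) - m i) - dotv wb (fun j => (y j + L) - m j).
have tgg : tame gg.
  apply: tameB; first by apply: tameB => //; exact: tame_cst.
  apply: tame_sum => j _; apply: tameZ; apply: tameB => //; exact: tame_cst.
have ggE y : Sig A m y * tdev L i y = gg y - rr y.
  have uE : mulv B (fun j => expR (y j + L) - wb j) =
      fun k => mulv B (fun j => expR (y j + L)) k - mulv B wb k.
    by apply/funext => k; rewrite mulvB.
  have c1 := crit m L y.
  have c2 : dotv wb (mulv B (res m L y)) +
      Sig A m y * dotv wb (mulv B (fun j => expR (y j + L))) =
      dotv wb (fun j => (y j + L) - m j) - L.
    rewrite -dotvZ -dotvD.
    have -> : (fun k => mulv B (res m L y) k + Sig A m y * mulv B (fun j => expR (y j + L)) k) =
       fun j => (y j + L - m j) - L.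
      by apply/funext => k; rewrite c1; ring.
    rewrite dotvB; congr (_ - _).
    by rewrite /dotv -big_distrl /= wb_sum mul1r.
  rewrite /tdev uE dotvB (wb_eq wi) -/q /gg /rr.
  have := c1 i; move: c2; lra.
have ggle y : \sum_i expR (y i) = expR (- L) -> `|gg y| <= K1 * dev m L y.
  move=> Ly.
  have LL := level_log_le BT BA B_pos wb_ge0 wb_sum wb_kkt q_gt0 L1 (usum Ly) (crit m L y).
  set k := - dotv wb (fun j => y j + L) in LL.
  have gl j : y j + L <= 0 by rewrite -ler_expR expR0 u_le1.
  have kE : k = \sum_j wb j * - (y j + L).
    by rewrite /k -sumrN; apply: eq_bigr => j _; rewrite mulrN.
  have k1 : - (y i + L) <= k / wb i.
    rewrite ler_pdivlMr// mulrC kE (bigD1 i)//= lerDl sumr_ge0// => j _.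
    by rewrite mulr_ge0// oppr_ge0.
  have k0 : 0 <= k by rewrite kE sumr_ge0// => j _; rewrite mulr_ge0// oppr_ge0.
  have d1 : 1 <= dev m L y by rewrite lerDl divr_ge0 ?sqr_ge0// ltW.
  rewrite /gg dotvB.
  have mi := coord_le_norm1 m i.
  have wm : `|dotv wb m| <= norm1 m.
    by apply: (le_trans (norm_dotv_le _ _)); rewrite norm1_wb mul1r.
  have S1 : `|(y i + L) - m i - (dotv wb (fun j => y j + L) - dotv wb m)| <=
      k / wb i + k + 2 * norm1 m.
    move: mi wm (gl i) k1; rewrite -[dotv wb (fun j => y j + L)]opprK -/k.
    rewrite !ler_norml; move: (k / wb i) k0 => x; lra.
  apply: (le_trans S1); rewrite /K1 [leRHS]mulrDl; apply: lerD.
    have -> : k / wb i + k = (1 / wb i + 1) * k by ring.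
    rewrite -[leRHS]mulrA; apply: ler_wpM2l => //.
    by rewrite addr_ge0// divr_ge0.
  by rewrite ler_peMr// mulr_ge0.
have cen y : \sum_i expR (y i) = expR (- L) ->
    `|(Sig A m y + L / q) * tdev L i y| <= K2 * dev m L y.
  move=> Ly.
  have H := slope_center_dev_le BT BA B_pos wb_ge0 wb_sum wb_kkt q_gt0 L1 (usum Ly) (crit m L y).
  rewrite normrM; apply: (le_trans (ler_wpM2l (normr_ge0 _) (tdev_le L i y))).
  by rewrite mulrCA /K2 -[leRHS]mulrA; apply: ler_wpM2l.
have tS : tame (fun y => Sig A m y * tdev L i y) by exact: tameM.
have tC : tame (fun y => (Sig A m y + L / q) * tdev L i y).
  by apply: tameM => //; apply: tameD => //; exact: tame_cst.
have split : avg m L (tdev L i) = (q / L) *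
    (avg m L (fun y => (Sig A m y + L / q) * tdev L i y) - avg m L gg).
  rewrite -[avg m L gg]subr0 -arr -avgB//.
  have <- : avg m L (fun y => Sig A m y * tdev L i y) = avg m L (fun y => gg y - rr y).
    by apply: eq_avg => y _; rewrite ggE.
  rewrite -avgB// (_ : (fun y => _ - _) = fun y => (L / q) * tdev L i y).
    rewrite avgZ// mulrA (_ : q / L * (L / q) = 1) ?mul1r//.
    by field; rewrite !gt_eqF.
  by apply/funext => y; ring.
rewrite split normrM ger0_norm ?divr_ge0 ?(ltW q_gt0) ?(ltW L0)//.
have -> : q * (K1 + K2) * C / L = q / L * (K2 * C + K1 * C) by ring.
apply: ler_wpM2l; first by rewrite divr_ge0 ?(ltW q_gt0) ?(ltW L0).
apply: (le_trans (ler_normB _ _)); apply: lerD.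
  apply: (le_trans (avg_norm_le m tC (tameZ K2 (tame_dev m L)) cen)).
  by rewrite avgZ//; apply: ler_wpM2l.
apply: (le_trans (avg_norm_le m tgg (tameZ K1 (tame_dev m L)) ggle)).
by rewrite avgZ//; apply: ler_wpM2l.
Qed.

(** In the quadratic form [D.B D] every product [D_j (B D)_j] has a factor [O(1/L)]: [D_j] off the
    support, by [avg_off], and [(B D)_j] on it, by [avg_tdev] and [Dwb]. Coercivity bounds the
    square of [norm1 D] by [norm1 D * O(1/L)], and one factor is divided out. *)
Lemma avg_softmax m : exists2 C, 0 <= C & forall L, 1 <= L -> forall i,
  `|avg m L (fun y => expR (y i + L)) - wb i| <= C / L.
Proof.
pose D L i := avg m L (fun y => expR (y i + L)) - wb i.
have [C1 C10 H1] := avg_energy m.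
have DE L v : avg m L (fun y => dotv v (fun j => expR (y j + L) - wb j)) = dotv v (D L).
  rewrite avg_sum => [|j]; last exact: tameZ.
  by apply: eq_bigr => j _; rewrite avgZ// avgB ?avg_cst//; exact: tame_cst.
have Dwb L : 1 <= L -> `|dotv wb (mulv B (D L))| <= C1 / L.
  move=> L1; have L0 : 0 < L by apply: lt_le_trans L1.
  rewrite dotv_mulv// -DE.
  apply: (le_trans _ (H1 L L1)); apply: avg_norm_le => // [|y Ly].
    by apply: tame_sum => j _; exact: tameZ.
  have := level_wb_le B_pos wb_kkt (usum Ly).
  by rewrite dotvC.
have [C2 C20 H2] : exists2 C, 0 <= C & forall L, 1 <= L -> forall i,
    (if wb i == 0 then `|D L i| else `|mulv B (D L) i|) <= C / L.
  apply: finite_choice => i; case: eqVneq => [wi|wi].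
    have [C C0 HC] := avg_off m wi; exists C => // L L1.
    rewrite /D wi subr0 ger0_norm ?HC//.
    rewrite -(avg_cst m L 0); apply: ler_avg => //; exact: tame_cst.
  have [C C0 HC] := avg_tdev m wi; exists (C + C1) => [|L L1]; first exact: addr_ge0.
  have -> : mulv B (D L) i = avg m L (tdev L i) + dotv wb (mulv B (D L)).
    rewrite /tdev avgB//; last by apply: tame_sum => j _; exact: tameZ.
    rewrite -[avg m L _]/(avg m L (fun y => dotv (B i) (fun j => expR (y j + L) - wb j))) DE.
    rewrite (_ : avg m L _ = dotv wb (mulv B (D L))) ?subrK//.
    rewrite [in RHS]dotv_mulv// -DE; congr avg; apply/funext => y.
    by rewrite dotv_mulv.
  by apply: (le_trans (ler_normD _ _)); rewrite mulrDl lerD ?HC ?Dwb.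
pose K := C2 * (1 + entries B).
have e0 := entries_ge0 B.
have K0 : 0 <= K by rewrite mulr_ge0// addr_ge0.
have c0 := coerc_gt0 A.
exists (coerc A * (n%:R * K)) => [|L L1 i].
  exact: mulr_ge0 (ltW c0) (mulr_ge0 (ler0n _ _) K0).
have L0 : 0 < L by apply: lt_le_trans L1.
have LV : 0 <= L^-1 by rewrite invr_ge0 ltW.
apply: (@le_trans _ _ (norm1 (D L))); first exact: (coord_le_norm1 (D L) i).
have N0 := norm1_ge0 (D L).
have Q := norm1_sqr_le_quad BT BA B_pos (D L).
have QQ : dotv (D L) (mulv B (D L)) <= norm1 (D L) * (n%:R * K / L).
  apply: (@le_trans _ _ (\sum_(j < n) norm1 (D L) * (K / L))); last first.
    by rewrite sumr_const card_ord -mulr_natl le_eqVlt; apply/orP; left; apply/eqP; ring.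
  apply: ler_sum => j _; apply: (le_trans (ler_norm _)); rewrite normrM.
  have := H2 L L1 j; have dj := coord_le_norm1 (D L) j.
  have Bj : `|mulv B (D L) j| <= entries B * norm1 (D L).
    by apply: le_trans (norm1_mulv_le B (D L)); exact: coord_le_norm1.
  have C2L : 0 <= C2 / L by rewrite divr_ge0// ltW.
  have KE : K / L = C2 / L + C2 / L * entries B by rewrite /K; ring.
  rewrite KE mulrDr; case: ifP => _ Hj.
    apply: (@le_trans _ _ (C2 / L * (entries B * norm1 (D L)))); first exact: ler_pM.
    by rewrite mulrA [leRHS]addrC mulrC lerDl mulr_ge0.
  apply: (@le_trans _ _ (norm1 (D L) * (C2 / L))); first exact: ler_pM.
  by rewrite lerDl !mulr_ge0.
have : norm1 (D L) * norm1 (D L) <= norm1 (D L) * (coerc A * (n%:R * K / L)).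
  rewrite -expr2; apply: (le_trans Q); rewrite mulrCA; apply: ler_wpM2l => //; exact: ltW.
have [->|Dn] := eqVneq (norm1 (D L)) 0.
  by move=> _; apply: mulr_ge0 LV; exact: mulr_ge0 (ltW c0) (mulr_ge0 (ler0n _ _) K0).
by rewrite ler_pM2l ?lt_def ?Dn// !mulrA.
Qed.

Let delta (i k : 'I_n) : R := (k == i)%:R.

Let dotv_delta i (y : 'I_n -> R) : dotv (delta i) y = y i.
Proof.
rewrite /dotv (bigD1 i)//= /delta eqxx mul1r big1 ?addr0// => k /negbTE ->.
by rewrite mul0r.
Qed.

Let tame_dotv a : tame (fun y : 'I_n -> R => dotv a y).
Proof. by apply: tame_lingrowth; apply: lingrowth_dotv => i; exact: lingrowth_coord. Qed.

Let tame_exp_dotv a : tame (fun y : 'I_n -> R => expR (dotv a y)).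
Proof. by apply: tame_expR; apply: lingrowth_dotv => i; exact: lingrowth_coord. Qed.

Lemma avg_expR_ge m L a :
  expR (avg m L (fun y => dotv a y)) <= avg m L (fun y => expR (dotv a y)).
Proof. exact: avg_jensen. Qed.

Lemma avg_expR_gt0 m L a : 0 < avg m L (fun y => expR (dotv a y)).
Proof. exact: lt_le_trans (expR_gt0 _) (avg_expR_ge m L a). Qed.

(* The tilted average of [exp (- a.y)] is the inverse of the average of [exp (a.y)],
   so Jensen's inequality for the former bounds the latter from above. *)
Lemma avg_expR_le m L a : avg m L (fun y => expR (dotv a y)) <=
  expR (avg (fun i => m i + t * mulv B a i) L (fun y => dotv a y)).
Proof.
have tN : tame (fun y : 'I_n -> R => expR (- dotv a y)).
  by apply/tame_expR/lingrowthN; apply: lingrowth_dotv => i; exact: lingrowth_coord.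
have := avg_tilt m L a tN.
rewrite (_ : (fun y => _ * _) = fun=> 1); last first.
  by apply/funext => y; rewrite -expRD addNr expR0.
rewrite avg_cst; set m' := (fun i => m i + _); set x := avg m L _; set z := avg m' L _ => xz.
have : expR (- avg m' L (fun y => dotv a y)) <= z.
  by rewrite -avgN//; apply: avg_jensen => //; exact: tameN.
rewrite expRN; set w := expR _ => wz.
have w0 : 0 < w by exact: expR_gt0.
have z0 : 0 < z by apply: lt_le_trans wz; rewrite invr_gt0.
have -> : x = z^-1 by apply: (mulIf (lt0r_neq0 z0)); rewrite -xz mulVf// gt_eqF.
by rewrite -[w]invrK lef_pV2 ?posrE ?invr_gt0.
Qed.

Lemma ln_dist (x w c : R) : 0 < w -> `|x - w| <= c -> c <= w / 2 ->
  `|ln x - ln w| <= 2 * c / w.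
Proof.
move=> w0 xw cw; have x0 : w / 2 <= x.
  by move: xw; rewrite ler_norml; lra.
have xp : 0 < x by apply: lt_le_trans x0; rewrite divr_gt0.
have c0 : 0 <= c by apply: le_trans xw.
have lnle (z : R) : 0 < z -> ln z <= z - 1.
  by move=> z0; have := expR_ge1Dx (ln z); rewrite lnK ?posrE//; lra.
move: xw; rewrite !ler_norml => /andP[xw1 xw2]; apply/andP; split.
  have := lnle (w / x) (divr_gt0 w0 xp); rewrite ln_div ?posrE//.
  suff : w / x - 1 <= 2 * c / w by lra.
  rewrite lerBlDr ler_pdivrMr// mulrDl mul1r -lerBlDr.
  apply: (@le_trans _ _ c); first lra.
  have E2 : 2 * c / w * (w / 2) = c by field; rewrite gt_eqF.
  rewrite -[leLHS]E2; apply: ler_wpM2l => //.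
  by rewrite divr_ge0 ?mulr_ge0// ltW.
have := lnle (x / w) (divr_gt0 xp w0); rewrite ln_div ?posrE//.
suff : x / w - 1 <= 2 * c / w by lra.
rewrite lerBlDr ler_pdivrMr// mulrDl mul1r -lerBlDr divfK ?gt_eqF//; lra.
Qed.

(** The average of [log u_i] lies between the logarithms of the averages of [u_i] at the means [m2]
    and [m], by Jensen's inequality and [avg_expR_le]; [avg_softmax] applies at both means. *)
Lemma avg_log m i : wb i != 0 -> exists2 C, 0 <= C & exists2 L0, 1 <= L0 &
  forall L, L0 <= L -> `|avg m L (fun y => y i + L) - ln (wb i)| <= C / L.
Proof.
(* [m2] is chosen so that the tilt by coordinate [i] translates it to [m]. *)
move=> wi; have wi0 : 0 < wb i by rewrite lt_neqAle eq_sym wi wb_ge0.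
pose m2 k := m k - t * mulv B (delta i) k.
have [C1 C10 H1] := avg_softmax m.
have [C2 C20 H2] := avg_softmax m2.
pose C := C1 + C2.
have C0 : 0 <= C by exact: addr_ge0.
exists (2 * C / wb i); first by rewrite divr_ge0 ?mulr_ge0.
(* Beyond this level [C / L] is at most [wb i / 2], as [ln_dist] requires. *)
exists (1 + 2 * C / wb i); first by rewrite lerDl divr_ge0 ?mulr_ge0.
move=> L LL0.
have L1 : 1 <= L by apply: le_trans LL0; rewrite lerDl divr_ge0 ?mulr_ge0.
have L0 : 0 < L by apply: lt_le_trans L1.
have small : C / L <= wb i / 2.
  have : 2 * C <= L * wb i.
    by rewrite -ler_pdivrMr//; apply: le_trans LL0; rewrite lerDr.
  by rewrite ler_pdivrMr//; lra.
have HH m' C' : 0 <= C' -> C' <= C ->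
    `|avg m' L (fun y => expR (y i + L)) - wb i| <= C' / L ->
    `|ln (avg m' L (fun y => expR (y i + L))) - ln (wb i)| <= 2 * C / wb i / L.
  move=> C'0 C'C H; have -> : 2 * C / wb i / L = 2 * (C / L) / wb i by ring.
  apply: ln_dist => //; apply: (le_trans H).
  by apply: ler_wpM2r => //; rewrite invr_ge0 ltW.
have a1 := HH m C1 C10 (ltac:(by rewrite lerDl)) (H1 L L1 i).
have a2 := HH m2 C2 C20 (ltac:(by rewrite lerDr)) (H2 L L1 i).
have uE m' : avg m' L (fun y => expR (y i + L)) = expR L * avg m' L (fun y => expR (dotv (delta i) y)).
  rewrite -avgZ//; congr avg; apply/funext => y.
  by rewrite -expRD dotv_delta addrC.
have gE m' : avg m' L (fun y => y i + L) = avg m' L (fun y => dotv (delta i) y) + L.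
  rewrite -[X in _ + X](avg_cst m' L) -avgD//; last exact: tame_cst.
  by congr avg; apply/funext => y; rewrite dotv_delta.
have upper : avg m L (fun y => y i + L) <= ln (avg m L (fun y => expR (y i + L))).
  have J := avg_expR_ge m L (delta i).
  rewrite -[leLHS]expRK ler_ln ?posrE ?expR_gt0//; last first.
    by rewrite uE mulr_gt0 ?expR_gt0// avg_expR_gt0.
  by rewrite gE uE addrC expRD; apply: ler_wpM2l => //; exact: expR_ge0.
have lower : ln (avg m2 L (fun y => expR (y i + L))) <= avg m L (fun y => y i + L).
  have J := avg_expR_le m2 L (delta i).
  have mE : (fun k => m2 k + t * mulv B (delta i) k) = m.
    by apply/funext => k; rewrite /m2 subrK.
  rewrite mE in J.
  rewrite -[leRHS]expRK ler_ln ?posrE ?expR_gt0//; last first.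
    by rewrite uE mulr_gt0 ?expR_gt0// avg_expR_gt0.
  by rewrite gE uE addrC expRD; apply: ler_wpM2l => //; exact: expR_ge0.
move: upper lower a1 a2; rewrite !ler_norml.
by move: (ln (avg m L _)) (ln (avg m2 L _)) (avg m L _) => x1 x2 x3; lra.
Qed.

(** [avg_expR_le] bounds the average of [u_k] by the exponential of the average of [log u_k] at the
    mean [m1]. By [crit] the latter is [L + m1_k] plus the average of [Sig (B u)_k], where [Sig] is
    near [- L / q] and [(B u)_k] near [(B wb)_k > q]. The decay is thus exponential; the fourth
    power is what [mass_translate_ge] calls for. *)
Lemma avg_off_small m k : wb k = 0 -> exists2 C, 0 <= C &
  forall L, 1 <= L -> avg m L (fun y => expR (y k + L)) <= C / L ^+ 4.
Proof.
move=> wk; pose m1 i := m i + t * mulv B (delta k) i.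
have gam : 0 < mulv B wb k - q by rewrite subr_gt0 wb_gt.
have [C1 C10 H1] := avg_softmax m1.
have [C2 C20 H2] := avg_dev m1.
have b1 := bound1_ge0 A B m1.
have e0 := entries_ge0 B.
have qV : 0 <= q^-1 by rewrite invr_ge0 ltW.
have b2 : 0 <= bound2 A B wb m1.
  rewrite /bound2 -/q; apply: addr_ge0; last by rewrite mulr_ge0// !addr_ge0// norm1_ge0.
  by rewrite !mulr_ge0// invr_ge0 sqr_ge0.
pose K := entries B * bound2 A B wb m1 * C2.
have K0 : 0 <= K by apply: mulr_ge0 => //; exact: mulr_ge0.
pose K' := entries B * (n%:R * C1) / q.
(* Half of the exponential rate; the other half absorbs the error [K * sqrt L] left by
   [slope_center_le]. *)
pose c := (mulv B wb k - q) / (2 * q).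
have c0 : 0 < c by rewrite divr_gt0// mulr_gt0.
pose C' := m1 k + K' + K ^+ 2 / (4 * c).
exists (expR C' * (4 / c) ^+ 4) => [|L L1]; first by rewrite mulr_ge0 ?expR_ge0// exprn_ge0// divr_ge0// ltW.
have L0 : 0 < L by apply: lt_le_trans L1.
have key : avg m1 L (fun y => y k + L) <= - c * L + C'.
  pose bu y := mulv B (fun i => expR (y i + L)) k.
  have tbu : tame bu by apply: tame_sum => j _; exact: tameZ.
  have tc : tame (fun y => (Sig A m1 y + L / q) * bu y).
    by apply: tameM => //; apply: tameD => //; exact: tame_cst.
  have tr : tame (fun y => mulv B (res m1 L y) k) by exact: tame_mulvres.
  have ar : avg m1 L (fun y => mulv B (res m1 L y) k) = 0.
    rewrite avg_sum => [|i]; last exact: tameZ.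
    by rewrite big1// => i _; rewrite avgZ// avg_residual mulr0.
  have -> : (fun y : 'I_n -> R => y k + L) = fun y =>
      ((L + m1 k) + mulv B (res m1 L y) k) + ((Sig A m1 y + L / q) * bu y - L / q * bu y).
    apply/funext => y; have := crit m1 L y k; rewrite -/(bu y); lra.
  have tl : tame (fun y => L / q * bu y) by exact: tameZ.
  rewrite avgD; [|by apply: tameD => //; exact: tame_cst|exact: tameB].
  rewrite avgD//; last exact: tame_cst.
  rewrite avg_cst ar addr0 avgB// avgZ//.
  have d1 : avg m1 L (fun y => (Sig A m1 y + L / q) * bu y) <= K * Num.sqrt L.
    apply: (le_trans (ler_norm _)).
    apply: (@le_trans _ _ (avg m1 L (fun y =>
        entries B * bound2 A B wb m1 * Num.sqrt L * dev m1 L y))).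
      apply: avg_norm_le => //; first exact: tameZ.
      move=> y Ly; rewrite normrM.
      have S := slope_center_le BT BA B_pos wb_ge0 wb_sum wb_kkt q_gt0 L1 (usum Ly) (crit m1 L y).
      have bue : `|bu y| <= entries B.
        apply: (le_trans (coord_le_norm1 _ _)); apply: (le_trans (norm1_mulv_le B _)).
        rewrite (_ : norm1 _ = 1) ?mulr1// -(usum Ly); apply: eq_bigr => i _.
        by rewrite ger0_norm// expR_ge0.
      apply: (le_trans (ler_pM (normr_ge0 _) (normr_ge0 _) S bue)).
      by rewrite mulrC -/(dev m1 L y) !mulrA.
    rewrite avgZ// /K mulrAC; apply: ler_wpM2r; first exact: sqrtr_ge0.
    by apply: ler_wpM2l; [exact: mulr_ge0|exact: H2].
  have d2 : mulv B wb k - entries B * (n%:R * C1) / L <= avg m1 L bu.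
    rewrite avg_sum => [|j]; last exact: tameZ.
    have -> : \sum_i avg m1 L (fun y => B k i * expR (y i + L)) =
        mulv B (fun i => avg m1 L (fun y => expR (y i + L))) k.
      by apply: eq_bigr => i _; rewrite avgZ.
    rewrite lerBlDr -lerBlDl -mulvB; apply: (le_trans (ler_norm _)).
    apply: (le_trans (coord_le_norm1 (mulv B _) k)); apply: (le_trans (norm1_mulv_le B _)).
    rewrite -mulrA; apply: ler_wpM2l => //.
    apply: (@le_trans _ _ (\sum_(i < n) C1 / L)).
      by apply: ler_sum => i _; rewrite distrC; exact: H1.
    by rewrite sumr_const card_ord -mulr_natl le_eqVlt; apply/orP; left; apply/eqP; ring.
  have d3 := ler_wpM2l (divr_ge0 (ltW L0) (ltW q_gt0)) d2.
  have d4 : K * Num.sqrt L <= c * L + K ^+ 2 / (4 * c).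
    have := mulr_ge0 (ltW c0) (sqr_ge0 (Num.sqrt L - K / (2 * c))).
    have -> : c * (Num.sqrt L - K / (2 * c)) ^+ 2 =
        c * Num.sqrt L ^+ 2 - K * Num.sqrt L + K ^+ 2 / (4 * c) by field; rewrite gt_eqF.
    by rewrite sqr_sqrtr ?(ltW L0)//; lra.
  have E1 : L / q * (mulv B wb k - entries B * (n%:R * C1) / L) =
      L + 2 * c * L - K'.
    by rewrite /c /K'; field; rewrite !gt_eqF.
  move: d3; rewrite E1 /C'; lra.
have J := avg_expR_le m L (delta k); rewrite -/m1 in J.
have -> : avg m L (fun y => expR (y k + L)) = expR L * avg m L (fun y => expR (dotv (delta k) y)).
  rewrite -avgZ//; congr avg; apply/funext => y.
  by rewrite -expRD dotv_delta addrC.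
apply: (le_trans (ler_wpM2l (expR_ge0 L) J)); rewrite -expRD.
have -> : L + avg m1 L (fun y => dotv (delta k) y) = avg m1 L (fun y => y k + L).
  rewrite -[X in X + _](avg_cst m1 L) -avgD//; last exact: tame_cst.
  by congr avg; apply/funext => y; rewrite dotv_delta addrC.
apply: (@le_trans _ _ (expR (- c * L + C'))); first by rewrite ler_expR.
rewrite addrC expRD -mulrA; apply: ler_wpM2l; first exact: expR_ge0.
(* [expR (- c * L)] is the inverse fourth power of [expR (c * L / 4)], which is at least
   [c * L / 4]. *)
have h0 : 0 < c * L / 4 by rewrite divr_gt0 ?(mulr_gt0 c0 L0).
have h1 : c * L / 4 <= expR (c * L / 4) by apply: le_trans (expR_ge1Dx _); rewrite lerDr.
have -> : expR (- c * L) = (expR (c * L / 4) ^+ 4)^-1.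
  by rewrite -expRM_natl -expRN; congr expR; field.
have -> : (4 / c) ^+ 4 / L ^+ 4 = ((c * L / 4) ^+ 4)^-1 by field; rewrite !gt_eqF.
rewrite lef_pV2 ?posrE ?exprn_gt0 ?expR_gt0//.
by rewrite lerXn2r// nnegrE ?expR_ge0 ?(ltW h0).
Qed.

(** The square of [level_slope_le], where [P^2] averages to [O(L)] by [avg_sumsqr]. *)
Lemma avg_Sig_sqr m : exists2 C, 0 <= C & forall L, 1 <= L ->
  avg m L (fun y => Sig A m y ^+ 2) <= C * L ^+ 2.
Proof.
have [C C0 HC] := avg_sumsqr m.
pose K := entries B ^+ 2 * n%:R; pose a := 1 + n%:R + norm1 m.
have K0 : 0 <= K by rewrite mulr_ge0 ?sqr_ge0.
have nm0 := norm1_ge0 m.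
have q2 : 0 <= 2 / q ^+ 2 by rewrite divr_ge0 ?sqr_ge0.
have KC0 : 0 <= K * C by exact: mulr_ge0.
exists (2 / q ^+ 2 * (a ^+ 2 + K * C)) => [|L L1].
  by rewrite mulr_ge0// addr_ge0 ?sqr_ge0.
have L0 : 0 < L by apply: lt_le_trans L1.
apply: (@le_trans _ _ (avg m L (fun y => 2 / q ^+ 2 * ((L * a) ^+ 2 + K * sumsqr m L y)))).
  apply: ler_avg; first exact: tameX.
    by apply: tameZ; apply: tameD; [exact: tame_cst|exact: tameZ].
  move=> y Ly.
  have S := level_slope_le BT B_pos wb_kkt q_gt0 L1 (usum Ly) (crit m L y).
  have P0 := norm1_ge0 (mulv B (res m L y)); have PK := norm1res_le m L y.
  set P := norm1 (mulv B _) in S P0 PK.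
  have S2 : `|Sig A m y| <= (L * a + P) / q.
    apply: (le_trans S); apply: ler_wpM2r; first by rewrite invr_ge0 ltW.
    rewrite lerD2r /a mulrDr mulrDr mulr1; apply: lerD; first apply: lerD => //.
      by rewrite ler_peMl.
    by rewrite ler_peMl.
  rewrite -(real_normK (num_real _)).
  apply: (@le_trans _ _ (((L * a + P) / q) ^+ 2)).
    by rewrite lerXn2r// nnegrE ?normr_ge0//; apply: le_trans S2.
  apply: (@le_trans _ _ (2 / q ^+ 2 * ((L * a) ^+ 2 + P ^+ 2))).
    have -> : ((L * a + P) / q) ^+ 2 = 2 / q ^+ 2 * ((L * a + P) ^+ 2 / 2).
      by field; rewrite gt_eqF.
    apply: ler_wpM2l => //; have := sqr_ge0 (L * a - P); lra.
  by apply: ler_wpM2l => //; rewrite lerD2l.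
rewrite avgZ; last by apply: tameD; [exact: tame_cst|exact: tameZ].
rewrite avgD; [|exact: tame_cst|exact: tameZ].
rewrite avg_cst avgZ// -[leRHS]mulrA; apply: ler_wpM2l => //.
rewrite [leRHS]mulrDl; apply: lerD; first by rewrite exprMn mulrC.
rewrite -[leRHS]mulrA; apply: ler_wpM2l => //; apply: (le_trans (HC L L1)).
by apply: ler_wpM2l => //; rewrite expr2 ler_peMl// ltW.
Qed.

End Concentration.
End Averages.

(** * Logarithmic asymptotics *)

Section LseLipschitz.
Context {R : realType} {n : nat} (i0 : 'I_n).
Implicit Types x h : 'I_n -> R.

Lemma lse_shift_le x h : lse (fun i => x i + h i) <= lse x + norm1 h.
Proof.
rewrite -ler_expR expRD !(expR_lse i0) /sumexp big_distrl; apply: ler_sum => i _ /=.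
rewrite expRD ler_wpM2l ?expR_ge0// ler_expR.
by apply: (le_trans (ler_norm _)); exact: coord_le_norm1.
Qed.

Lemma lse_shift_dist x h : `|lse (fun i => x i + h i) - lse x| <= norm1 h.
Proof.
rewrite ler_norml; apply/andP; split; last by rewrite lerBlDl lse_shift_le.
have := lse_shift_le (fun i => x i + h i) (fun i => - h i).
rewrite (_ : (fun i => x i + h i + - h i) = x); last by apply/funext => i; rewrite addrK.
rewrite (_ : norm1 (fun i => - h i) = norm1 h); first by lra.
by apply: eq_bigr => i _; rewrite normrN.
Qed.

End LseLipschitz.

Section Asymptotics.
Context {R : realType} {n : nat} (i0 : 'I_n) {A B : 'M[R]_n} {t : R}
  (E : gaussian_expectation A t).
Hypothesis t_gt0 : 0 < t.
Hypothesis AT : A^T = A.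
Hypothesis BT : B^T = B.
Hypothesis AB : A *m B = 1%:M.
Hypothesis BA : B *m A = 1%:M.
Hypothesis S_gt0 : 0 < totsum A.
Variable wb : 'I_n -> R.
Let q := dotv wb (mulv B wb).
Hypothesis B_pos : forall v : 'I_n -> R, (exists i, v i != 0) -> 0 < dotv v (mulv B v).
Hypothesis wb_ge0 : forall i, 0 <= wb i.
Hypothesis wb_sum : \sum_i wb i = 1.
Hypothesis wb_eq : forall i, wb i != 0 -> mulv B wb i = q.
Hypothesis wb_gt : forall i, wb i = 0 -> q < mulv B wb i.
Hypothesis q_gt0 : 0 < q.
Implicit Types (m : 'I_n -> R).

Lemma lingrowth_lse_diff (h : 'I_n -> R) : lingrowth (fun y => lse (fun i => y i + h i) - lse y).
Proof.
apply: lingrowthB; last exact: lingrowth_lse.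
have H := lingrowth_lse_shift i0 h.
by under eq_fun do under eq_fun do rewrite addrC.
Qed.

Let S := totsum A.
Let kap := (2 * t * S)^-1.

(** Logarithm of the quotient of the weights for [m + h] and [m]: at fixed [v], passing from [m] to
    [m + h] lowers the value of [Sig] at the level point by [S * l]. *)
Let logratio (m h y : 'I_n -> R) : R :=
  let l := lse (fun i => y i + h i) - lse y in
  kap * (2 * S * (Sig A m y * l) - S ^+ 2 * l ^+ 2).

Lemma mass_translate m h L :
  mass E (fun i => m i + h i) L = cexp E m L (fun y => expR (logratio m h y)).
Proof.
rewrite /mass /cexp; congr (E _); apply/funext => v.
pose x i := m i + v i; set y := level m L v; set m' := fun i => m i + h i.
have lE : lse (fun i => y i + h i) - lse y = lse (fun i => m' i + v i) - lse x.
  have -> : (fun i => y i + h i) = fun i => (m' i + v i) + (- (lse x + L)).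
    by apply/funext => i; rewrite /y /level /m' -/x; ring.
  have -> : y = fun i => x i + (- (lse x + L)) by apply/funext => i; rewrite /y /level -/x /x; ring.
  rewrite !(lseD i0); ring.
rewrite mul1r /weight -expRD; congr expR.
rewrite /logratio lE !Sig_level -/m' -/x -/S -/kap; ring.
Qed.

(** The difference [l] is bounded by [norm1 h], so the exponent is at most affine in [|Sig|]. *)
Let tame_logratio m h : tame (logratio m h) /\ tame (fun y => expR (logratio m h y)).
Proof.
have ll := lingrowth_lse_diff h.
have tl := tame_lingrowth ll.
have tS : tame (Sig A m) := tame_lingrowth (lingrowth_Sig m).
have tL : tame (logratio m h).
  apply: tameZ; apply: tameB; first by apply: tameZ; exact: tameM.
  by apply: tameZ; exact: tameX.
split => //.
have mL : vmeasurable (logratio m h) by case: tL.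
pose N := norm1 h.
have k0 : 0 <= kap by rewrite invr_ge0 !mulr_ge0// ltW.
have lm : lingrowth (fun y => kap * (2 * S * N * `|Sig A m y| + S ^+ 2 * N ^+ 2)).
  apply/lingrowthZ/lingrowthD; last exact: lingrowth_cst.
  have [mS [k kk H]] := lingrowth_Sig (A := A) m.
  apply: lingrowthZ; split; first exact: measurableT_comp.
  by exists k => // v; rewrite normr_id.
apply: (tame_le _ (tame_expR lm)); first exact: measurableT_comp.
move=> y; rewrite [leLHS]ger0_norm ?expR_ge0// [leRHS]ger0_norm ?expR_ge0// ler_expR /logratio.
set l := lse _ - lse _; have lN : `|l| <= N by exact: (lse_shift_dist i0).
apply: ler_wpM2l => //.
have N0 : 0 <= N by exact: norm1_ge0.
apply: lerD.
  rewrite -[leRHS]mulrA; apply: ler_wpM2l; first by rewrite mulr_ge0// ltW.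
  apply: (le_trans (ler_norm _)); rewrite normrM mulrC.
  by apply: ler_wpM2r.
apply: (@le_trans _ _ 0); first by rewrite oppr_le0 mulr_ge0 ?sqr_ge0.
by rewrite mulr_ge0 ?sqr_ge0.
Qed.

Let usum L (y : 'I_n -> R) : \sum_i expR (y i) = expR (- L) -> \sum_i expR (y i + L) = 1.
Proof.
move=> Ly; under eq_bigr do rewrite expRD.
by rewrite -big_distrl /= Ly -expRD addNr expR0.
Qed.

Let off L (y : 'I_n -> R) := \sum_(i | wb i == 0) expR (y i + L).

Let tame_off L : tame (off L).
Proof.
apply: tame_sum => i _; apply: tame_expR; apply: lingrowthD.
  exact: lingrowth_coord.
exact: lingrowth_cst.
Qed.

Let off_ge0 L (y : 'I_n -> R) : 0 <= off L y.
Proof. by apply: sumr_ge0 => i _; exact: expR_ge0. Qed.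

Let off_le1 L (y : 'I_n -> R) : \sum_i expR (y i) = expR (- L) -> off L y <= 1.
Proof.
move=> /usum <-; rewrite [leRHS](bigID (fun i => wb i == 0)) /= lerDl.
by apply: sumr_ge0 => i _; exact: expR_ge0.
Qed.

(** As [h] vanishes on the support, [Z], the mean of [expR h] under [u], differs from [1] only
    through the mass [off]. The second factor [expR N] comes from [1 / Z], in the lower bound of
    [ln Z]. *)
Let lse_diff_le (h : 'I_n -> R) L (y : 'I_n -> R) :
  (forall i, wb i != 0 -> h i = 0) -> \sum_i expR (y i) = expR (- L) ->
  `|lse (fun i => y i + h i) - lse y| <= expR (2 * norm1 h) * off L y.
Proof.
move=> h0 Ly; set N := norm1 h; set U := off L y.
have N0 : 0 <= N by exact: norm1_ge0.
have U0 : 0 <= U by exact: off_ge0.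
pose Z := \sum_i expR (y i + L) * expR (h i).
have hN i : `|h i| <= N by exact: coord_le_norm1.
have ZE : lse (fun i => y i + h i) - lse y = ln Z.
  have -> : lse y = - L by rewrite /lse /sumexp Ly expRK.
  apply: expR_inj; rewrite expRD (expR_lse i0) opprK lnK ?posrE; last first.
    have -> : Z = sumexp (fun i => y i + L + h i) by apply: eq_bigr => i _; rewrite -expRD.
    exact: sumexp_gt0.
  rewrite /sumexp /Z big_distrl; apply: eq_bigr => i _ /=.
  by rewrite -!expRD; congr expR; ring.
have Zlow : expR (- N) <= Z.
  rewrite -[leLHS]mul1r -(usum Ly) big_distrl; apply: ler_sum => i _ /=.
  apply: ler_wpM2l; first exact: expR_ge0.
  by rewrite ler_expR; have := hN i; rewrite ler_norml => /andP[].
have Z0 : 0 < Z by apply: lt_le_trans Zlow; exact: expR_gt0.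
have zE : Z - 1 = \sum_(i | wb i == 0) expR (y i + L) * (expR (h i) - 1).
  rewrite -[X in Z - X](usum Ly) -sumrB (bigID (fun i => wb i == 0)) /= [X in _ + X]big1 ?addr0.
    by apply: eq_bigr => i _; rewrite mulrBr mulr1.
  by move=> i /h0 ->; rewrite expR0 mulr1 subrr.
have zle : `|Z - 1| <= expR N * U.
  rewrite zE mulrC; apply: (le_trans (ler_norm_sum _ _ _)); rewrite /U /off big_distrl.
  apply: ler_sum => i _ /=; rewrite normrM ger0_norm ?expR_ge0//.
  apply: ler_wpM2l; first exact: expR_ge0.
  have e1 : expR (h i) <= expR N.
    by rewrite ler_expR; exact: le_trans (ler_norm _) (hN i).
  have e2 : 1 <= expR N by rewrite -expR0 ler_expR.
  have e3 := expR_ge0 (h i).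
  by rewrite ler_norml; lra.
have lnle (z : R) : 0 < z -> ln z <= z - 1.
  by move=> z0; have := expR_ge1Dx (ln z); rewrite lnK ?posrE//; lra.
have eN : 1 <= expR N by rewrite -expR0 ler_expR.
have e2N : expR (2 * N) = expR N * expR N by rewrite -expRD; congr expR; ring.
have NU : 0 <= expR N * U by rewrite mulr_ge0// expR_ge0.
rewrite ZE e2N -mulrA ler_norml; apply/andP; split.
  have := lnle Z^-1; rewrite invr_gt0 => /(_ Z0); rewrite lnV ?posrE//.
  suff : Z^-1 - 1 <= expR N * (expR N * U) by lra.
  have -> : Z^-1 - 1 = Z^-1 * (1 - Z) by rewrite mulrBr mulr1 mulVf// gt_eqF.
  apply: (@le_trans _ _ (Z^-1 * (expR N * U))).
    apply: ler_wpM2l; first by rewrite invr_ge0 ltW.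
    by move: zle; rewrite ler_norml; lra.
  apply: ler_wpM2r => //.
  by rewrite -[leRHS]invrK -expRN lef_pV2 ?posrE ?expR_gt0.
apply: (le_trans (lnle _ Z0)); apply: (le_trans (ler_norm _)); apply: (le_trans zle).
by rewrite ler_peMl.
Qed.

Let avg_off m : exists2 C, 0 <= C &
  forall L, 1 <= L -> avg E m L (off L) <= C / L ^+ 4.
Proof.
have /choice[C HC] : forall i, exists C, 0 <= C /\ (wb i = 0 -> forall L, 1 <= L ->
    avg E m L (fun y => expR (y i + L)) <= C / L ^+ 4).
  move=> i; have [wi|wi] := eqVneq (wb i) 0; last first.
    by exists 0; split=> // w0; case/eqP: wi.
  have [C C0 HC] := avg_off_small i0 E t_gt0 AT BT AB BA S_gt0 B_pos wb_ge0
    wb_sum wb_eq wb_gt q_gt0 m wi.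
  by exists C; split.
exists (\sum_i C i) => [|L L1]; first by apply: sumr_ge0 => i _; case: (HC i).
pose F i (y : 'I_n -> R) := if wb i == 0 then expR (y i + L) else 0.
have tF i : tame (F i).
  rewrite /F; case: (wb i == 0); last exact: tame_cst.
  by apply: tame_expR; apply: lingrowthD; [exact: lingrowth_coord|exact: lingrowth_cst].
have -> : off L = fun y => \sum_i F i y.
  by apply/funext => y; rewrite /off big_mkcond.
rewrite (avg_sum i0)// big_distrl; apply: ler_sum => i _ /=.
rewrite /F; have [C0 H] := HC i; case: eqVneq => [wi|_]; first exact: H.
by rewrite (avg_cst i0)// divr_ge0// exprn_ge0// (le_trans _ L1).
Qed.

(** The ratio of the masses is the average of [expR (logratio)], to which Jensen's inequality
    applies; it remains to bound the average of [logratio], a quantity of size [|Sig| * off]. *)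
Lemma mass_translate_ge m h : (forall i, wb i != 0 -> h i = 0) ->
  exists2 C, 0 <= C & forall L, 1 <= L ->
    mass E m L * expR (- (C / L)) <= mass E (fun i => m i + h i) L.
Proof.
move=> h0; have [C1 C10 H1] := avg_off m.
have [C2 C20 H2] := avg_Sig_sqr i0 E t_gt0 AT BT BA S_gt0 B_pos wb_eq wb_gt q_gt0 m.
have k0 : 0 <= kap by rewrite invr_ge0 !mulr_ge0// ltW.
have S0 : 0 <= S by exact: ltW.
pose a := kap * (2 * S * expR (2 * norm1 h)).
pose b := kap * (S ^+ 2 * (norm1 h * expR (2 * norm1 h))).
have a0 : 0 <= a by rewrite !mulr_ge0 ?expR_ge0.
have b0 : 0 <= b by rewrite !mulr_ge0 ?expR_ge0 ?norm1_ge0 ?sqr_ge0.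
have ab : 0 <= a + b by exact: addr_ge0.
exists (a * C2 + (a + b) * C1) => [|L L1].
  exact: addr_ge0 (mulr_ge0 a0 C20) (mulr_ge0 ab C10).
have L0 : 0 < L by apply: lt_le_trans L1.
have [tG tE] := tame_logratio m h.
have massP := mass_gt0 i0 E t_gt0 S_gt0 m L.
have -> : mass E (fun i => m i + h i) L = mass E m L * avg E m L (fun y => expR (logratio m h y)).
  by rewrite mass_translate /avg mulrC divfK// gt_eqF.
apply: ler_wpM2l; first exact: ltW.
apply: le_trans (avg_jensen i0 E t_gt0 S_gt0 m L tG tE).
rewrite ler_expR.
have tSq : tame (fun y => Sig A m y ^+ 2) by apply/tameX/tame_lingrowth/lingrowth_Sig.
(* The power [L^3] balances the averages [O(L^2)] of the square of [Sig] and [O(L^-4)] of [off]: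
   both terms become [O(1/L)]. *)
pose bd y := a / L ^+ 3 * Sig A m y ^+ 2 + (a + b) * L ^+ 3 * off L y.
have tbd : tame bd by apply: tameD; exact: tameZ.
have : `|avg E m L (logratio m h)| <= avg E m L bd.
  apply: (avg_norm_le i0) => // y Ly.
  have l1 := lse_diff_le h0 Ly; have l2 := lse_shift_dist i0 y h.
  rewrite /logratio; set l := lse _ - lse _ in l1 l2 *; set Y := Sig A m y.
  have U0 := off_ge0 L y; have U1 := off_le1 Ly; set U := off L y in l1 U0 U1 *.
  have L3 : 0 < L ^+ 3 by exact: exprn_gt0.
  have YU : `|Y| * U <= Y ^+ 2 / L ^+ 3 + L ^+ 3 * U.
    have U2 : U ^+ 2 <= U by rewrite expr2 ler_piMl.
    have := ler_wpM2l (ltW L3) U2.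
    have : 0 <= (`|Y| - L ^+ 3 * U) ^+ 2 / L ^+ 3 by rewrite divr_ge0 ?sqr_ge0// ltW.
    have -> : (`|Y| - L ^+ 3 * U) ^+ 2 / L ^+ 3 =
        `|Y| ^+ 2 / L ^+ 3 - 2 * (`|Y| * U) + L ^+ 3 * U ^+ 2 by field; rewrite gt_eqF.
    rewrite (real_normK (num_real _)).
    have := mulr_ge0 (normr_ge0 Y) U0; have := mulr_ge0 (ltW L3) U0.
    have : 0 <= Y ^+ 2 / L ^+ 3 by rewrite divr_ge0 ?sqr_ge0// ltW.
    move: (Y ^+ 2 / _) (`|Y| * U) (L ^+ 3 * U) (L ^+ 3 * U ^+ 2) => x1 x2 x3 x4; lra.
  rewrite normrM (ger0_norm k0).
  apply: (@le_trans _ _ (a * (`|Y| * U) + b * U)).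
    have -> : a * (`|Y| * U) + b * U = kap * (2 * S * (`|Y| * (expR (2 * norm1 h) * U)) +
        S ^+ 2 * (norm1 h * (expR (2 * norm1 h) * U))) by rewrite /a /b; ring.
    apply: ler_wpM2l => //; apply: (le_trans (ler_normB _ _)); apply: lerD.
      rewrite normrM (ger0_norm (mulr_ge0 _ _))//; apply: ler_wpM2l; first exact: mulr_ge0.
      by rewrite normrM; apply: ler_wpM2l.
    rewrite normrM (ger0_norm (sqr_ge0 _)); apply: ler_wpM2l; first exact: sqr_ge0.
    by rewrite normrX expr2; exact: ler_pM.
  have L31 : 1 <= L ^+ 3 by exact: exprn_ege1.
  have bU : b * U <= b * L ^+ 3 * U.
    by apply: ler_wpM2r => //; rewrite ler_peMr.
  have := ler_wpM2l a0 YU; rewrite /bd -/U -/Y.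
  have -> : a / L ^+ 3 * Y ^+ 2 + (a + b) * L ^+ 3 * U =
    a * (Y ^+ 2 / L ^+ 3 + L ^+ 3 * U) + b * L ^+ 3 * U by ring.
  by move=> aYU; apply: lerD.
rewrite ler_norml => /andP[+ _]; apply: le_trans; rewrite lerN2.
rewrite (avgD i0)//; [|exact: tameZ|exact: tameZ].
rewrite !(avgZ i0)// [leRHS]mulrDl; apply: lerD.
  apply: (le_trans (ler_wpM2l _ (H2 L L1))); first by rewrite divr_ge0// exprn_ge0// ltW.
  by rewrite le_eqVlt; apply/orP; left; apply/eqP; field; rewrite gt_eqF.
apply: (le_trans (ler_wpM2l _ (H1 L L1))); first by rewrite mulr_ge0// exprn_ge0// ltW.
by rewrite le_eqVlt; apply/orP; left; apply/eqP; field; rewrite gt_eqF.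
Qed.

End Asymptotics.

Section LogAsymptotics.
Context {R : realType} {n : nat} (i0 : 'I_n) {A B : 'M[R]_n} {t : R}
  (E : gaussian_expectation A t).
Hypothesis t_gt0 : 0 < t.
Hypothesis AT : A^T = A.
Hypothesis BT : B^T = B.
Hypothesis AB : A *m B = 1%:M.
Hypothesis BA : B *m A = 1%:M.
Hypothesis S_gt0 : 0 < totsum A.
Variable wb : 'I_n -> R.
Let q := dotv wb (mulv B wb).
Hypothesis B_pos : forall v : 'I_n -> R, (exists i, v i != 0) -> 0 < dotv v (mulv B v).
Hypothesis wb_ge0 : forall i, 0 <= wb i.
Hypothesis wb_sum : \sum_i wb i = 1.
Hypothesis wb_eq : forall i, wb i != 0 -> mulv B wb i = q.
Hypothesis wb_gt : forall i, wb i = 0 -> q < mulv B wb i.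
Hypothesis q_gt0 : 0 < q.
Implicit Types (m : 'I_n -> R).

Lemma avg_dotv m (c : 'I_n -> R) : (forall i, wb i = 0 -> c i = 0) ->
  exists2 C, 0 <= C & exists2 L0, 1 <= L0 & forall L, L0 <= L ->
    `|avg E m L (dotv c) - \sum_i c i * (ln (wb i) - L)| <= C / L.
Proof.
move=> c0.
have /choice[C /all_and2[C0 /choice[l0 /all_and2[l01 HC]]]] : forall i, exists C, 0 <= C /\
    exists L0, 1 <= L0 /\ (wb i != 0 -> forall L, L0 <= L ->
    `|avg E m L (fun y => y i + L) - ln (wb i)| <= C / L).
  move=> i; have [wi|wi] := boolP (wb i == 0); first by exists 0; split=> //; exists 1.
  have [C C0 [L0 L01 HC]] := avg_log i0 E t_gt0 AT BT AB BA S_gt0 B_pos wb_ge0 wb_sum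
    wb_eq wb_gt q_gt0 m wi.
  by exists C; split=> //; exists L0.
have l0s i : l0 i <= \sum_j l0 j.
  rewrite (bigD1 i)//= lerDl; apply: sumr_ge0 => j _; exact: le_trans (l01 j).
exists (\sum_i `|c i| * C i); first by apply: sumr_ge0 => i _; exact: mulr_ge0.
exists (\sum_i l0 i) => [|L Ll0]; first exact: le_trans (l01 i0) (l0s i0).
have tc i : tame (fun y : 'I_n -> R => y i) by apply/tame_lingrowth/lingrowth_coord.
have -> : avg E m L (dotv c) = \sum_i c i * avg E m L (fun y => y i).
  rewrite (avg_sum i0 E t_gt0 S_gt0 m L (F := fun i y => c i * y i)); last first.
    by move=> i; exact: tameZ.
  by apply: eq_bigr => i _; rewrite (avgZ i0).
rewrite -sumrB big_distrl; apply: (le_trans (ler_norm_sum _ _ _)); apply: ler_sum => i _ /=.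
rewrite -mulrBr normrM -mulrA; have [/c0 ->|wi] := eqVneq (wb i) 0; first by rewrite normr0 !mul0r.
apply: ler_wpM2l => //.
have := HC i wi L (le_trans (l0s i) Ll0).
rewrite (avgD i0)//; last exact: tame_cst.
by rewrite (avg_cst i0)// opprB addrA addrAC.
Qed.

(** The two sides come from [mass_translate_ge] used from [m] to [m + h] and back. *)
Lemma ln_mass_translate m h : (forall i, wb i != 0 -> h i = 0) ->
  exists2 C, 0 <= C & forall L, 1 <= L ->
    `|ln (mass E (fun i => m i + h i) L / mass E m L)| <= C / L.
Proof.
move=> h0; pose m' i := m i + h i.
have hN0 i : wb i != 0 -> - h i = 0 by move=> /h0 ->; rewrite oppr0.
have massP k L := mass_gt0 i0 E t_gt0 S_gt0 k L.
have [C C0 HC] := mass_translate_ge i0 E t_gt0 AT BT AB BA S_gt0 B_pos wb_ge0 wb_sum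
  wb_eq wb_gt q_gt0 m h0.
have [D D0 HD] := mass_translate_ge i0 E t_gt0 AT BT AB BA S_gt0 B_pos wb_ge0 wb_sum
  wb_eq wb_gt q_gt0 m' hN0.
have mE : (fun i => m' i + - h i) = m by apply/funext => i; rewrite /m' addrK.
exists (C + D) => [|L L1]; first exact: addr_ge0.
have L0 : 0 < L by apply: lt_le_trans L1.
have := HD L L1; have := HC L L1; rewrite mE -/m'.
have := massP m L; have := massP m' L; move: (mass E m' L) (mass E m L) => a b a0 b0 H1 H2.
have CL : 0 <= C / L by rewrite divr_ge0// ltW.
have DL : 0 <= D / L by rewrite divr_ge0// ltW.
have ab0 : 0 < a / b by exact: divr_gt0.
have K1 : - (C / L) <= ln (a / b).
  by rewrite -ler_expR lnK ?posrE// ler_pdivlMr// mulrC.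
have K2 : ln (a / b) <= D / L.
  rewrite -ler_expR lnK ?posrE// ler_pdivrMr// -ler_pdivrMl ?expR_gt0//.
  by rewrite -expRN mulrC.
by rewrite mulrDl ler_norml; lra.
Qed.

(* [expR (y j) = expR (dotv c y) * expR (dotv alpha y)]: the second factor is an
   exponential tilt, which moves [m] off the support of [wb] only. *)
Theorem ln_avg_expR m (j : 'I_n) (c : 'I_n -> R) :
  let alpha k := (k == j)%:R - c k in
  (forall i, wb i = 0 -> c i = 0) -> (forall i, wb i != 0 -> mulv B alpha i = 0) ->
  exists2 C, 0 <= C & exists2 L0, 1 <= L0 & forall L, L0 <= L ->
    `|ln (avg E m L (fun y => expR (y j))) -
      (dotv alpha m + t / 2 * dotv alpha (mulv B alpha) + \sum_i c i * (ln (wb i) - L))| <= C / L.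
Proof.
move=> alpha c0 a0.
(* [m'] is the mean after the tilt by [alpha], [m2] after a further tilt by [c]. The logarithm of
   the average of [exp (c.y)] at [m'] lies between the averages of [c.y] at [m'] and at [m2], which
   have the same expansion. *)
pose h i := t * mulv B alpha i; pose m' i := m i + h i; pose m2 i := m' i + t * mulv B c i.
have h0 i : wb i != 0 -> h i = 0 by move=> /a0 E0; rewrite /h E0 mulr0.
have [C1 C10 H1] := ln_mass_translate m h0.
have [C2 C20 [L2 L21 H2]] := avg_dotv m' c0.
have [C3 C30 [L3 L31 H3]] := avg_dotv m2 c0.
exists (C1 + (C2 + C3)); first by rewrite !addr_ge0.
have L30 : 0 <= L3 by exact: le_trans L31.
have L20 : 0 <= L2 by exact: le_trans L21.
exists (L2 + L3) => [|L LL]; first by rewrite (le_trans L21)// lerDl.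
have L2L : L2 <= L by apply: le_trans LL; rewrite lerDl.
have L3L : L3 <= L by apply: le_trans LL; rewrite lerDr.
have L1 : 1 <= L by exact: le_trans L2L.
have L0 : 0 < L by exact: lt_le_trans L1.
have tH : tame (fun y => expR (dotv c y)).
  by apply: tame_expR; apply: (lingrowth_dotv _ (F := fun i y => y i)) => i; exact: lingrowth_coord.
have massP k := mass_gt0 i0 E t_gt0 S_gt0 k L.
have avgE : avg E m L (fun y => expR (y j)) =
    expR (dotv alpha m + t / 2 * dotv alpha (mulv B alpha)) *
    (mass E m' L / mass E m L * avg E m' L (fun y => expR (dotv c y))).
  have yE (y : 'I_n -> R) : expR (y j) = expR (dotv c y) * expR (dotv alpha y).
    rewrite -expRD; congr expR; rewrite /dotv -big_split /= (bigD1 j)//= big1 => [|k kj].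
      by rewrite /alpha eqxx mulr1n; ring.
    by rewrite /alpha (negbTE kj) mulr0n; ring.
  rewrite /avg (eq_cexp i0 E m (L := L) (fun y _ => yE y)).
  rewrite (cexp_tilt i0 E t_gt0 AT BT AB BA S_gt0)// -/m'.
  have := massP m; have := massP m'.
  move: (mass E m' L) (mass E m L) (cexp _ _ _ _) => a b z a_gt0 b_gt0.
  by field; rewrite !gt_eqF.
have av0 := avg_expR_gt0 i0 E t_gt0 S_gt0 m' L c.
rewrite avgE lnM ?posrE ?expR_gt0//; last by rewrite mulr_gt0// divr_gt0.
rewrite expRK lnM ?posrE//; last by rewrite divr_gt0.
have K1 := H1 L L1; have K2 := H2 L L2L; have K3 := H3 L L3L.
have J1 : avg E m' L (dotv c) <= ln (avg E m' L (fun y => expR (dotv c y))).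
  by rewrite -ler_expR lnK ?posrE//; exact: (avg_expR_ge i0 E t_gt0 S_gt0).
have J2 : ln (avg E m' L (fun y => expR (dotv c y))) <= avg E m2 L (dotv c).
  by rewrite -ler_expR lnK ?posrE//; exact: (avg_expR_le i0 E t_gt0 AT BT AB BA S_gt0).
rewrite -/m' in K1.
move: K1 K2 K3 J1 J2.
move: (ln (mass E m' L / _)) (ln (avg _ _ _ _)) (avg _ _ _ _) (avg _ _ _ _)
  (\sum_i _) (dotv _ _) (t / 2 * _).
move=> x1 x2 x3 x4 x5 x6 x7 K1 K2 K3 J1 J2.
rewrite !mulrDl; move: (C1 / L) (C2 / L) (C3 / L)
  (divr_ge0 C20 (ltW L0)) (divr_ge0 C30 (ltW L0)) K1 K2 K3.
move=> d1 d2 d3 d20 d30; rewrite !ler_norml => /andP[? ?] /andP[? ?] /andP[? ?].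
by apply/andP; split; lra.
Qed.

End LogAsymptotics.

(** * The continuous version of the conditional expectation *)

Section Disintegration.
Context {R : realType} d (T : measurableType d) (P : probability T R) n (i0 : 'I_n)
  (N : 'I_n -> T -> R) (A : 'M[R]_n) (t : R).
Hypothesis t_gt0 : 0 < t.
Hypothesis AT : A^T = A.
Hypothesis NG : gaussian_shift P N A t.
Hypothesis S_gt0 : 0 < totsum A.
Let S := totsum A.
Let k := (2 * t * S)^-1.
Let sigma := Num.sqrt (t / S).
Let D (v : 'I_n -> R) := dotv (rowsum A) v.
Let leb := @lebesgue_measure R.

Let mN : forall i, measurable_fun [set: T] (N i) := proj1 NG.

Let sigma_neq0 : sigma != 0.
Proof. by rewrite gt_eqF// sqrtr_gt0 divr_gt0. Qed.

Let sigma2 : sigma ^+ 2 = t / S.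
Proof. by rewrite sqr_sqrtr// divr_ge0// ltW. Qed.

Let mD : vmeasurable D.
Proof. by apply: measurable_sum => j; apply: measurable_funM => //; exact: measurable_tnth. Qed.

Let mG : vmeasurable (fun v => expR (- k * D v ^+ 2)).
Proof. by apply: measurableT_comp => //; apply: measurable_funM => //; exact: measurable_funX. Qed.

(** Completing the square in [s]: translating by [s (1,...,1)] turns the exponent into that of a
    normal density in [s], of mean [D / S] and variance [t / S], whose integral does not depend on
    the sample point. *)
Let gauss_translate (F : ('I_n -> R) -> R) s : vmeasurable F -> (forall v, 0 <= F v) ->
  (\int[P]_w (F (fun i => N i w + s) * expR (- k * (D (N ^~ w) + s * S) ^+ 2))%:E =
   \int[P]_w (F (N ^~ w) * normal_fun (D (N ^~ w) / S) sigma s)%:E)%E.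
Proof.
move=> mF F0; have [_ /(_ (fun=> s) (fun v => F v * expR (- k * D v ^+ 2)))] := NG.
have one u : dotv (fun=> s) (mulv A u) = s * D u.
  rewrite (_ : (fun=> s) = fun i => s * 1); last by apply/funext => i; rewrite mulr1.
  by rewrite dotvC (dotvZ _ s (fun=> 1)) (dotvC _ (fun=> 1)) (dotv_mulv _ _ AT).
have Ds : D (fun=> s) = s * S.
  rewrite /D (_ : (fun=> s) = fun i => s * 1); last by apply/funext => i; rewrite mulr1.
  by rewrite (dotvZ _ s (fun=> 1)) dotvC.
have mFG : vmeasurable (fun v => F v * expR (- k * D v ^+ 2)) by exact: measurable_funM.
move=> /(_ mFG (fun v => mulr_ge0 (F0 v) (expR_ge0 _))) E.
transitivity (\int[P]_w (F (fun i => N i w + s) *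
    expR (- k * D (fun i => N i w + s) ^+ 2))%:E)%E.
  apply: eq_integral => w _; congr (_ * expR (_ * _ ^+ 2))%:E.
  by rewrite /D dotvD -/(D _) -/(D _) Ds.
rewrite E; apply: eq_integral => w _; rewrite -mulrA -expRD; congr (_ * expR _)%:E.
rewrite !one Ds sigma2 /k; field; rewrite !gt_eqF//.
Qed.

Let integral_normal_fun a : (\int[leb]_s (normal_fun a sigma s)%:E = (normal_peak sigma)^-1%:E)%E.
Proof.
have p0 : 0 < normal_peak sigma := normal_peak_gt0 sigma_neq0.
have H := integral_normal_pdf a sigma.
have pI : ((normal_peak sigma)%:E * (\int[leb]_s (normal_fun a sigma s)%:E) = 1)%E.
  rewrite -[RHS]H -ge0_integralZl//; last first.
  - by rewrite lee_fin ltW.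
  - by move=> x _; rewrite lee_fin expR_ge0.
  - by apply/measurable_EFinP; exact: measurable_normal_fun.
  by apply: eq_integral => s _; rewrite normal_pdfE.
by rewrite -[LHS]mul1e
  -[X in (X * _)%E](_ : (((normal_peak sigma)^-1)%:E * (normal_peak sigma)%:E)%E = _)
  -?muleA ?pI ?mule1// -EFinM mulVf// gt_eqF.
Qed.

Let mN2 i : measurable_fun [set: measurableTypeR R * T] (fun p => N i p.2).
Proof. exact: measurableT_comp. Qed.

(** For fixed [w] the level point runs along the line [m + N + R.1] as [z] varies. Tonelli's theorem
    allows the substitution [s = z - ell w], and [gauss_translate] lets [s] be integrated out. *)
Lemma disintegration m (H : ('I_n -> R) -> R) : vmeasurable H -> (forall y, 0 <= H y) ->
  (\int[leb]_z \int[P]_w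
      (H (level m (- z) (N ^~ w)) * weight A t m (level m (- z) (N ^~ w)))%:E =
   ((normal_peak sigma)^-1)%:E * \int[P]_w (H (fun i => m i + N i w))%:E)%E.
Proof.
move=> mH H0; pose F v := H (fun i => m i + v i).
have mF : vmeasurable F.
  apply: vmeasurable_subst => // i; apply: measurable_funD => //; exact: measurable_tnth.
have F0 v : 0 <= F v by exact: H0.
pose ell w := lse (fun i => m i + N i w).
pose J (p : measurableTypeR R * T) : \bar R := (F (fun i => N i p.2 + p.1) *
  expR (- k * (D (N ^~ p.2) + p.1 * S) ^+ 2))%:E.
have J0 p : (0 <= J p)%E by rewrite lee_fin mulr_ge0 ?expR_ge0.
have mell : measurable_fun [set: T] ell.
  have [+ _] := lingrowth_lse_shift i0 m.
  by move=> ml; exact: (vmeasurable_comp ml mN).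
have mD2 : measurable_fun [set: measurableTypeR R * T] (fun p => D (N ^~ p.2)).
  exact: (vmeasurable_comp mD mN2).
have mJ : measurable_fun [set: measurableTypeR R * T] J.
  apply/measurable_EFinP; apply: measurable_funM.
    apply: (vmeasurable_comp (N := fun i (p : measurableTypeR R * T) => N i p.2 + p.1) mF) => i.
    exact: measurable_funD.
  apply: measurableT_comp => //; apply: measurable_funM => //; apply: measurable_funX.
  by apply: measurable_funD => //; exact: measurable_funM.
have levelE z w : level m (- z) (N ^~ w) = fun i => m i + (N i w + (z - ell w)).
  by apply/funext => i; rewrite /level /ell; ring.
have JE z w : (H (level m (- z) (N ^~ w)) * weight A t m (level m (- z) (N ^~ w)))%:E =
    J (z - ell w, w).
  rewrite levelE /J/=; congr (_ * expR (_ * _ ^+ 2))%:E.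
  rewrite /Sig (_ : (fun i => _) = fun i => N i w + (z - ell w) * 1); last first.
    by apply/funext => i; ring.
  by rewrite dotvD (dotvZ _ _ (fun=> 1)) (dotvC _ (fun=> 1)).
under eq_integral do under eq_integral do rewrite JE.
pose J' (p : measurableTypeR R * T) := J (p.1 - ell p.2, p.2).
have mJ' : measurable_fun [set: measurableTypeR R * T] J'.
  apply: (measurableT_comp mJ); apply: measurable_fun_pair => //.
  by apply: measurable_funB => //; exact: measurableT_comp.
rewrite (fubini_tonelli (m1 := lebesgue_measure) (m2 := P) J' mJ'); last by move=> p; exact: J0.
transitivity (\int[P]_w \int[leb]_s J (s, w))%E.
  apply: eq_integral => w _.
  rewrite -(ge0_integral_lebesgue_shift (ell w) (F := fun z => J' (z, w))); last 2 first.
  - exact: (measurableT_comp mJ').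
  - by move=> z; exact: J0.
  by apply: eq_integral => s _; rewrite /J'/= addrK.
rewrite -(fubini_tonelli (m1 := lebesgue_measure) (m2 := P) J mJ)//.
pose G (p : measurableTypeR R * T) : \bar R :=
  (F (N ^~ p.2) * normal_fun (D (N ^~ p.2) / S) sigma p.1)%:E.
have mG2 : measurable_fun [set: measurableTypeR R * T] G.
  apply/measurable_EFinP; apply: measurable_funM; first exact: (vmeasurable_comp mF mN2).
  apply: measurableT_comp => //; apply: measurable_funM => //.
  apply: measurableT_comp => //; apply: measurable_funX; apply: measurable_funB => //.
  exact: measurable_funM.
have G0 p : (0 <= G p)%E by rewrite lee_fin mulr_ge0 ?expR_ge0.
transitivity (\int[leb]_s \int[P]_w G (s, w))%E.
  by apply: eq_integral => s _; exact: gauss_translate.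
rewrite (fubini_tonelli (m1 := lebesgue_measure) (m2 := P) G mG2)//.
rewrite -ge0_integralZl//; last first.
- by rewrite lee_fin invr_ge0 ltW// normal_peak_gt0.
- by move=> w _; rewrite lee_fin.
- by apply/measurable_EFinP; exact: (vmeasurable_comp mF mN).
apply: eq_integral => w _; rewrite /G/=.
under eq_integral do rewrite EFinM.
rewrite ge0_integralZl//; last first.
- by rewrite lee_fin.
- by move=> s _; rewrite lee_fin expR_ge0.
- by apply/measurable_EFinP; exact: measurable_normal_fun.
by rewrite integral_normal_fun muleC.
Qed.

End Disintegration.

(** * Continuity in the level *)

Lemma locally_lipschitz_continuous (R : realType) (f : R -> R) :
  (forall x, exists K, forall y, `|y - x| <= 1 -> `|f y - f x| <= K * `|y - x|) ->
  continuous f.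
Proof.
move=> fL x; have [K HK] := fL x; apply/cvgrPdist_le => e e0.
have K0 : 0 < `|K| + 1 by rewrite ltr_wpDl.
near=> y.
have yx : `|x - y| <= Num.min 1 (e / (`|K| + 1)).
  near: y; apply: (@cvgr_dist_le _ _ _ (nbhs x) _ id x) => //.
  by rewrite lt_min ltr01 divr_gt0.
move: yx; rewrite le_min ler_pdivlMr// => /andP[y1 ye].
rewrite distrC; apply: (le_trans (HK y _)); first by rewrite distrC.
rewrite distrC (le_trans _ ye)// mulrC ler_wpM2l//.
by rewrite (le_trans (ler_norm _))// lerDl.
Unshelve. all: by end_near. Qed.

Lemma expRN_dist_le (R : realType) (x y : R) : 0 <= x -> 0 <= y ->
  `|expR (- x) - expR (- y)| <= `|x - y|.
Proof.
wlog xy : x y / x <= y => [H x0 y0|x0 _].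
  by have [xy|/ltW yx] := leP x y; [exact: H|rewrite distrC (distrC x); exact: H].
rewrite ger0_norm ?subr_ge0 ?ler_expR ?lerN2// ler0_norm ?subr_le0// opprB.
have -> : expR (- x) - expR (- y) = expR (- x) * (1 - expR (x - y)).
  by rewrite mulrBr mulr1 -expRD; congr (_ - expR _); ring.
apply: (@le_trans _ _ (1 - expR (x - y))).
  rewrite ler_piMl ?subr_ge0 -1?expR0 ?ler_expR ?oppr_le0//.
  by rewrite subr_le0.
by have := expR_ge1Dx (x - y); lra.
Qed.

Section Continuity.
Context {R : realType} {n : nat} (i0 : 'I_n) {A : 'M[R]_n} {t : R}
  (E : gaussian_expectation A t).
Hypothesis t_gt0 : 0 < t.
Hypothesis S_gt0 : 0 < totsum A.
Let S := totsum A.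
Let k := (2 * t * S)^-1.

Lemma gexp_dist_le F G K : tame F -> tame G -> tame K ->
  (forall v, `|F v - G v| <= K v) -> `|E F - E G| <= E K.
Proof.
move=> tF tG tK H.
have H1 : E F <= E (fun v => G v + K v).
  apply: ler_gexp => // [|v]; first exact: tameD.
  by have := H v; rewrite ler_norml; lra.
have H2 : E G <= E (fun v => F v + K v).
  apply: ler_gexp => // [|v]; first exact: tameD.
  by have := H v; rewrite ler_norml; lra.
by move: H1 H2; rewrite !gexpD// ler_norml; lra.
Qed.

Let tame_gweight F m L : tame F -> tame (fun v => F v * weight A t m (level m L v)).
Proof.
move=> tF; apply: tameM => //; apply: (tame_level i0); exact: (tame_weight t_gt0 S_gt0).
Qed.

(** [L] enters only through [weight], the exponential of a non-positive number. As [Sig] at the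
    level point is affine in [L], [expRN_dist_le] gives a local Lipschitz bound whose constant is a
    tame function of [v]. *)
Lemma gexp_weight_continuous F m : tame F ->
  continuous (fun L => E (fun v => F v * weight A t m (level m L v))).
Proof.
move=> tF; apply: locally_lipschitz_continuous => L.
have k0 : 0 < k by rewrite invr_gt0 !mulr_gt0.
pose G v := `|F v| * (k * S * (2 * `|Sig A m (level m L v)| + S)).
have tG : tame G.
  apply: tameM; first exact: tame_norm.
  apply: tameZ; apply: tameD; last exact: tame_cst.
  apply/tameZ/tame_norm/(tame_level i0)/tame_lingrowth; exact: lingrowth_Sig.
exists (E G) => M ML; rewrite mulrC -gexpZ//.
apply: gexp_dist_le; [exact: tame_gweight|exact: tame_gweight|exact: tameZ|].
move=> v; rewrite -mulrBr normrM /G mulrCA; apply: ler_wpM2l => //.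
rewrite /weight -/k -/S !mulNr; apply: (le_trans (expRN_dist_le _ _)).
- by rewrite mulr_ge0 ?sqr_ge0// ltW.
- by rewrite mulr_ge0 ?sqr_ge0// ltW.
set a := Sig A m (level m L v); set b := Sig A m (level m M v).
have ba : b = a - (M - L) * S by rewrite /a /b !Sig_level -/S; ring.
rewrite -mulrBr normrM (gtr0_norm k0).
have -> : b ^+ 2 - a ^+ 2 = - ((M - L) * S * (2 * a - (M - L) * S)) by rewrite ba; ring.
rewrite normrN !normrM (gtr0_norm S_gt0).
rewrite [leRHS](_ : _ = k * (`|M - L| * S * (2 * `|a| + S))); last by rewrite /S; ring.
apply: ler_wpM2l; first exact: ltW.
apply: ler_wpM2l; first by rewrite mulr_ge0// ltW.
apply: (le_trans (ler_normB _ _)); rewrite !normrM (gtr0_norm S_gt0) ger0_norm// lerD2l.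
by apply: ler_piMl => //; exact: ltW.
Qed.

Lemma mass_continuous m : continuous (mass E m).
Proof. exact: (gexp_weight_continuous (m := m) (tame_cst 1)). Qed.

(** The level point depends on [L] by a translation along [(1,...,1)]; once [expR (- L)] is factored
    out, [L] remains in [weight] only. *)
Lemma cexp_expR m i L : cexp E m L (fun y => expR (y i)) =
  expR (- L) *
  E (fun v => expR (m i + v i - lse (fun j => m j + v j)) * weight A t m (level m L v)).
Proof.
have lT : tame (fun v : 'I_n -> R => expR (m i + v i - lse (fun j => m j + v j))).
  apply: tame_expR; apply: lingrowthB; last exact: (lingrowth_lse_shift i0).
  by apply: lingrowthD; [exact: lingrowth_cst|exact: lingrowth_coord].
rewrite -gexpZ; last exact: tame_gweight.
by congr (E _); apply/funext => v; rewrite {1}/level expRD; ring.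
Qed.

Lemma cexp_expR_continuous m i : continuous (fun L => cexp E m L (fun y => expR (y i))).
Proof.
under eq_fun do rewrite cexp_expR.
move=> L; apply: cvgM.
  by apply: continuous_comp; [exact: continuousN|exact: continuous_expR].
apply: gexp_weight_continuous.
apply: tame_expR; apply: lingrowthB; last exact: (lingrowth_lse_shift i0).
by apply: lingrowthD; [exact: lingrowth_cst|exact: lingrowth_coord].
Qed.

End Continuity.

(** If two versions differ at [x], continuity keeps them apart on an interval around [x]; [X] falls
    there with positive probability, and the integrals over that event differ. *)
Lemma cond_exp_version_unique {R : realType} d (T : measurableType d) (P : probability T R)
    (Y X : T -> R) (g1 g2 : R -> R) :
  measurable_fun [set: T] X ->
  (forall a b : R, 0 < a -> a < b -> (0 < P (X @^-1` `]a, b[))%E) ->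
  cond_exp_version P Y X g1 -> {within [set x | 0 < x], continuous g1} ->
  cond_exp_version P Y X g2 -> {within [set x | 0 < x], continuous g2} ->
  forall x, 0 < x -> g1 x = g2 x.
Proof.
move=> mX PX.
suff le g g' : cond_exp_version P Y X g -> {within [set x | 0 < x], continuous g} ->
    cond_exp_version P Y X g' -> {within [set x | 0 < x], continuous g'} ->
    forall x, 0 < x -> g' x <= g x.
  by move=> v1 c1 v2 c2 x x0; apply/eqP; rewrite eq_le !(le _ _ v1 c1 v2 c2, le _ _ v2 c2 v1 c1).
move=> [mg ig Hg] cg [mg' ig' Hg'] cg' x x0; rewrite leNgt; apply/negP => gg.
(* With a third of the gap, both functions may vary by [e] and still stay [e] apart. *)
pose e := (g' x - g x) / 3.
have e0 : 0 < e by rewrite divr_gt0// subr_gt0.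
have cx (h : R -> R) : {within [set x : R | 0 < x], continuous h} -> {for x, continuous h}.
  by rewrite continuous_open_subspace; [move=> H; apply: H; rewrite inE|exact: open_gt].
have : \forall y \near x, [/\ 0 < y, g y <= g x + e & g x + 2 * e <= g' y].
  near=> y; split.
  - by near: y; exact: lt_nbhsr.
  - have : `|g x - g y| <= e by near: y; apply: cvgr_dist_le => //; exact: cx.
    by rewrite ler_norml; lra.
  - have : `|g' x - g' y| <= e by near: y; apply: cvgr_dist_le => //; exact: cx.
    by rewrite ler_norml /e; lra.
move=> /nbhs_ballP[r /= r0 xr].
pose a := Num.max (x / 2) (x - r); pose b := x + r.
have a0 : 0 < a by rewrite lt_max divr_gt0.
have ab : a < b by rewrite gt_max /b; apply/andP; split; lra.
have inr y : y \in `]a, b[ -> [/\ 0 < y, g y <= g x + e & g x + 2 * e <= g' y].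
  rewrite in_itv/= gt_max /b => /andP[/andP[_ y1] y2]; apply: xr.
  by rewrite /ball/= ltr_norml; lra.
have mI : measurable (`]a, b[ : set R) by [].
have mA : measurable (X @^-1` `]a, b[) by rewrite -[X in measurable X]setTI; exact: mX.
pose Q := P (X @^-1` `]a, b[).
have iA (h : R -> R) : P.-integrable setT (EFin \o (h \o X)) ->
    P.-integrable (X @^-1` `]a, b[) (EFin \o (h \o X)).
  by move=> ih; apply: (integrableS _ _ _ ih).
have ic (c : R) : P.-integrable (X @^-1` `]a, b[) (EFin \o cst c).
  by apply: finite_measure_integrable_cst.
have H1 : (\int[P]_(w in X @^-1` `]a, b[) (g (X w))%:E <= (g x + e)%:E * Q)%E.
  rewrite -integral_cst//; apply: le_integral => //; [exact: iA|exact: ic|].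
  by move=> w; rewrite inE => Xw; have [_ + _] := inr _ Xw; rewrite lee_fin.
have H2 : ((g x + 2 * e)%:E * Q <= \int[P]_(w in X @^-1` `]a, b[) (g' (X w))%:E)%E.
  rewrite -integral_cst//; apply: le_integral => //; [exact: ic|exact: iA|].
  by move=> w; rewrite inE => Xw; have [_ _ +] := inr _ Xw; rewrite lee_fin.
have := le_trans H2 (le_trans _ H1); rewrite -Hg'// -Hg// => /(_ (lexx _)).
have Qf : Q \is a fin_num by exact: fin_num_measure.
rewrite -(fineK Qf) -!EFinM lee_fin.
have : 0 < fine Q by rewrite fine_gt0// PX//= ltey_eq Qf.
move=> Q0; rewrite ler_pM2r//; lra.
Unshelve. all: by end_near. Qed.

(** * Construction of the continuous version *)

Section Version.
Context {R : realType} d (T : measurableType d) (P : probability T R) n (i0 : 'I_n)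
  (N : 'I_n -> T -> R) (A B : 'M[R]_n) (t : R).
Hypothesis t_gt0 : 0 < t.
Hypothesis AT : A^T = A.
Hypothesis BT : B^T = B.
Hypothesis BA : B *m A = 1%:M.
Hypothesis NG : gaussian_shift P N A t.
Hypothesis S_gt0 : 0 < totsum A.
Let E := gaussian_expectation_of t_gt0 BT BA NG.
Let kap := normal_peak (Num.sqrt (t / totsum A)).
Let leb := @lebesgue_measure R.
Variable m : 'I_n -> R.
Let X w := sumexp (fun i => m i + N i w).

Let mN : forall i, measurable_fun [set: T] (N i) := proj1 NG.

Let kap_gt0 : 0 < kap.
Proof. by apply: normal_peak_gt0; rewrite gt_eqF// sqrtr_gt0 divr_gt0. Qed.

Let integral_gaussE F : tame F -> (\int[P]_w (F (N ^~ w))%:E)%E = (E F)%:E.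
Proof.
move=> tF; rewrite /E /= /gaussE /Rintegral fineK//.
apply: integrable_fin_num => //; exact: (integrable_tame t_gt0 BT BA NG tF).
Qed.

Let msumexp : vmeasurable (@sumexp R n).
Proof.
by apply: measurable_sum => i; apply: measurableT_comp => //; exact: measurable_tnth.
Qed.

Let mX : measurable_fun [set: T] X.
Proof.
apply: (vmeasurable_comp (N := fun i w => m i + N i w) msumexp) => i.
exact: measurable_funD.
Qed.

(** [psi] of the sum is constant on a level set, so it leaves [cexp]; what remains is
    [disintegration]. *)
Lemma level_integral (psi : R -> R) (G : ('I_n -> R) -> R) :
  measurable_fun [set: R] psi -> (forall x, 0 <= psi x) -> tame G -> (forall y, 0 <= G y) ->
  (\int[P]_w (psi (X w) * G (fun i => m i + N i w))%:E =
   kap%:E * \int[leb]_z (psi (expR z) * cexp E m (- z) G)%:E)%E.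
Proof.
move=> mpsi psi0 tG G0; have [mG _] := tG.
pose H (y : 'I_n -> R) := psi (sumexp y) * G y.
have mH : vmeasurable H by apply: measurable_funM => //; exact: measurableT_comp.
have H0 y : 0 <= H y by exact: mulr_ge0.
have := disintegration i0 t_gt0 AT NG S_gt0 m mH H0; rewrite -/kap => D.
rewrite (_ : (\int[leb]_z _)%E = ((kap^-1)%:E * \int[P]_w (H (fun i => m i + N i w))%:E)%E).
  by rewrite muleA -EFinM mulfV ?mul1e// gt_eqF.
rewrite -D; apply: eq_integral => z _.
rewrite EFinM -integral_gaussE; last exact: (tame_cexp i0 t_gt0 S_gt0).
rewrite -ge0_integralZl//; last first.
- by rewrite lee_fin.
- by move=> w _; rewrite lee_fin mulr_ge0 ?expR_ge0.
- have [mc _] := tame_cexp i0 t_gt0 S_gt0 m (- z) tG.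
  by apply/measurable_EFinP; exact: (vmeasurable_comp mc mN).
apply: eq_integral => w _; rewrite /H -EFinM mulrA.
by rewrite /sumexp (sum_expR_level i0) opprK.
Qed.

Let integral_preimage (A0 : set R) (f : T -> R) :
  (\int[P]_(w in X @^-1` A0) (f w)%:E = \int[P]_w (\1_A0 (X w) * f w)%:E)%E.
Proof.
rewrite integral_mkcond; apply: eq_integral => w _; rewrite patchE indicE.
rewrite (_ : (w \in _) = (X w \in A0)); last by apply/idP/idP; rewrite !inE.
by case: ifP => _; rewrite ?mul1r ?mul0r.
Qed.

Variables (i : 'I_n) (c : R).
Hypothesis c_gt0 : 0 < c.
Let ei : ('I_n -> R) -> R := fun y => expR (y i).
Let Y w := c * expR (m i + N i w).

(** The sum is positive, so the default value [0] for [x <= 0] carries no mass. *)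
Definition regression x : R := if 0 < x then c * avg E m (- ln x) ei else 0.

Let tei : tame ei.
Proof. by apply: tame_expR; exact: lingrowth_coord. Qed.

Let massP L : 0 < mass E m L.
Proof. exact: (mass_gt0 i0 E t_gt0 S_gt0). Qed.

Let cont_avg : continuous (fun L => avg E m L ei).
Proof.
move=> L; apply: cvgM; first exact: (@cexp_expR_continuous _ _ i0 _ _ E t_gt0 S_gt0 m i L).
by apply: cvgV; [rewrite gt_eqF|exact: (@mass_continuous _ _ i0 _ _ E t_gt0 S_gt0 m L)].
Qed.

Lemma measurable_regression : measurable_fun [set: R] regression.
Proof.
apply: measurable_fun_ifT => //; first exact: measurable_fun_ltr.
apply: measurable_funM => //.
apply: (@measurableT_comp _ _ _ _ _ _ (fun L => avg E m L ei)).
  exact: continuous_measurable_fun.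
by apply: measurableT_comp => //; exact: measurable_ln.
Qed.

Lemma continuous_regression : {within [set x | 0 < x], continuous regression}.
Proof.
rewrite continuous_open_subspace; last exact: open_gt.
move=> x; rewrite inE /= => x0.
have H : {for x, continuous (fun x => c * avg E m (- ln x) ei)}.
  apply: cvgM; first exact: cvg_cst.
  apply: (@continuous_comp _ _ _ (fun x => - ln x) (fun L => avg E m L ei)); last exact: cont_avg.
  by apply: cvgN; exact: continuous_ln.
rewrite /continuous_at /regression x0; apply: cvg_trans H.
apply: near_eq_cvg; near=> y; rewrite ifT//; near: y; exact: lt_nbhsr.
Unshelve. all: by end_near. Qed.

Let regression_ge0 x : 0 <= regression x.
Proof.
rewrite /regression; case: ifP => // _; rewrite mulr_ge0 ?(ltW c_gt0)//.
rewrite divr_ge0 ?(ltW (massP _))//.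
have := ler_cexp i0 E t_gt0 S_gt0 m (tame_cst 0) tei (fun y _ => expR_ge0 (y i)) (L := - ln x).
have := cexpZ i0 E t_gt0 S_gt0 m (- ln x) 0 (tame_cst 0).
by under eq_fun do rewrite mul0r; rewrite mul0r => ->.
Qed.

(** [level_integral] computes both integrals, which agree level by level because [cexp] is [avg]
    times [mass]. *)
Lemma cond_exp_version_regression : cond_exp_version P Y X regression.
Proof.
have YE (A0 : set R) : measurable A0 ->
    (\int[P]_(w in X @^-1` A0) (Y w)%:E = \int[P]_(w in X @^-1` A0) (regression (X w))%:E)%E.
  move=> mA0; rewrite !integral_preimage.
  have := level_integral (psi := \1_A0) (G := fun y => c * ei y).
  move=> -> //; last 2 first.
  - exact: tameZ.
  - by move=> y; rewrite mulr_ge0 ?expR_ge0// ltW.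
  have := level_integral (psi := fun x => \1_A0 x * regression x) (G := fun=> 1).
  under eq_integral do rewrite mulr1.
  move=> -> //; last 3 first.
  - by apply: measurable_funM => //; exact: measurable_regression.
  - by move=> x; rewrite mulr_ge0 ?regression_ge0.
  - exact: tame_cst.
  congr (_ * _)%E; apply: eq_integral => z _; congr EFin.
  rewrite (cexpZ i0 E t_gt0 S_gt0)// /regression expR_gt0 expRK -mulrA; congr (_ * _).
  by rewrite -/(mass E m (- z)) /avg -mulrA divfK// gt_eqF.
split => //; first exact: measurable_regression.
apply/integrableP; split.
  by apply/measurable_EFinP; apply: measurableT_comp => //; exact: measurable_regression.
under eq_integral do rewrite /= ger0_norm ?regression_ge0//.
have := YE setT measurableT; rewrite preimage_setT => <-.
have tY : tame (fun v => c * expR (m i + v i)).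
  apply/tameZ/tame_expR/lingrowthD; [exact: lingrowth_cst|exact: lingrowth_coord].
by have := integral_gaussE tY; rewrite /Y => ->; rewrite ltry.
Qed.

(** The logarithm of the sum has density [kap * mass], which is positive; with a zero probability it
    would vanish almost everywhere on []ln a, ln b[], an interval of positive length. *)
Lemma probability_sumexp_gt0 (a b : R) : 0 < a -> a < b -> (0 < P (X @^-1` `]a, b[))%E.
Proof.
move=> a0 ab; set A0 : set R := `]a, b[%classic.
have mA0 : measurable A0 by exact: measurable_itv.
have mXA : measurable (X @^-1` A0) by rewrite -[X in measurable X]setTI; exact: mX.
pose f z := (\1_A0 (expR z) * mass E m (- z))%:E.
have PE : P (X @^-1` A0) = (kap%:E * \int[leb]_z f z)%E.
  have := level_integral (psi := \1_A0) (G := fun=> 1).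
  move=> <- //; last exact: tame_cst.
  by rewrite -(integral_preimage A0 (fun=> 1)) integral_cst// mul1e.
have f0 z : (0 <= f z)%E by rewrite lee_fin mulr_ge0 ?indic_ge0 ?(ltW (massP _)).
have mf : measurable_fun [set: measurableTypeR R] f.
  apply/measurable_EFinP; apply: measurable_funM.
    by apply: measurableT_comp => //; exact: measurable_expR.
  apply: (@measurableT_comp _ _ _ _ _ _ (mass E m)) => //.
  apply: continuous_measurable_fun; exact: (@mass_continuous _ _ i0 _ _ E t_gt0 S_gt0 m).
rewrite PE mule_gt0 ?lte_fin// lt0e integral_ge0// andbT; apply/eqP => If.
have b0 : 0 < b by exact: lt_trans ab.
have : ae_eq leb setT f (cst 0%E).
  apply/(ae_eq_integral_abs _ measurableT mf).
  by under eq_integral do rewrite gee0_abs//.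
move=> [Z [mZ Z0 fZ]].
have : (lebesgue_measure `]ln a, ln b[ <= lebesgue_measure Z)%E.
  apply: le_measure; rewrite ?inE// => z; rewrite /= in_itv/= => /andP[za zb].
  apply: fZ => /(_ I) /eqP; rewrite eqe mulf_eq0 (gt_eqF (massP _)) orbF indicE.
  rewrite mem_set ?oner_eq0//= /A0 /= in_itv/=.
  by rewrite -[X in X < _]lnK ?posrE// -[X in _ && (_ < X)]lnK ?posrE// !ltr_expR za zb.
rewrite Z0 lebesgue_measure_itv/= lte_fin ltr_ln ?posrE// ab -EFinB lee_fin subr_le0.
by rewrite leNgt ltr_ln ?posrE// ab.
Qed.

Lemma cond_exp_version_avg g : cond_exp_version P Y X g ->
  {within [set x | 0 < x], continuous g} ->
  forall x, 0 < x -> g x = c * avg E m (- ln x) ei.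
Proof.
move=> vg cg x x0.
rewrite (cond_exp_version_unique mX probability_sumexp_gt0 vg cg
  cond_exp_version_regression continuous_regression x0).
by rewrite /regression x0.
Qed.

End Version.

(** * The minimal variance portfolio *)

Lemma pos_def_unitmx {R : realType} n (M : 'M[R]_n) : pos_def M -> M \in unitmx.
Proof.
move=> [_ MP]; rewrite -row_free_unit -kermx_eq0; apply/rowV0P => v /sub_kermxP vM.
apply/eqP; apply: contraT => /MP; rewrite vM mul0mx mxE ltxx //.
Qed.

Lemma pos_def_Bbar {R : realType} nb m (B : 'M[R]_(nb + m)) : pos_def B -> pos_def (Bbar B).
Proof.
move=> [BT BP]; split; first by rewrite /Bbar trmx_ulsub BT.
move=> v v0; have := BP (row_mx v 0).
rewrite -[X in row_mx v 0 *m X]submxK mul_row_block !mul0mx !addr0.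
rewrite tr_row_mx trmx0 mul_row_col mulmx0 addr0.
by apply; apply: contra v0 => /eqP /(congr1 lsubmx); rewrite row_mxKl => ->; rewrite linear0.
Qed.

Lemma mulmx_dotv {R : realType} n (M : 'M[R]_n) (v w : 'rV[R]_n) :
  (v *m M *m w^T) 0 0 = dotv (v 0) (mulv M (w 0)).
Proof.
rewrite -mulmxA mxE; apply: eq_bigr => i _; rewrite mxE; congr (_ * _).
by apply: eq_bigr => j _; rewrite mxE.
Qed.

Lemma pos_def_dotv {R : realType} n (M : 'M[R]_n) (v : 'I_n -> R) :
  pos_def M -> (exists i, v i != 0) -> 0 < dotv v (mulv M v).
Proof.
move=> [_ MP] [i vi]; have /MP : \row_j v j != 0.
  by apply: contra vi => /eqP /rowP /(_ i); rewrite !mxE => ->.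
rewrite mulmx_dotv (_ : (\row_j v j) 0 = v)//.
by apply/funext => j; rewrite mxE.
Qed.

Section SimplexMinimizer.
Context {R : realType} {n : nat} (B : 'M[R]_n) (wbar : 'rV[R]_n).
Hypothesis BT : B^T = B.
Hypothesis wmin : simplex_minimizer B wbar.
Let wb := wbar 0.
Let q := dotv wb (mulv B wb).

Let wb_ge0 i : 0 <= wb i.
Proof. by case: wmin => [[+ _] _]; exact. Qed.

Let wb_sum : \sum_i wb i = 1.
Proof. by case: wmin => [[_ +] _]. Qed.

(** First variation along the segment from [wb] to the vertex [i]. *)
Lemma simplex_minimizer_ge i : q <= mulv B wb i.
Proof.
pose dl k := (k == i)%:R - wb k.
pose c := dotv dl (mulv B dl).
have one v : dotv (fun k => (k == i)%:R) v = v i.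
  rewrite /dotv (bigD1 i)//= eqxx mul1r big1 ?addr0// => k /negbTE ->.
  by rewrite mul0r.
have dlE : dotv dl (mulv B wb) = mulv B wb i - q.
  by rewrite dotvC dotvB dotvC one (dotvC _ wb).
have H s : 0 <= s <= 1 -> 0 <= s * (2 * (mulv B wb i - q) + s * c).
  move=> /andP[s0 s1]; pose w := \row_k (wb k + s * dl k).
  have sw : simplex w.
    split=> [k|]; first last.
      under eq_bigr do rewrite mxE; rewrite big_split /= -big_distrr /= sumrB wb_sum.
      rewrite (bigD1 i)//= eqxx big1 ?addr0 ?subrr ?mulr0 ?addr0// => k /negbTE ->//.
    rewrite mxE /dl (_ : _ + _ = (1 - s) * wb k + s * (k == i)%:R); last by ring.
    by rewrite addr_ge0// mulr_ge0// subr_ge0.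
  have [_ /(_ _ sw)] := wmin; rewrite /qform !mulmx_dotv -/wb -/q.
  have -> : w 0 = fun k => wb k + s * dl k by apply/funext => k; rewrite mxE.
  have -> : mulv B (fun k => wb k + s * dl k) = fun k => mulv B wb k + s * mulv B dl k.
    by apply/funext => k; rewrite mulvD mulvZ.
  have dlW : dotv wb (mulv B dl) = mulv B wb i - q by rewrite (dotv_mulv _ _ BT) dotvC.
  have -> : dotv (fun k => wb k + s * dl k) (fun k => mulv B wb k + s * mulv B dl k) =
      q + s * (2 * (mulv B wb i - q) + s * c).
    rewrite dotvD dotvZ (dotvC _ (mulv B wb)) dotvD dotvZ (dotvC (mulv B wb) dl) dlE.
    rewrite (dotvC (mulv B wb)) -/q (dotvC _ (mulv B dl)) dotvD dotvZ.
    rewrite (dotvC (mulv B dl) wb) dlW (dotvC (mulv B dl) dl) -/c; ring.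
  by rewrite lerDl.
rewrite leNgt; apply/negP => bq.
pose a := q - mulv B wb i; have a0 : 0 < a by rewrite subr_gt0.
have c1 : 0 < `|c| + a by rewrite ltr_wpDl.
(* For this [s], at most [1], the second-order term [s * c] is at most [a], while the first-order
   term is [- 2 a]. *)
pose s := a / (`|c| + a).
have s0 : 0 < s by rewrite divr_gt0.
have s1 : s <= 1 by rewrite ler_pdivrMr// mul1r lerDr.
have := H s; rewrite (ltW s0) s1 => /(_ isT); rewrite pmulr_rge0//.
have : s * c <= a.
  apply: (@le_trans _ _ (s * `|c|)); first by rewrite ler_pM2l// ler_norm.
  apply: (@le_trans _ _ (s * (`|c| + a))); first by rewrite ler_pM2l// lerDl ltW.
  by rewrite /s divfK// gt_eqF.
rewrite /a in a0 *; lra.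
Qed.

(** Complementary slackness: the terms [wb_k ((B wb)_k - q)] are non-negative and sum to [0]. *)
Lemma simplex_minimizer_eq i : wb i != 0 -> mulv B wb i = q.
Proof.
have S0 : \sum_k wb k * (mulv B wb k - q) = 0.
  under eq_bigr do rewrite mulrBr.
  by rewrite sumrB -big_distrl /= wb_sum mul1r -/(dotv _ _) subrr.
have /psumr_eq0P H k : true -> 0 <= wb k * (mulv B wb k - q).
  by move=> _; rewrite mulr_ge0// subr_ge0 simplex_minimizer_ge.
move=> wi; have /eqP := H S0 i isT; rewrite mulf_eq0 (negbTE wi)/= subr_eq0.
by move/eqP.
Qed.

End SimplexMinimizer.

Lemma expR_dist1_le {R : realType} (x : R) : `|x| <= 1 / 2 -> `|expR x - 1| <= 2 * `|x|.
Proof.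
move=> x2; have x1 := expR_ge1Dx x; have x3 := expR_ge1Dx (- x).
have e0 := expR_gt0 x.
have ee : expR (- x) * expR x = 1 by rewrite -expRD addNr expR0.
have [xp|xn] := leP 0 x.
  rewrite (ger0_norm xp) in x2 *; rewrite ger0_norm; last by lra.
  have := ler_wpM2r (ltW e0) x3; rewrite ee => H.
  have H1 : expR x <= 2.
    have : 0 <= expR x * (1 / 2 - x) by rewrite mulr_ge0 ?subr_ge0 // ltW.
    lra.
  have := mulr_ge0 xp (_ : 0 <= 2 - expR x); rewrite subr_ge0 => /(_ H1); lra.
rewrite (ltr0_norm xn) ler0_norm; first by lra.
by rewrite subr_le0 -expR0 ler_expR ltW.
Qed.

Lemma bigO_loginv_ln {R : realType} (g F a T : R -> R) (K : R) : 0 < K ->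
  (forall L, 0 < a L) ->
  (forall x, 0 < x -> g x = K * a (- ln x)) ->
  (forall x, 0 < x -> F x = K * expR (T (- ln x))) ->
  (exists2 C, 0 <= C & exists2 L0, 1 <= L0 & forall L, L0 <= L -> `|ln (a L) - T L| <= C / L) ->
  bigO_loginv_at0 g F.
Proof.
move=> K0 a0 gE FE [C C0 [L0 L01 H]].
(* Below this bound [L] exceeds [L0 + 2 * C], so the error of the logarithm is at most [1 / 2] and
   [expR_dist1_le] makes it a relative error. *)
exists (2 * C), (expR (- (L0 + 2 * C))); split=> [|x /andP[x0 xd]]; first exact: expR_gt0.
have : L0 + 2 * C < - ln x by rewrite ltrNr -ltr_expR lnK ?posrE.
rewrite lnV ?posrE// gE// FE//; move: (- ln x) => L LL.
have L0L : L0 <= L by lra.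
have Lp : 0 < L by lra.
have D : `|ln (a L) - T L| <= C / L by exact: H.
have D2 : `|ln (a L) - T L| <= 1 / 2.
  by apply: (le_trans D); rewrite ler_pdivrMr//; lra.
have -> : K * a L - K * expR (T L) = K * expR (T L) * (expR (ln (a L) - T L) - 1).
  by rewrite mulrBr mulr1 -mulrA -expRD addrCA subrr addr0 lnK ?posrE.
rewrite normrM.
have -> : 2 * C * `|K * expR (T L)| / L = `|K * expR (T L)| * (2 * (C / L)) by ring.
by apply: ler_wpM2l => //; apply: (le_trans (expR_dist1_le D2)); rewrite ler_pM2l.
Qed.

Lemma bigO_loginv_scaled {R : realType} (g F a : R -> R) (K w : R) : 0 < w ->
  (forall x, 0 < x -> g x = K * x * a (- ln x)) ->
  (forall x, 0 < x -> F x = K * x * w) ->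
  (exists2 C, 0 <= C & forall L, 1 <= L -> `|a L - w| <= C / L) ->
  bigO_loginv_at0 g F.
Proof.
move=> w0 gE FE [C C0 H].
exists (C / w), (expR (- 1)); split=> [|x /andP[x0 xd]]; first exact: expR_gt0.
have : 1 < - ln x by rewrite ltrNr -ltr_expR lnK ?posrE.
rewrite lnV ?posrE// gE// FE//; move: (- ln x) => L LL.
have Lp : 0 < L by lra.
rewrite -mulrBr !normrM (gtr0_norm w0).
have -> : C / w * (`|K| * `|x| * w) / L = `|K| * `|x| * (C / L) by field; rewrite !gt_eqF.
by apply: ler_wpM2l; rewrite ?mulr_ge0//; apply: H; exact: ltW.
Qed.

Section Minimizer.
Context {R : realType} {nb m : nat} (B : 'M[R]_(nb + m)) (wbar : 'rV[R]_(nb + m)).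
Hypothesis BP : pos_def B.
Hypothesis wmin : simplex_minimizer B wbar.
Hypothesis supp : forall i : 'I_(nb + m), (wbar 0 i != 0) = (i < nb)%N.
Let wb := wbar 0.
Let q := dotv wb (mulv B wb).
Let BT : B^T = B := proj1 BP.

Lemma minimizer_off (j : 'I_m) : wb (rshift nb j) = 0.
Proof. by apply/eqP; rewrite -[_ == _]negbK supp /= -leqNgt leq_addr. Qed.

Lemma minimizer_on (p : 'I_nb) : 0 < wb (lshift m p).
Proof.
have [[w0 _] _] := wmin; rewrite lt_neqAle w0 andbT eq_sym supp /=; exact: ltn_ord.
Qed.

Lemma minimizer_q_gt0 : 0 < q.
Proof.
apply: pos_def_dotv => //; have [[_ ws] _] := wmin.
apply/existsP; apply: contraT; rewrite negb_exists => /forallP H.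
have : (1 : R) = 0 by rewrite -ws big1// => i _; apply/eqP; have := H i; rewrite negbK.
by move/eqP; rewrite oner_eq0.
Qed.

Lemma abar_sym p r : abar B p r = abar B r p.
Proof.
have : (abar B)^T = abar B by rewrite /abar trmx_inv /Bbar trmx_ulsub BT.
by move=> /matrixP /(_ p r) <-; rewrite mxE.
Qed.

Lemma Bbar_unit : Bbar B \in unitmx.
Proof. exact/pos_def_unitmx/pos_def_Bbar. Qed.

(** On [Ibar] the first-order conditions read [Bbar u = q (1,...,1)], and [Bbar] is invertible. *)
Lemma minimizer_lshift p : wb (lshift m p) = q * Abar B p.
Proof.
pose u := \col_p wb (lshift m p).
have : Bbar B *m u = const_mx q.
  apply/colP => r; rewrite !mxE.
  transitivity (mulv B wb (lshift m r)); last first.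
    by apply: (simplex_minimizer_eq BT wmin); rewrite gt_eqF// minimizer_on.
  rewrite /mulv big_split_ord /= [X in _ + X]big1 ?addr0.
    by apply: eq_bigr => j _; rewrite !mxE.
  by move=> j _; rewrite -/wb minimizer_off mulr0.
move=> /(congr1 (mulmx (abar B))); rewrite mulmxA mulVmx ?Bbar_unit// mul1mx => /colP /(_ p).
rewrite !mxE => ->; rewrite /Abar big_distrr; apply: eq_bigr => j _ /=.
by rewrite mxE mulrC.
Qed.

Lemma minimizer_Sbar : q * Sbar B = 1.
Proof.
have [[_ <-] _] := wmin; rewrite big_split_ord /= [X in _ + X]big1 ?addr0; last first.
  by move=> j _; exact: minimizer_off.
by rewrite /Sbar big_distrr; apply: eq_bigr => p _; exact/esym/minimizer_lshift.
Qed.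

Lemma minimizer_Abar p : Abar B p / Sbar B = wb (lshift m p).
Proof.
have := minimizer_Sbar => H; have S0 : Sbar B != 0.
  by apply/eqP => S0; move: H; rewrite S0 mulr0 => /eqP; rewrite eq_sym oner_eq0.
apply: (mulIf S0); rewrite divfK// minimizer_lshift mulrAC -[q * _]/(q * _) H mul1r //.
Qed.

(** The number that assumption (A) makes non-zero is [(B wb)_j - q], which is non-negative by
    minimality. *)
Lemma minimizer_rshift_gt (j : 'I_m) : assumptionA B wbar -> q < mulv B wb (rshift nb j).
Proof.
move=> /(_ j); rewrite mulmx_dotv dotvC => H.
have : mulv B wb (rshift nb j) - q != 0.
  apply: contra H => /eqP H; apply/eqP.
  rewrite (_ : fun_of_matrix (delta_mx 0 (rshift nb j) - wbar) 0 =
    fun k => (k == rshift nb j)%:R - wb k); last first.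
    by apply/funext => k; rewrite !mxE eqxx.
  rewrite dotvB -[X in X - _]dotvC -[X in _ - X]dotvC -/q -[RHS]H; congr (_ - _).
  rewrite /dotv (bigD1 (rshift nb j))//= eqxx mul1r big1 ?addr0// => k /negbTE ->.
  by rewrite mul0r.
rewrite subr_eq0 => neq; rewrite lt_neqAle eq_sym neq /=.
exact: simplex_minimizer_ge.
Qed.

End Minimizer.

(** It is the quadratic form of [B] at [rowsum A], since [B (A 1) = 1]; [i0] excludes dimension
    zero. *)
Lemma totsum_gt0 {R : realType} n (i0 : 'I_n) (A B : 'M[R]_n) :
  pos_def B -> A^T = A -> B *m A = 1%:M -> 0 < totsum A.
Proof.
move=> BP AT BA; have BAone : mulv B (rowsum A) = fun=> 1 by rewrite /rowsum mulvM BA mulv1.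
have := pos_def_dotv (v := rowsum A) BP; rewrite BAone dotvC; apply.
apply/existsP; apply: contraT; rewrite negb_exists => /forallP H.
have := congr1 (fun f => f i0) BAone; rewrite /= /mulv big1 => [/esym/eqP|j _].
  by rewrite oner_eq0.
by have := H j; rewrite negbK => /eqP ->; rewrite mulr0.
Qed.

(** * Regression of an asset on the minimal portfolio *)

Section Regression.
Context {R : realType} {nb m : nat} (B : 'M[R]_(nb + m)) (i : 'I_(nb + m)).
Hypothesis BP : pos_def B.
Let BT : B^T = B := proj1 BP.

(* Coefficients of the regression of asset [i] on the assets of the minimal portfolio. *)
Definition regcoef : 'I_(nb + m) -> R :=
  row_mx (\row_p \sum_q abar B p q * B (lshift m q) i) 0 0.

Lemma regcoef_lshift p : regcoef (lshift m p) = \sum_q abar B p q * B (lshift m q) i.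
Proof. by rewrite /regcoef row_mxEl mxE. Qed.

Lemma regcoef_rshift j : regcoef (rshift nb j) = 0.
Proof. by rewrite /regcoef row_mxEr mxE. Qed.

Lemma mulv_regcoef (k : 'I_(nb + m)) :
  mulv B regcoef k = \sum_p B k (lshift m p) * regcoef (lshift m p).
Proof.
rewrite /mulv big_split_ord /= [X in _ + X]big1 ?addr0// => j _.
by rewrite regcoef_rshift mulr0.
Qed.

Lemma mulv_regcoef_lshift p : mulv B regcoef (lshift m p) = B (lshift m p) i.
Proof.
pose b := \col_q B (lshift m q) i.
have /colP /(_ p) : Bbar B *m (abar B *m b) = b by rewrite mulmxA mulmxV ?mul1mx ?Bbar_unit.
rewrite !mxE mulv_regcoef => {1}<-; apply: eq_bigr => q _.
rewrite !mxE regcoef_lshift; congr (_ * _).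
by apply: eq_bigr => r _; rewrite mxE.
Qed.

Lemma mulv_delta (k l : 'I_(nb + m)) : mulv B (fun j => (j == l)%:R) k = B k l.
Proof.
rewrite /mulv (bigD1 l)//= eqxx mulr1 big1 ?addr0// => j /negbTE ->.
by rewrite mulr0.
Qed.

Lemma dotv_delta (l : 'I_(nb + m)) (v : 'I_(nb + m) -> R) : dotv (fun j => (j == l)%:R) v = v l.
Proof.
rewrite /dotv (bigD1 l)//= eqxx mul1r big1 ?addr0// => j /negbTE ->.
by rewrite mul0r.
Qed.

Let alpha k := (k == i)%:R - regcoef k.

Lemma mulv_alpha_lshift p : mulv B alpha (lshift m p) = 0.
Proof. by rewrite mulvB mulv_delta mulv_regcoef_lshift subrr. Qed.

Lemma regcoef_dotv v : dotv regcoef v = \sum_p regcoef (lshift m p) * v (lshift m p).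
Proof.
rewrite /dotv big_split_ord /= [X in _ + X]big1 ?addr0// => j _.
by rewrite regcoef_rshift mul0r.
Qed.

Lemma dotv_alpha v : dotv alpha v = v i - \sum_p regcoef (lshift m p) * v (lshift m p).
Proof. by rewrite dotvC dotvB dotvC dotv_delta dotvC regcoef_dotv. Qed.

(** [B alpha] vanishes on [Ibar] and [regcoef] off it, so only coordinate [i] counts; the value is
    the residual variance of the regression. *)
Lemma dotv_alpha_mulv : dotv alpha (mulv B alpha) =
  B i i - \sum_p \sum_q abar B p q * B (lshift m p) i * B (lshift m q) i.
Proof.
rewrite dotv_alpha big1 ?subr0; last by move=> p _; rewrite mulv_alpha_lshift mulr0.
rewrite mulvB mulv_delta mulv_regcoef; congr (_ - _); apply: eq_bigr => p _.
rewrite regcoef_lshift big_distrr; apply: eq_bigr => q _ /=.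
by rewrite (_ : B i (lshift m p) = B (lshift m p) i); [ring|rewrite -{1}BT mxE].
Qed.

(** This sum is the exponent of [x]: in [ln_avg_expR] it multiplies [- L = ln x]. *)
Lemma sum_regcoef : \sum_p regcoef (lshift m p) = \sum_q Abar B q * B i (lshift m q).
Proof.
under eq_bigr do rewrite regcoef_lshift.
rewrite exchange_big; apply: eq_bigr => q _ /=; rewrite /Abar big_distrl.
apply: eq_bigr => p _ /=; rewrite (abar_sym BP); congr (_ * _).
by rewrite -{1}BT mxE.
Qed.

Lemma sum_regcoef_mul (f : 'I_nb -> R) :
  \sum_p \sum_q B (lshift m p) i * abar B p q * f q = \sum_q regcoef (lshift m q) * f q.
Proof.
rewrite exchange_big; apply: eq_bigr => q _ /=.
rewrite -big_distrl regcoef_lshift /=; congr (_ * _).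
by apply: eq_bigr => p _; rewrite mulrC (abar_sym BP).
Qed.

End Regression.

(** A conditional expectation is determined up to null sets only, so its value at [x] is read off a
    version continuous on [x > 0]: the first conjunct provides one, and the expansions hold for
    every such version. *)
Theorem theorem4 (R : realType) (nb m : nat)
  (B C : 'M[R]_(nb + m)) (S0 theta xi : 'I_(nb + m) -> R) (t : R)
  (wbar : 'rV[R]_(nb + m))
  (d : measure_display) (T : measurableType d) (P : probability T R)
  (W : 'I_(nb + m) -> T -> R) :
  pos_def B -> is_psd_sqrt B C ->
  (forall i, 0 < S0 i) -> (forall i, 0 < xi i) -> 0 < t ->
  (forall j, measurable_fun setT (W j)) ->
  (forall j (A : set R), measurable A ->
     P (W j @^-1` A) = normal_prob 0 (Num.sqrt t) A) ->
  mutually_independent P W ->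
  simplex_minimizer B wbar ->
  (forall i : 'I_(nb + m), (wbar 0 i != 0) = (i < nb)%N) ->
  assumptionA B wbar ->
  let S := priceS S0 theta B C t W in
  let X := fun w => \sum_k xi k * S k w in
  (forall i, exists g : R -> R,
      cond_exp_version P (S i) X g /\ {within [set x | 0 < x], continuous g}) /\
  (forall (i : 'I_(nb + m)) (g : R -> R),
      cond_exp_version P (S i) X g -> {within [set x | 0 < x], continuous g} ->
      (forall p : 'I_nb, i = lshift m p ->
         bigO_loginv_at0 g (fun x => x / xi i * (Abar B p / Sbar B)) /\
         bigO_loginv_at0 g (fun x => x * wbar 0 i / xi i)) /\
      (forall j : 'I_m, i = rshift nb j ->
         bigO_loginv_at0 g (fun x =>
           x `^ (\sum_(q < nb) Abar B q * B i (lshift m q)) * S0 i *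
           expR (theta i * t -
             \sum_(p < nb) \sum_(q < nb) B (lshift m p) i * abar B p q *
               (ln (Sbar B / Abar B q) + mu_t S0 theta xi B t (lshift m q))) *
           expR (- (t / 2) *
             \sum_(p < nb) \sum_(q < nb) abar B p q * B (lshift m p) i * B (lshift m q) i)))).
Proof.
move=> BP [CT CC _] S0_gt0 xi_gt0 t_gt0 mW nW iW wmin supp asA S X.
have BT : B^T = B := proj1 BP.
have Bu := pos_def_unitmx BP.
pose A := invmx B.
have AT : A^T = A by rewrite /A trmx_inv BT.
have AB : A *m B = 1%:M by exact: mulVmx.
have BA : B *m A = 1%:M by exact: mulmxV.
have NG := gaussian_shift_linear t_gt0 mW nW iW CT AT CC BA.
set N := (fun i w => mulv C (W ^~ w) i) in NG.
(* [mu_t] contains [ln (xi i)], so [X] is the sum of the exponentials of [mu + N], and [S i] is one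
   of them divided by [xi i]. *)
pose mu := mu_t S0 theta xi B t.
have SE i w : xi i * S i w = expR (mu i + N i w).
  rewrite (_ : mu i + N i w = ln (S0 i) + (ln (xi i) + (theta i * t - t / 2 * B i i + N i w))).
    by rewrite 2!expRD !lnK ?posrE// mulrCA.
  by rewrite /mu /mu_t (gtr0_norm (xi_gt0 i)); ring.
have XE : X = fun w => sumexp (fun i => mu i + N i w).
  by apply/funext => w; apply: eq_bigr => i _.
have YE i : S i = fun w => (xi i)^-1 * expR (mu i + N i w).
  by apply/funext => w; rewrite -SE mulrA mulVf ?mul1r// gt_eqF.
have xiV i : 0 < (xi i)^-1 by rewrite invr_gt0.
pose E := gaussian_expectation_of t_gt0 BT BA NG.
split=> [i|i g].
  have ST := totsum_gt0 i BP AT BA.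
  exists (regression t_gt0 BT BA NG mu i (xi i)^-1); split.
    by rewrite YE XE; exact: (cond_exp_version_regression i t_gt0 AT BT BA NG ST mu i (xiV i)).
  exact: (@continuous_regression _ _ _ _ _ i _ _ _ _ _ _ _ _ ST).
have ST := totsum_gt0 i BP AT BA.
rewrite YE XE => vg cg.
have gE := cond_exp_version_avg i t_gt0 AT BT BA NG ST (xiV i) vg cg.
rewrite -/E in gE.
set wb := wbar 0.
have wb_ge0 k : 0 <= wb k by case: wmin => [[+ _] _]; exact.
have wb_sum : \sum_k wb k = 1 by case: wmin => [[_ +] _].
have wb_eq := simplex_minimizer_eq BT wmin.
have wb_gt k : wb k = 0 -> dotv wb (mulv B wb) < mulv B wb k.
  have [p ->|j -> _] := split_ordP k; last exact: minimizer_rshift_gt.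
  by move=> w0; have := minimizer_on wmin supp p; rewrite -/wb w0 ltxx.
have q_gt0 := minimizer_q_gt0 BP wmin.
have BPv := pos_def_dotv (M := B) ^~ BP.
split=> [p ip|j ij].
- have wi : 0 < wbar 0 i by rewrite ip; exact: (minimizer_on wmin supp).
  have [K K0 HK] := avg_softmax i E t_gt0 AT BT BA ST BPv wb_ge0 wb_sum wb_eq wb_gt q_gt0 mu.
  (* At [L = - ln x], [expR (y i + L)] is [expR (y i) / x], which brings out the factor [x]. *)
  have gE' x : 0 < x -> g x = (xi i)^-1 * x *
      (fun L => avg E mu L (fun y => expR (y i + L))) (- ln x).
    move=> x0; rewrite gE// -mulrA; congr (_ * _).
    have -> : (fun y : 'I_(nb + m) -> R => expR (y i + - ln x)) = fun y => x^-1 * expR (y i).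
      by apply/funext => y; rewrite expRD -lnV ?posrE// lnK ?posrE ?invr_gt0// mulrC.
    rewrite (avgZ i E)// ?mulVKf ?gt_eqF//.
    by apply: tame_expR; exact: lingrowth_coord.
  have HK' : exists2 C, 0 <= C & forall L, 1 <= L ->
      `|avg E mu L (fun y => expR (y i + L)) - wbar 0 i| <= C / L.
    by exists K => // L L1; exact: HK.
  split; apply: (bigO_loginv_scaled wi gE' _ HK') => x x0; last by rewrite [LHS]mulrC mulrA.
  by rewrite (minimizer_Abar BP wmin supp) -ip mulrAC [LHS]mulrC mulrA.
- have c0 k : wb k = 0 -> regcoef B i k = 0.
    have [p ->|l -> _] := split_ordP k; last exact: regcoef_rshift.
    by move=> w0; have := minimizer_on wmin supp p; rewrite -/wb w0 ltxx.
  have a0 k : wb k != 0 -> mulv B (fun l => (l == i)%:R - regcoef B i l) k = 0.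
    have [p -> _|l ->] := split_ordP k; first exact: mulv_alpha_lshift.
    by rewrite /wb (minimizer_off supp) eqxx.
  have HK := ln_avg_expR i E t_gt0 AT BT AB BA ST BPv wb_ge0 wb_sum wb_eq wb_gt q_gt0
    mu (j := i) (c := regcoef B i) c0 a0.
  apply: (bigO_loginv_ln (xiV i) _ gE _ HK) => [L|x x0].
    have -> : (fun y : 'I_(nb + m) -> R => expR (y i)) =
        fun y => expR (dotv (fun k => (k == i)%:R) y).
      by apply/funext => y; rewrite dotv_delta.
    exact: (avg_expR_gt0 i E).
  rewrite sum_regcoef_mul// -sum_regcoef//.
  pose c q := regcoef B i (lshift m q).
  have SA q : ln (Sbar B / Abar B q) = - ln (wb (lshift m q)).
    rewrite /wb -(minimizer_Abar BP wmin supp) -lnV ?invf_div// posrE.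
    rewrite (minimizer_Abar BP wmin supp); exact: (minimizer_on wmin supp).
  rewrite (dotv_alpha B i) (dotv_alpha_mulv i BP).
  rewrite /powR gt_eqF// -/mu.
  have -> : \sum_k regcoef B i k * (ln (wb k) - - ln x) =
      \sum_q c q * ln (wb (lshift m q)) + ln x * \sum_q c q.
    rewrite -/(dotv _ _) regcoef_dotv big_distrr -big_split; apply: eq_bigr => q _ /=.
    by rewrite /c; ring.
  have -> : \sum_q regcoef B i (lshift m q) * (ln (Sbar B / Abar B q) + mu (lshift m q)) =
      \sum_q c q * mu (lshift m q) - \sum_q c q * ln (wb (lshift m q)).
    by rewrite -sumrB; apply: eq_bigr => q _; rewrite SA -/(c q); ring.
  rewrite (_ : \sum_p regcoef B i (lshift m p) = \sum_q c q)//.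
  rewrite (_ : \sum_p regcoef B i (lshift m p) * mu (lshift m p) = \sum_q c q * mu (lshift m q))//.
  (* The term [- B i i * t / 2] cancels the [B i i] of the residual variance, and [ln (xi i)]
     cancels the factor [(xi i)^-1]. *)
  have muE : mu i = ln (S0 i) + ln (xi i) + theta i * t - B i i * t / 2.
    by rewrite /mu /mu_t (gtr0_norm (xi_gt0 i)).
  rewrite muE -[S0 i in LHS](lnK (S0_gt0 i)) -[(xi i)^-1](lnK (xiV i)) lnV ?posrE//.
  rewrite -!expRD; congr expR; ring.
Qed.
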